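(* Let $Q$ be a finite quiver without oriented cycles with $n$ vertices. Any $\alpha\in\mathbb{Z}^n$ has a unique decomposition (up to reordering of the $\beta_i$) of the form $$\alpha=\beta_1+\beta_2+\cdots+\beta_k-(E^t)^{-1}\gamma$$ where (1) $\beta_1,\dots,\beta_k,\gamma\in\mathbb{N}^n$; (2) $\beta_i$ and $\gamma$ have disjoint support for all $i$; (3) $\mathrm{ext}_Q(\beta_i,\beta_j)=0$ for all $i\neq j$; (4) each $\beta_j$ is a Schur root. Furthermore, the general element $f:P_1\to P_0$ of the canonical presentation space $R^{can}(\alpha)$, regarded as a two-term complex of projectives, is homotopy equivalent to a direct sum of projective complexes which are either (i) minimal projective resolutions of indecomposable modules $M_j$ with $\underline{\dim}\,M_j=\beta_j$, or (ii) complexes of the form $P(v_i)[1]=(P(v_i)\to 0)$ with $\underline{\dim}\,P(v_i)[1]=-(E^t)^{-1}e_{v_i}$.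
   Context: $\Bbbk$ is an algebraically closed field, $\mathbb{N}$ includes $0$. $Q_0$, $Q_1$ are the vertices and arrows of $Q$, $n=|Q_0|$. Representations are finite dimensional over $\Bbbk$ and identified with modules over $\Bbbk Q$; $\underline{\dim}\,M=(\dim M_v)_v\in\mathbb{N}^n$. The support of a vector is the set of vertices at which it is nonzero. $e_v$ is the unit vector at $v$. $P(v)$ is the indecomposable projective representation at $v$ (with $P(v)_u$ having basis the paths from $v$ to $u$), and $P(\gamma)=\coprod_v P(v)^{\gamma_v}$ for $\gamma\in\mathbb{N}^n$. The Euler matrix $E$ is the $n\times n$ matrix with $E_{v,v}=1$ and $E_{u,v}=-(\text{number of arrows } u\to v)$ for $u\ne v$. One has $\underline{\dim}\,P(\gamma)=(E^t)^{-1}\gamma$. $R(\beta)=\prod_{(u\to v)\in Q_1}\mathrm{Hom}_\Bbbk(\Bbbk^{\beta_u},\Bbbk^{\beta_v})$. A vector $\beta\in\mathbb{N}^n$ is a Schur root if the general representation in $R(\beta)$ is indecomposable. For $\beta,\beta'\in\mathbb{N}^n$, $\mathrm{ext}_Q(\beta,\beta')$ is the minimum of $\dim_\Bbbk \mathrm{Ext}^1_Q(B,B')$ over representations $B,B'$ with $\underline{\dim}\,B=\beta$, $\underline{\dim}\,B'=\beta'$. For $\gamma_0,\gamma_1\in\mathbb{N}^n$ the presentation space is $R(\gamma_0,\gamma_1)=\mathrm{Hom}_Q(P(\gamma_1),P(\gamma_0))$. For each $\alpha\in\mathbb{Z}^n$ there are unique $\mu,\gamma\in\mathbb{N}^n$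 with disjoint supports such that $\alpha=\mu-(E^t)^{-1}\gamma$; also $\mu-E^t\mu\in\mathbb{N}^n$. The canonical presentation space is $R^{can}(\alpha)=R(\mu,\mu-E^t\mu+\gamma)$. A statement holds for the general element of an affine space if it holds for all elements of some nonempty Zariski open subset. *)

(* Defs.v *)
From HB Require Import structures.
From mathcomp Require Import all_boot all_algebra.
From mathcomp Require Import mpoly.

Set Implicit Arguments.
Unset Strict Implicit.
Unset Printing Implicit Defensive.

Import GRing.Theory.
Local Open Scope ring_scope.

(* Products of finite families of finite-dimensional vector spaces; the
   library has the instances only for constant families. *)

Record dprod (k : fieldType) (I : finType) (V : I -> vectType k) : Type :=
  DProd { dprod_val : {dffun forall i : I, V i} }.

Definition dapp (k : fieldType) (I : finType) (V : I -> vectType k)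
  (x : dprod V) (i : I) : V i := dprod_val x i.
Coercion dapp : dprod >-> Funclass.

Definition dmk (k : fieldType) (I : finType) (V : I -> vectType k)
  (x : forall i, V i) : dprod V := DProd (finfun x).

Section DProd.
Import VectorInternalTheory.
Variables (k : fieldType) (I : finType) (V : I -> vectType k).
Implicit Types x y z : dprod V.

Lemma dmkE (x : forall i, V i) i : dmk x i = x i.
Proof. exact: ffunE. Qed.

Lemma dprodP x y : (forall i, x i = y i) <-> x = y.
Proof.
split=> [|-> //]; case: x y => [x] [y] xy; congr DProd; exact/ffunP.
Qed.

HB.instance Definition _ := [isNew for @dprod_val k I V].
HB.instance Definition _ := [Choice of dprod V by <:].

Let zerod : dprod V := dmk (fun=> 0).
Let oppd x : dprod V := dmk (fun i => - x i).
Let addd x y : dprod V := dmk (fun i => x i + y i).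
Let scaled (c : k) x : dprod V := dmk (fun i => c *: x i).

Fact dprod_addA : associative addd.
Proof. by move=> x y z; apply/dprodP=> i; rewrite !dmkE addrA. Qed.
Fact dprod_addC : commutative addd.
Proof. by move=> x y; apply/dprodP=> i; rewrite !dmkE addrC. Qed.
Fact dprod_add0 : left_id zerod addd.
Proof. by move=> x; apply/dprodP=> i; rewrite !dmkE add0r. Qed.
Fact dprod_addN : left_inverse zerod oppd addd.
Proof. by move=> x; apply/dprodP=> i; rewrite !dmkE addNr. Qed.

HB.instance Definition _ := GRing.isZmodule.Build (dprod V)
  dprod_addA dprod_addC dprod_add0 dprod_addN.

Fact dprod_scaleA a b x : scaled a (scaled b x) = scaled (a * b) x.
Proof. by apply/dprodP=> i; rewrite !dmkE scalerA. Qed.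
Fact dprod_scale1 : left_id 1 scaled.
Proof. by move=> x; apply/dprodP=> i; rewrite !dmkE scale1r. Qed.
Fact dprod_scaleDr : right_distributive scaled +%R.
Proof. by move=> a x y; apply/dprodP=> i; rewrite !dmkE scalerDr. Qed.
Fact dprod_scaleDl x : {morph scaled^~ x : a b / a + b}.
Proof. by move=> a b; apply/dprodP=> i; rewrite !dmkE scalerDl. Qed.

HB.instance Definition _ := GRing.Zmodule_isLmodule.Build k (dprod V)
  dprod_scaleA dprod_scale1 dprod_scaleDr dprod_scaleDl.

Lemma dprodD x y i : dapp (x + y) i = x i + y i.
Proof. exact: dmkE. Qed.
Lemma dprodZ a x i : dapp (a *: x) i = a *: x i.
Proof. exact: dmkE. Qed.

Fact dprod_vect : Vector.axiom (dim {ffun {i : I & 'I_(dim (V i))} -> k^o})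
                               (dprod V).
Proof.
pose c (x : dprod V) : {ffun {i : I & 'I_(dim (V i))} -> k^o} :=
  [ffun y => v2r (x (tag y)) 0 (tagged y)].
pose d (z : {ffun {i : I & 'I_(dim (V i))} -> k^o}) : dprod V :=
  dmk (fun i => r2v (\row_j z (Tagged _ j))).
exists (fun x => v2r (c x)) => [a x y|].
  rewrite -linearP; congr v2r; apply/ffunP => -[i j].
  rewrite ffunE. rewrite dprodD dprodZ linearP [RHS]ffunE.
  by rewrite [X in _ = X + _]ffunE !mxE /c !ffunE.
exists (fun r => d (r2v r)) => [x|r].
  apply/dprodP => i; rewrite v2rK dmkE -[RHS]v2rK; congr r2v.
  by apply/rowP => j; rewrite mxE ffunE.
rewrite -[RHS]r2vK; congr v2r; apply/ffunP => -[i j].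
by rewrite ffunE dmkE r2vK mxE.
Qed.

HB.instance Definition _ := Lmodule_hasFinDim.Build k (dprod V) dprod_vect.

End DProd.

Section DMap.
Variables (k : fieldType) (I : finType) (U V : I -> vectType k).
Variable f : forall i, 'Hom(U i, V i).

Definition dmap_fun (x : dprod U) : dprod V := dmk (fun i => f i (x i)).

Fact dmap_linear : linear dmap_fun.
Proof.
move=> a x y; apply/dprodP=> i; rewrite dprodD dprodZ.
by rewrite /dmap_fun 3!(dmkE (fun i => f i _)) dprodD dprodZ linearP.
Qed.
HB.instance Definition _ :=
  GRing.isLinear.Build k (dprod U) (dprod V) _ dmap_fun dmap_linear.

Definition dmap : 'Hom(dprod U, dprod V) := linfun dmap_fun.

Lemma dmapE x i : dmap x i = f i (x i).
Proof. by rewrite lfunE dmkE. Qed.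
End DMap.

Section General.
Variables (k : fieldType) (W : vectType k).

Definition zariski_open (U : W -> Prop) : Prop :=
  exists S : {mpoly k[\dim {:W}]} -> Prop,
    forall x, U x <->
      exists2 p, S p & p.@[fun i => coord (vbasis {:W}) i x] != 0.

Definition for_general (P : W -> Prop) : Prop :=
  exists U : W -> Prop,
    [/\ zariski_open U, exists x, U x & forall x, U x -> P x].
End General.

Record quiver (n : nat) := Quiver {
  arrow : finType;
  src : arrow -> 'I_n;
  tgt : arrow -> 'I_n }.

Section Quiver.
Variables (n : nat) (Q : quiver n).

Fixpoint is_path (v : 'I_n) (p : seq (arrow Q)) (u : 'I_n) : bool :=
  if p is a :: p' then (src a == v) && is_path (tgt a) p' u else v == u.

Definition acyclic : Prop :=
  forall v (p : seq (arrow Q)), is_path v p v -> p = [::].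

(* When Q is acyclic a path visits no vertex twice, so the bound n on the
   length excludes no path. *)
Definition qpath (v u : 'I_n) : finType :=
  {p : n.-bseq (arrow Q) | is_path v p u}.

Definition euler_mx : 'M[int]_n :=
  \matrix_(u, v) if u == v then 1
                 else - (#|[set a : arrow Q | (src a == u) && (tgt a == v)]|)%:Z.

Definition toZ (b : 'cV[nat]_n) : 'cV[int]_n := map_mx Posz b.

Definition supp (b : 'cV[nat]_n) : {set 'I_n} := [set v | b v 0 != 0%N].

Definition unitv (v : 'I_n) : 'cV[nat]_n := \col_u (u == v : nat).

End Quiver.

Section Rep.
Variables (k : fieldType) (n : nat) (Q : quiver n).

Record rep := Rep {
  rep_at :> 'I_n -> vectType k;
  rmap : forall a : arrow Q, 'Hom(rep_at (src a), rep_at (tgt a)) }.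

Definition dim_vec (M : rep) : 'cV[nat]_n := \col_v \dim {:M v}.

Section Hom.
Variables M N : rep.

Local Notation vfamily := (dprod (fun v => 'Hom(M v, N v) : vectType k)).

Definition commutator (f : vfamily) :
    dprod (fun a : arrow Q => 'Hom(M (src a), N (tgt a)) : vectType k) :=
  dmk (fun a => (rmap N a \o f (src a))%VF - (f (tgt a) \o rmap M a)%VF).

Lemma commutatorE f a : commutator f a =
  (rmap N a \o f (src a))%VF - (f (tgt a) \o rmap M a)%VF.
Proof. exact: dmkE. Qed.

Fact commutator_linear : linear commutator.
Proof.
move=> c f g; apply/dprodP => a; rewrite dprodD dprodZ !commutatorE.
rewrite !dprodD !dprodZ comp_lfunDr comp_lfunDl -comp_lfunZr -comp_lfunZl.
by rewrite scalerBr opprD addrACA.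
Qed.
HB.instance Definition _ := GRing.isLinear.Build k _ _ _ commutator commutator_linear.

Definition Homv : {vspace vfamily} :=
  lker (linfun commutator).

Lemma HomvP (f : vfamily) :
  reflect (forall a, (rmap N a \o f (src a) = f (tgt a) \o rmap M a)%VF)
          (f \in Homv).
Proof.
rewrite memv_ker lfunE /=; apply: (iffP eqP) => [/dprodP f0 a|fC].
  apply/eqP; rewrite -subr_eq0; apply/eqP.
  by move: (f0 a); rewrite commutatorE => ->; rewrite dmkE.
by apply/dprodP => a; rewrite commutatorE fC subrr dmkE.
Qed.

Definition rhom : vectType k := subvs_of Homv.

Definition at_vertex (f : rhom) (v : 'I_n) : 'Hom(M v, N v) := vsval f v.

Lemma rhomC (f : rhom) a :
  (rmap N a \o at_vertex f (src a) = at_vertex f (tgt a) \o rmap M a)%VF.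
Proof. by move/HomvP: (subvsP f) => /(_ a). Qed.

Fact mk_rhom_subproof (f : forall v, 'Hom(M v, N v))
  (fC : forall a, (rmap N a \o f (src a) = f (tgt a) \o rmap M a)%VF) :
  dmk f \in Homv.
Proof. by apply/HomvP => a; rewrite !dmkE. Qed.

Definition mk_rhom f fC : rhom := Subvs (@mk_rhom_subproof f fC).

Lemma mk_rhomE f fC v : at_vertex (@mk_rhom f fC) v = f v.
Proof. exact: dmkE. Qed.

Lemma rhomP (f g : rhom) : (forall v, at_vertex f v = at_vertex g v) <-> f = g.
Proof.
by split=> [fg|-> //]; apply/val_inj/dprodP => v; apply: fg.
Qed.

Lemma at_vertexP c (f g : rhom) v :
  at_vertex (c *: f + g) v = c *: at_vertex f v + at_vertex g v.
Proof. by rewrite /at_vertex linearP dprodD dprodZ. Qed.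

Definition rinjective (f : rhom) := forall v, lker (at_vertex f v) = 0%VS.
Definition rsurjective (f : rhom) := forall v, limg (at_vertex f v) = fullv.
End Hom.

Fact rid_subproof (M : rep) a : (rmap M a \o \1 = \1 \o rmap M a)%VF.
Proof. by rewrite comp_lfun1l comp_lfun1r. Qed.
Definition rid (M : rep) : rhom M M :=
  mk_rhom (f := fun v => \1%VF) (@rid_subproof M).

Fact rcomp_subproof (L M N : rep) (g : rhom M N) (f : rhom L M) a :
  (rmap N a \o (at_vertex g (src a) \o at_vertex f (src a)) =
   at_vertex g (tgt a) \o at_vertex f (tgt a) \o rmap L a)%VF.
Proof. by rewrite comp_lfunA rhomC -comp_lfunA rhomC comp_lfunA. Qed.
Definition rcomp (L M N : rep) (g : rhom M N) (f : rhom L M) : rhom L N :=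
  mk_rhom (f := fun v => (at_vertex g v \o at_vertex f v)%VF)
          (rcomp_subproof g f).

Definition short_exact (L M N : rep) (i : rhom L M) (p : rhom M N) : Prop :=
  [/\ rinjective i, rsurjective p
    & forall v, limg (at_vertex i v) = lker (at_vertex p v)].

Definition riso (M N : rep) : Prop :=
  exists (f : rhom M N) (g : rhom N M), rcomp g f = rid M /\ rcomp f g = rid N.

Definition is_zero (M : rep) : Prop := forall v, \dim {:M v} = 0%N.

Definition zero_rep : rep :=
  @Rep (fun=> 'rV[k]_0 : vectType k) (fun=> 0).

Section Sum.
Variable I : finType.

Definition rsum (M : I -> rep) : rep :=
  @Rep (fun v => dprod (fun i => M i v)) (fun a => dmap (fun i => rmap (M i) a)).

Fact rsum_hom_subproof (M N : I -> rep) (f : forall i, rhom (M i) (N i)) a :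
  (rmap (rsum N) a \o dmap (fun i => at_vertex (f i) (src a)) =
   dmap (fun i => at_vertex (f i) (tgt a)) \o rmap (rsum M) a)%VF.
Proof.
apply/lfunP => x; rewrite !comp_lfunE; apply/dprodP => i.
by rewrite !dmapE -!comp_lfunE rhomC.
Qed.
Definition rsum_hom (M N : I -> rep) (f : forall i, rhom (M i) (N i)) :
    rhom (rsum M) (rsum N) :=
  @mk_rhom (rsum M) (rsum N) (fun v => dmap (fun i => at_vertex (f i) v))
    (rsum_hom_subproof f).
End Sum.

Definition indecomposable (M : rep) : Prop :=
  ~ is_zero M /\
  forall A B : rep, riso M (rsum (fun b : bool => if b then A else B)) ->
    is_zero A \/ is_zero B.

Definition projective (P : rep) : Prop :=
  forall (X Y : rep) (g : rhom X Y) (h : rhom P Y), rsurjective g ->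
    exists h' : rhom P X, rcomp g h' = h.

(* The last condition says that the epimorphism p is essential. *)
Definition projective_cover (P M : rep) (p : rhom P M) : Prop :=
  [/\ projective P, rsurjective p
    & forall (X : rep) (h : rhom X P), rsurjective (rcomp p h) -> rsurjective h].

(* A path p from v to src a is sent by the arrow a to the path p followed by
   a: the coefficient at q of the image of x is the sum of the x p over the
   (at most one) p with q = rcons p a. *)
Section Proj.
Variable v : 'I_n.

Definition append_arrow (a : arrow Q) (x : {ffun qpath Q v (src a) -> k^o}) :
    {ffun qpath Q v (tgt a) -> k^o} :=
  [ffun q : qpath Q v (tgt a) =>
     (\sum_(p : qpath Q v (src a) | rcons (val p) a == val q :> seq _) x p : k^o)].

Fact append_arrow_linear a : linear (@append_arrow a).
Proof.
move=> c x y; apply/ffunP => q; rewrite !ffunE scaler_sumr -big_split /=.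
by apply: eq_bigr => p _; rewrite !ffunE.
Qed.
HB.instance Definition _ a :=
  GRing.isLinear.Build k _ _ _ (@append_arrow a) (@append_arrow_linear a).

Definition proj : rep :=
  @Rep (fun u => {ffun qpath Q v u -> k^o} : vectType k)
       (fun a => linfun (@append_arrow a)).
End Proj.

Definition projs (g : 'cV[nat]_n) : rep :=
  rsum (fun x : {v : 'I_n & 'I_(g v 0)} => proj (tag x)).

Definition rep_space (b : 'cV[nat]_n) : vectType k :=
  dprod (fun a : arrow Q =>
           'Hom('rV[k]_(b (src a) 0), 'rV[k]_(b (tgt a) 0)) : vectType k).

Definition rep_of (b : 'cV[nat]_n) (x : rep_space b) : rep :=
  @Rep (fun v => 'rV[k]_(b v 0) : vectType k) (fun a => x a).

Definition schur_root (b : 'cV[nat]_n) : Prop :=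
  for_general (fun x : rep_space b => indecomposable (rep_of x)).

Section Ext.
Variables (K P B' : rep) (i : rhom K P).

Definition precomp (f : rhom P B') : rhom K B' := rcomp f i.

Fact precomp_linear : linear precomp.
Proof.
move=> c f g; apply/rhomP => v; rewrite at_vertexP !mk_rhomE at_vertexP.
by rewrite comp_lfunDl -comp_lfunZl.
Qed.
HB.instance Definition _ := GRing.isLinear.Build k _ _ _ precomp precomp_linear.
End Ext.

(* d = dim Ext^1(B, B'), where Ext^1(B, B') is the cokernel of
   Hom(P, B') -> Hom(K, B') for a short exact sequence 0 -> K -> P -> B -> 0
   with P projective. *)
Definition ext1_dim (B B' : rep) (d : nat) : Prop :=
  exists (K P : rep) (i : rhom K P) (p : rhom P B),
    [/\ projective P, short_exact i p
      & d = (\dim {:rhom K B'} - \dim (limg (linfun (@precomp K P B' i))))%N].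

Definition ext_is (b b' : 'cV[nat]_n) (d : nat) : Prop :=
  (exists B B' : rep, [/\ dim_vec B = b, dim_vec B' = b' & ext1_dim B B' d]) /\
  (forall (B B' : rep) (e : nat),
     dim_vec B = b -> dim_vec B' = b' -> ext1_dim B B' e -> (d <= e)%N).

(* Complexes of representations concentrated in degrees 1 and 0. *)
Record cplx := Cplx { deg1 : rep; deg0 : rep; diff : rhom deg1 deg0 }.

Definition dim_vec_cplx (C : cplx) : 'cV[int]_n :=
  toZ (dim_vec (deg0 C)) - toZ (dim_vec (deg1 C)).

Definition homotopy_equiv (C D : cplx) : Prop :=
  exists (f1 : rhom (deg1 C) (deg1 D)) (f0 : rhom (deg0 C) (deg0 D))
         (g1 : rhom (deg1 D) (deg1 C)) (g0 : rhom (deg0 D) (deg0 C))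
         (s : rhom (deg0 C) (deg1 C)) (t : rhom (deg0 D) (deg1 D)),
    [/\ rcomp (diff D) f1 = rcomp f0 (diff C),
        rcomp (diff C) g1 = rcomp g0 (diff D),
        rcomp g1 f1 - rid _ = rcomp s (diff C) /\
        rcomp g0 f0 - rid _ = rcomp (diff C) s
      & rcomp f1 g1 - rid _ = rcomp t (diff D) /\
        rcomp f0 g0 - rid _ = rcomp (diff D) t].

Definition csum (I : finType) (C : I -> cplx) : cplx :=
  Cplx (rsum_hom (fun i => diff (C i))).

(* The kernel of e is deg1 C itself, and the identity of a projective is a
   projective cover, so minimality only concerns e. *)
Definition minimal_projective_resolution (C : cplx) (M : rep) : Prop :=
  projective (deg1 C) /\
  exists e : rhom (deg0 C) M, projective_cover e /\ short_exact (diff C) e.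

Definition proj_shift (v : 'I_n) : cplx := @Cplx (proj v) zero_rep 0.

Definition pres_space (g0 g1 : 'cV[nat]_n) : vectType k :=
  rhom (projs g1) (projs g0).

(* R(g0, g1) is the canonical presentation space of alpha:
   g0 = mu and g1 = mu - E^t mu + gamma. *)
Definition canonical_pair (alpha : 'cV[int]_n) (g0 g1 : 'cV[nat]_n) : Prop :=
  exists mu gamma : 'cV[nat]_n,
    [/\ [disjoint supp mu & supp gamma],
        alpha = toZ mu - invmx (euler_mx Q)^T *m toZ gamma,
        g0 = mu
      & toZ g1 = toZ mu - (euler_mx Q)^T *m toZ mu + toZ gamma].

Definition canonical_decomposition (alpha : 'cV[int]_n)
    (betas : seq 'cV[nat]_n) (gamma : 'cV[nat]_n) : Prop :=
  [/\ alpha = \sum_(b <- betas) toZ b - invmx (euler_mx Q)^T *m toZ gamma,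
      forall b, b \in betas -> [disjoint supp b & supp gamma],
      forall i j : 'I_(size betas), i != j -> ext_is betas`_i betas`_j 0
    & forall b, b \in betas -> schur_root b].

Lemma canonical_pair_exists alpha betas gamma :
  canonical_decomposition alpha betas gamma ->
  exists g1, canonical_pair alpha (\sum_(b <- betas) b) g1.
Proof.
case=> -> dis _ _; pose mu : 'cV[nat]_n := \sum_(b <- betas) b.
have muZ : \sum_(b <- betas) toZ b = toZ mu.
  rewrite /mu; elim: (betas) => [|b s IH].
    by rewrite !big_nil; apply/matrixP => i j; rewrite !mxE.
  rewrite !big_cons IH; apply/matrixP => i j.
  by rewrite [LHS]mxE [in RHS]mxE [X in (X + _)]mxE [X in (_ + X)]mxE [in RHS]mxE PoszD.
pose z := toZ mu - (euler_mx Q)^T *m toZ mu.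
have z_ge0 v : 0 <= z v 0.
  rewrite !mxE (bigD1 v) //= !mxE eqxx mul1r opprD addrA subrr add0r.
  rewrite -sumrN; apply: Num.Theory.sumr_ge0 => u uv.
  by rewrite !mxE (negPf uv) mulNr opprK -PoszM.
exists ((\col_v `|(z v 0)%R|%N) + gamma), mu, gamma; split=> //.
- rewrite -setI_eq0; apply/eqP/setP => v; rewrite !inE; apply/negP.
  case/andP => mv gv; case/negP: mv; apply/eqP; rewrite /mu summxE.
  rewrite big_seq big1 // => b /dis; rewrite disjoint_subset => /subsetP/(_ v).
  by rewrite !inE gv; case: eqP => //= _ /(_ isT).
- by rewrite muZ.
- apply/matrixP => v j; rewrite (ord1 j) [in RHS]mxE -/z [LHS]mxE.
  rewrite [X in Posz X]mxE PoszD; congr (_ + _); last by rewrite mxE.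
  by rewrite mxE gez0_abs.
Qed.

End Rep.

(* Main.v *)
From HB Require Import structures.
From mathcomp Require Import all_boot all_algebra.
From mathcomp Require Import fingroup perm mpoly.
From mathcomp Require Import ring zify.
From Stdlib Require Import Classical.
Require Import Defs.

(** Write D for the inverse of E^t.  Its entries count paths, so D is unipotent
    along the quiver, and alpha = mu - D gamma with disjoint supports holds for
    exactly one pair of vectors (pair_exists, pair_uniq).  A decomposition of
    alpha is this gamma together with a list of Schur roots which has sum mu and
    vanishing ext in pairs.  It remains to see that mu has exactly one such
    list, and that the general presentation realizes it.

    Existence (kac_exists).  Among the lists of nonzero representations whose
    dimension vectors have sum mu, take one whose direct sum has the fewest
    endomorphisms and, among these, one with the most terms.  The middle term of
    a nonsplit extension of two terms would have fewer endomorphisms than their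
    sum; and if decomposable representations were dense in the dimension vector
    of a term, semicontinuity of Hom would allow to split this term.

    Uniqueness.  A set in a representation space is called dense if every
    polynomial function which vanishes on it is zero.  Given such a list, the
    direct sums of indecomposables with these dimension vectors are dense in
    R(mu) (rigid_dense): at a block diagonal point with vanishing Ext in both
    directions, block diagonal directions and conjugation by block unipotent
    matrices fill the tangent space (two_block_dense), and a function which
    vanishes on curves in every direction is zero (polyfun_curves).  Two lists
    with this density are equal (dense_type_uniq).  Indeed, at a point of the
    first type there is an endomorphism with distinct eigenvalues on the
    summands; it extends to a polynomial family of endomorphisms.  By the
    Krull-Schmidt theorem the multiplicities of its eigenvalues at the points of
    the second type are sums of entries of the second list.  This is a closed
    condition on the characteristic polynomials (root_pattern_closed), so it
    holds at the original point as well: the first list arises from the second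
    by merging entries, and conversely.  There are finitely many lists with sum
    mu, so the dense type is the general type (dense_type_general).

    The general presentation.  Let kappa = mu - E^t mu, so that P1 is the sum of
    P(kappa) and P(gamma), and P0 = P(mu).  For general f the generators of P0
    span at each vertex a complement of the image of P(kappa); therefore the
    cokernel M of f on P(kappa) is a point of R(mu), which depends rationally on
    f.  Every point of R(mu) occurs, by the standard presentation, so M has the
    general type (general_cokernel).  As the supports are disjoint, there is no
    nonzero map from P(gamma) to M, and after a change of the complement f
    vanishes on P(gamma) (general_presentation).  The summands of M have minimal
    projective resolutions, whose sum resolves the same module as the
    restriction of f to P(kappa) and is homotopy equivalent to it, while
    P(gamma) contributes the shifted projectives (minimal_splitting). *)

Set Implicit Arguments.
Unset Strict Implicit.
Unset Printing Implicit Defensive.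

Import GRing.Theory.
Local Open Scope ring_scope.

(** * Polynomial functions and Zariski density *)

Section PolyFun.
Variable k : fieldType.
Implicit Types U V W : vectType k.

Notation crd V := (coord (vbasis {:V})).

Lemma crdE V (v : V) : v = \sum_i crd V i v *: (vbasis {:V})`_i.
Proof. by apply: coord_vbasis; rewrite memvf. Qed.

Definition polyfun W (f : W -> k) : Prop :=
  exists p : {mpoly k[\dim {:W}]}, forall x, f x = p.@[fun i => crd W i x].

Definition polymap W V (F : W -> V) : Prop := forall i, polyfun (fun w => crd V i (F w)).

Section Pf.
Variable W : vectType k.
Implicit Types f g : W -> k.

Lemma polyfun_ext f g : f =1 g -> polyfun f -> polyfun g.
Proof. by move=> e [p Hp]; exists p => x; rewrite -e. Qed.

Lemma polyfunC c : polyfun (fun _ : W => c).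
Proof. by exists c%:MP => x; rewrite mevalC. Qed.

Lemma polyfunD f g : polyfun f -> polyfun g -> polyfun (fun x => f x + g x).
Proof. by move=> [p Hp] [q Hq]; exists (p + q) => x; rewrite mevalD Hp Hq. Qed.

Lemma polyfunM f g : polyfun f -> polyfun g -> polyfun (fun x => f x * g x).
Proof. by move=> [p Hp] [q Hq]; exists (p * q) => x; rewrite mevalM Hp Hq. Qed.

Lemma polyfunN f : polyfun f -> polyfun (fun x => - f x).
Proof. by move=> [p Hp]; exists (- p) => x; rewrite mevalN Hp. Qed.

Lemma polyfun_sum (I : Type) (r : seq I) (P : pred I) (F : I -> W -> k) :
  (forall i, polyfun (F i)) -> polyfun (fun x => \sum_(i <- r | P i) F i x).
Proof.
move=> H; elim: r => [|i r IH].
  by apply: polyfun_ext (polyfunC 0) => x; rewrite big_nil.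
case Pi: (P i); last by apply: polyfun_ext IH => x; rewrite big_cons Pi.
by apply: polyfun_ext (polyfunD (H i) IH) => x; rewrite big_cons Pi.
Qed.

Lemma polyfun_prod (I : Type) (r : seq I) (P : pred I) (F : I -> W -> k) :
  (forall i, polyfun (F i)) -> polyfun (fun x => \prod_(i <- r | P i) F i x).
Proof.
move=> H; elim: r => [|i r IH].
  by apply: polyfun_ext (polyfunC 1) => x; rewrite big_nil.
case Pi: (P i); last by apply: polyfun_ext IH => x; rewrite big_cons Pi.
by apply: polyfun_ext (polyfunM (H i) IH) => x; rewrite big_cons Pi.
Qed.

Lemma polyfunX f n : polyfun f -> polyfun (fun x => f x ^+ n).
Proof.
move=> H; elim: n => [|n IH]; first exact: polyfunC 1.
by apply: polyfun_ext (polyfunM H IH) => x; rewrite exprS.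
Qed.

Lemma polyfun_crd i : polyfun (fun x : W => crd W i x).
Proof. by exists 'X_i => x; rewrite mevalXU. Qed.

(** Induction over the ring operations, so that closure properties need not
    touch the monomials. *)
Lemma polyfun_ind (Q : (W -> k) -> Prop) :
  (forall f g, f =1 g -> Q f -> Q g) -> (forall c, Q (fun=> c)) ->
  (forall i, Q (fun x => crd W i x)) ->
  (forall f g, Q f -> Q g -> Q (fun x => f x + g x)) ->
  (forall f g, Q f -> Q g -> Q (fun x => f x * g x)) ->
  forall f, polyfun f -> Q f.
Proof.
move=> Qe Qc Qi QD QM f [p Hp].
apply: (Qe (fun x => \sum_(m <- msupp p) p@_m * \prod_i crd W i x ^+ m i)).
  by move=> x; rewrite Hp mevalE.
have QX i n : Q (fun x => crd W i x ^+ n).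
  elim: n => [|n IH]; first exact: Qc 1.
  by apply: Qe (QM _ _ (Qi i) IH) => x; rewrite exprS.
have Qp m r : Q (fun x => \prod_(i <- r) crd W i x ^+ m i).
  elim: r => [|i r IH]; first by apply: Qe (Qc 1) => x; rewrite big_nil.
  by apply: Qe (QM _ _ (QX i (m i)) IH) => x; rewrite big_cons.
elim: (msupp p) => [|m r IH]; first by apply: Qe (Qc 0) => x; rewrite big_nil.
apply: Qe (QD _ _ (QM _ _ (Qc p@_m) (Qp m (index_enum _))) IH) => x.
by rewrite big_cons.
Qed.

End Pf.

(** Polynomiality does not depend on the basis. *)
Lemma polymap_lin W V (F : W -> V) (phi : V -> k^o) :
  linear phi -> polymap F -> polyfun (fun w => phi (F w)).
Proof.
move=> lphi HF.
pose phi' : {linear V -> k^o} :=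
  HB.pack phi (GRing.isLinear.Build _ _ _ _ phi lphi).
apply: (@polyfun_ext _ (fun w => \sum_i crd V i (F w) * phi' (vbasis {:V})`_i)).
  move=> w; rewrite -[RHS]/(phi' (F w)) [in RHS](crdE (F w)) linear_sum.
  by apply: eq_bigr => i _; rewrite linearZ.
by apply: polyfun_sum => i; apply: polyfunM (polyfunC _ _).
Qed.

Lemma polymap_ext W V (F G : W -> V) : F =1 G -> polymap F -> polymap G.
Proof. by move=> e H i; apply: polyfun_ext (H i) => x; rewrite e. Qed.

Lemma polymap_id W : polymap (@id W).
Proof. exact: polyfun_crd. Qed.

Lemma polymapC W V (v : V) : polymap (fun _ : W => v).
Proof. by move=> i; apply: polyfunC. Qed.

Lemma polymapD W V (F G : W -> V) : polymap F -> polymap G -> polymap (fun w => F w + G w).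
Proof.
by move=> HF HG i; apply: polyfun_ext (polyfunD (HF i) (HG i)) => x; rewrite linearD.
Qed.

Lemma polymapZ W V (f : W -> k) (F : W -> V) :
  polyfun f -> polymap F -> polymap (fun w => f w *: F w).
Proof.
by move=> Hf HF i; apply: polyfun_ext (polyfunM Hf (HF i)) => x; rewrite linearZ.
Qed.

Lemma polymapN W V (F : W -> V) : polymap F -> polymap (fun w => - F w).
Proof. by move=> HF i; apply: polyfun_ext (polyfunN (HF i)) => x; rewrite linearN. Qed.

Lemma polymap_sum W V (I : Type) (r : seq I) (P : pred I) (F : I -> W -> V) :
  (forall i, polymap (F i)) -> polymap (fun x => \sum_(i <- r | P i) F i x).
Proof.
move=> H j; apply: polyfun_ext (polyfun_sum r P (fun i => H i j)) => x.
by rewrite linear_sum.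
Qed.

Lemma polymapL W V V' (F : W -> V) (L : V -> V') :
  linear L -> polymap F -> polymap (fun w => L (F w)).
Proof.
move=> lL HF i; apply: (polymap_lin (phi := fun v => crd V' i (L v))) HF => c u v.
by rewrite lL linearP.
Qed.

Lemma polymapB W V1 V2 V3 (B : V1 -> V2 -> V3) (F : W -> V1) (G : W -> V2) :
  (forall v, linear (B v)) -> (forall v, linear (B^~ v)) ->
  polymap F -> polymap G -> polymap (fun w => B (F w) (G w)).
Proof.
move=> l1 l2 HF HG.
have E w : B (F w) (G w) =
  \sum_i crd V1 i (F w) *: B (vbasis {:V1})`_i (G w).
  pose B' : {linear V1 -> V3} :=
    HB.pack (B^~ (G w)) (GRing.isLinear.Build _ _ _ _ (B^~ (G w)) (l2 _)).
  rewrite -[LHS]/(B' (F w)) [in LHS](crdE (F w)) linear_sum.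
  by apply: eq_bigr => i _; rewrite linearZ.
apply: (polymap_ext (fun w => esym (E w))); apply: polymap_sum => i.
by apply: polymapZ => //; apply: polymapL.
Qed.

Lemma polyfun_comp W V (q : V -> k) (F : W -> V) :
  polyfun q -> polymap F -> polyfun (fun w => q (F w)).
Proof.
move=> Hq HF; move: q Hq; apply: polyfun_ind => [f g e|c|i|f g|f g].
- by apply: polyfun_ext => x; rewrite e.
- exact: polyfunC.
- exact: HF.
- exact: polyfunD.
- exact: polyfunM.
Qed.

Lemma polymap_line W (x y : W) : polymap (fun t : k^o => x + t *: y).
Proof.
have l : linear (fun t : k^o => t *: y).
  by move=> c s t; rewrite scalerDl scalerA.
exact: polymapD (polymapC _ _) (polymapL l (@polymap_id k^o)).
Qed.

Lemma polyfun_self : polyfun (fun t : k^o => t : k).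
Proof. exact: (@polymap_lin k^o k^o id id (fun _ _ _ => erefl) (@polymap_id _)). Qed.

Lemma polyfun_poly (f : k^o -> k) : polyfun f -> exists P : {poly k}, forall t, f t = P.[t].
Proof.
move: f; apply: polyfun_ind => [f g e [P HP]|c|i|f g [P HP] [Q HQ]|f g [P HP] [Q HQ]].
- by exists P => t; rewrite -e.
- by exists c%:P => t; rewrite hornerC.
- exists ((crd k^o i 1)%:P * 'X) => t; rewrite hornerMX hornerC mulrC.
  have {1}-> : (t : k^o) = t *: (1 : k^o) by rewrite /GRing.scale /= mulr1.
  by rewrite linearZ.
- by exists (P + Q) => t; rewrite hornerD HP HQ.
- by exists (P * Q) => t; rewrite hornerM HP HQ.
Qed.

(** Clearing denominators in the rational function q (F / d). *)
Lemma polyfun_frac W V (q : V -> k) (d : W -> k) (F : W -> V) :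
  polyfun q -> polyfun d -> polymap F ->
  exists r : W -> k, exists m : nat, polyfun r /\
    forall w, d w != 0 -> r w = d w ^+ m * q ((d w)^-1 *: F w).
Proof.
move=> Hq Hd HF; move: q Hq; apply: polyfun_ind => [f g e|c|i|f g|f g].
- by move=> [r [m [Hr E]]]; exists r, m; split=> // w /E ->; rewrite e.
- by exists (fun=> c), 0%N; split=> [|w _]; [exact: polyfunC | rewrite mul1r].
- exists (fun w => crd V i (F w)), 1%N; split=> // w dw.
  by rewrite linearZ /= mulrA expr1 divff // mul1r.
- move=> [r [m [Hr E]]] [r' [m' [Hr' E']]].
  exists (fun w => d w ^+ m' * r w + d w ^+ m * r' w), (m + m')%N; split.
    by apply: polyfunD; apply: polyfunM => //; apply: polyfunX.
  by move=> w dw; rewrite E // E' // mulrDr exprD !mulrA [d w ^+ m' * _]mulrC.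
- move=> [r [m [Hr E]]] [r' [m' [Hr' E']]].
  exists (fun w => r w * r' w), (m + m')%N; split; first exact: polyfunM.
  by move=> w dw; rewrite E // E' // exprD mulrACA.
Qed.

Lemma polyfun_homog W (f : W -> k) (w0 : W) : polyfun f ->
  exists N : nat, exists G : nat -> W -> k,
    [/\ forall j, polyfun (G j), forall j t x, G j (t *: x) = t ^+ j * G j x
      & forall x, f (w0 + x) = \sum_(j < N) G j x].
Proof.
move=> Hf.
have [p Hp]: polyfun (fun x => f (w0 + x)).
  by apply: polyfun_comp => //; apply: polymapD (polymapC _ _) (@polymap_id _).
exists (msize p).
exists (fun j x => \sum_(m <- msupp p | mdeg m == j)
          p@_m * \prod_i crd W i x ^+ m i); split.
- move=> j; apply: polyfun_sum => m; apply: polyfunM (polyfunC _ _) _.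
  by apply: polyfun_prod => i; apply: polyfunX; apply: polyfun_crd.
- move=> j t x; rewrite big_distrr /=; apply: eq_bigr => m /eqP <-.
  rewrite mulrCA; congr (_ * _); rewrite mdegE -prodrXr -big_split /=.
  by apply: eq_bigr => i _; rewrite linearZ /= exprMn.
- move=> x; rewrite Hp mevalE (exchange_big_dep xpredT) //= !big_seq.
  apply: eq_bigr => m mp.
  by rewrite (big_pred1 (Ordinal (msize_mdeg_lt mp))).
Qed.

End PolyFun.

Notation crd V := (coord (vbasis {:V})).

Section Dense.
Variable k : closedFieldType.
Implicit Types U V W : vectType k.

Lemma poly_zero (P : {poly k}) : (forall t, P.[t] = 0) -> P = 0.
Proof.
move=> P0; apply/eqP; apply: contraT => nzP.
case: (eqVneq (size P) 1%N) => [/eqP/size_poly1P[c nc Pc]|sP].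
  by move: (P0 0); rewrite Pc hornerC => c0; rewrite c0 eqxx in nc.
have /closed_rootP[x]: size (P + 1) != 1%N.
  rewrite size_polyDl ?size_poly1 //.
  by rewrite ltn_neqAle eq_sym sP lt0n size_poly_eq0.
by rewrite /root hornerD P0 hornerC add0r oner_eq0.
Qed.

(** Affine space is irreducible: it suffices to restrict to the line through
    two points. *)
Lemma polyfun_irred W (f g : W -> k) x y : polyfun f -> polyfun g -> f x != 0 -> g y != 0 ->
  exists z, f z != 0 /\ g z != 0.
Proof.
move=> Hf Hg fx gy.
have [P HP] := polyfun_poly (polyfun_comp Hf (polymap_line x (y - x))).
have [R HR] := polyfun_poly (polyfun_comp Hg (polymap_line x (y - x))).
have nP : P != 0.
  apply: contraNneq fx => P0; move: (HP 0); rewrite P0 horner0.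
  by rewrite scale0r addr0 => ->.
have nR : R != 0.
  apply: contraNneq gy => P0; move: (HR 1); rewrite P0 horner0.
  by rewrite scale1r addrC subrK => ->.
have [t] : exists t, (P * R).[t] != 0.
  apply: NNPP => H; have /eqP[] : P * R != 0 by rewrite mulf_neq0.
  by apply: poly_zero => t; apply/eqP; apply: contraT => ht; case: H; exists t.
rewrite hornerM mulf_eq0 negb_or => /andP[Pt Rt].
by exists (x + t *: (y - x)); rewrite HP HR.
Qed.

(** Zariski density, tested on functions. *)
Definition dense W (D : W -> Prop) : Prop :=
  forall f : W -> k, polyfun f -> (forall x, D x -> f x = 0) -> forall x, f x = 0.

Lemma dense_nonzero W (g : W -> k) y : polyfun g -> g y != 0 -> dense (fun x => g x != 0).
Proof.
move=> Hg gy f Hf f0 x; apply/eqP; apply: contraT => fx.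
have [z [fz gz]] := polyfun_irred Hf Hg fx gy.
by rewrite f0 ?eqxx in fz.
Qed.

Lemma denseT W (D : W -> Prop) : (forall x, D x) -> dense D.
Proof. by move=> H f _ f0 x; apply: f0. Qed.

Lemma dense_sub W (D E : W -> Prop) :
  (forall x, D x -> E x) -> dense D -> dense E.
Proof. by move=> DE HD f Hf f0; apply: HD => // x /DE /f0. Qed.

Lemma dense_open W (D : W -> Prop) (g : W -> k) y : dense D -> polyfun g -> g y != 0 ->
  dense (fun x => D x /\ g x != 0).
Proof.
move=> HD Hg gy f Hf f0.
apply: (dense_nonzero Hg gy) => // x gx.
have H: forall x, f x * g x = 0.
  apply: HD; first exact: polyfunM.
  move=> z Dz; have [->|gz] := eqVneq (g z) 0; first by rewrite mulr0.
  by rewrite f0 ?mul0r.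
by move/eqP: (H x); rewrite mulf_eq0 (negPf gx) orbF => /eqP.
Qed.

Lemma dense_meet W (D : W -> Prop) (g : W -> k) y : dense D -> polyfun g -> g y != 0 ->
  exists2 x, D x & g x != 0.
Proof.
move=> HD Hg gy; apply: NNPP => H; move/eqP: gy; apply.
by apply: HD => // x Dx; apply/eqP; apply: contraT => gx; case: H; exists x.
Qed.

Lemma for_generalP W (P : W -> Prop) :
  for_general P <->
  exists f : W -> k, [/\ polyfun f, exists x, f x != 0 & forall x, f x != 0 -> P x].
Proof.
split=> [[U [[S HS] [x Ux] UP]]|[f [[p Hp] [x fx] fP]]].
  have [p Sp px] := (HS x).1 Ux.
  exists (fun x => p.@[fun i => crd W i x]); split.
  - by exists p.
  - by exists x.
  - by move=> y py; apply/UP/HS; exists p.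
exists (fun x => f x != 0); split=> //; last by exists x.
exists (eq p) => y; split=> [fy|[_ <-]]; last by rewrite Hp.
by exists p => //; rewrite -Hp.
Qed.

Lemma general_dense W (P : W -> Prop) : for_general P -> dense P.
Proof.
case/for_generalP=> f [Hf [x fx] fP].
exact: dense_sub fP (dense_nonzero Hf fx).
Qed.

Lemma not_general_dense W (P : W -> Prop) : ~ for_general P -> dense (fun x => ~ P x).
Proof.
move=> nP f Hf f0 x; apply/eqP; apply: contraT => fx; case: nP.
apply/for_generalP; exists f; split=> //; first by exists x.
by move=> y fy; apply: NNPP => nPy; rewrite f0 ?eqxx in fy.
Qed.

(** Each D i lies in the zero set of a nonzero function, and by irreducibility
    the product of these functions is nonzero. *)
Lemma general_avoid W (I : finType) (D : I -> W -> Prop) :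
  (forall i, ~ dense (D i)) -> for_general (fun x => forall i, ~ D i x).
Proof.
move=> nD.
have H i : exists f : W -> k, [/\ polyfun f, exists x, f x != 0 &
    forall x, f x != 0 -> ~ D i x].
  apply: NNPP => H; apply: (nD i) => f Hf f0 x; apply/eqP; apply: contraT => fx.
  case: H; exists f; split=> //; first by exists x.
  by move=> y fy Dy; rewrite f0 ?eqxx in fy.
apply/for_generalP.
suff: forall r : seq I, exists f : W -> k, [/\ polyfun f, exists x, f x != 0 &
    forall x, f x != 0 -> forall i, i \in r -> ~ D i x].
  case/(_ (enum I)) => f [Hf nf fP]; exists f; split=> // x fx i.
  by apply: fP => //; rewrite mem_enum.
elim=> [|i r [f [Hf [x fx] fP]]].
  exists (fun=> 1); split=> //; first exact: polyfunC.
  by exists 0; rewrite oner_neq0.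
have [g [Hg [y gy] gP]] := H i.
exists (fun x => f x * g x); split; first exact: polyfunM.
  have [z [fz gz]] := polyfun_irred Hf Hg fx gy.
  by exists z; rewrite mulf_neq0.
move=> z; rewrite mulf_eq0 negb_or => /andP[fz gz] j.
by rewrite inE => /orP[/eqP ->|jr]; [apply: gP | apply: fP].
Qed.

(** Along a curve through w0 with tangent T the leading term of G is its lowest
    homogeneous part at w0, evaluated at T; so the homogeneous parts vanish one
    after the other.  This replaces a dimension count: to see that a family
    fills a space it is enough to reach every tangent direction at one point. *)
Lemma polyfun_curves W (G : W -> k) (w0 : W) : polyfun G ->
  (forall T : W, exists e : k^o -> W, polymap e /\
     forall t : k, G (w0 + t *: (T + t *: e t)) = 0) ->
  forall x, G x = 0.
Proof.
move=> HG curv; have [N [H [Hp Hh HE]]] := polyfun_homog w0 HG.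
suff H0 j : (j < N)%N -> forall x, H j x = 0.
  by move=> x; rewrite -(subrK w0 x) addrC HE big1 // => j _; apply: H0.
elim/ltn_ind: j => j IH jN T.
have [e [He Ge]] := curv T.
pose y t : W := T + t *: e t.
have Hy : polymap (y : k^o -> W).
  apply: polymapD (polymapC _ _) _; apply: polymapZ He.
  exact: polyfun_self.
(* G along the curve, divided by t ^+ j; its value at 0 is H j T. *)
pose Q t := \sum_(i < N | (j <= i)%N) t ^+ (i - j) * H i (y t).
have HQ : polyfun (Q : k^o -> k).
  apply: polyfun_sum => i; apply: polyfunM; last exact: polyfun_comp.
  by apply: polyfunX; exact: polyfun_self.
have Q0 : forall t, Q t = 0.
  have Hid : polyfun (fun t : k^o => t : k).
    exact: polyfun_self.
  apply: (dense_nonzero (W := k^o) (y := 1) Hid (oner_neq0 _)) => // t nt.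
  have tj : t ^+ j != 0 by rewrite expf_neq0.
  apply: (mulfI tj); rewrite mulr0 -(Ge t) HE (bigID (fun i : 'I_N => j <= i)%N) /=.
  rewrite [X in _ + X]big1 ?addr0 => [|i]; last first.
    by rewrite -ltnNge => ij; rewrite IH.
  rewrite big_distrr /=; apply: eq_bigr => i ji.
  by rewrite Hh mulrA -exprD subnKC.
have := Q0 0; rewrite /Q (bigD1 (Ordinal jN)) //= subnn mul1r /y scale0r addr0.
rewrite big1 ?addr0 // => i /andP[ji nij]; rewrite expr0n subn_eq0.
by rewrite leqNgt ltn_neqAle eq_sym (_ : (i : nat) != j) // ji mul0r.
Qed.

End Dense.

(** * Polynomial families of linear maps *)

Section Families.
Import VectorInternalTheory.
Variable k : fieldType.
Implicit Types U V W : vectType k.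

Lemma mul_f2mx U V (f : 'Hom(U, V)) u : u *m f2mx f = v2r (f (r2v u)).
Proof. by rewrite unlock /= !r2vK. Qed.

Lemma f2mx_inj U V : injective (@f2mx k U V).
Proof. exact: val_inj. Qed.

Lemma f2mx_linear U V c (f g : 'Hom(U, V)) : f2mx (c *: f + g) = c *: f2mx f + f2mx g.
Proof.
apply/row_matrixP => i; rewrite !rowE mulmxDr -scalemxAr !mul_f2mx.
by rewrite add_lfunE scale_lfunE linearP.
Qed.

Lemma f2mxZ U V c (f : 'Hom(U, V)) : f2mx (c *: f) = c *: f2mx f.
Proof.
apply/row_matrixP => i; rewrite !rowE -scalemxAr !mul_f2mx.
by rewrite scale_lfunE linearZ.
Qed.

Lemma f2mx_comp U V W (g : 'Hom(V, W)) (f : 'Hom(U, V)) :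
  f2mx (g \o f)%VF = f2mx f *m f2mx g.
Proof.
apply/row_matrixP => i; rewrite !rowE mulmxA !mul_f2mx comp_lfunE.
by rewrite v2rK.
Qed.

Lemma f2mx1 U : f2mx (\1%VF : 'End(U)) = 1%:M.
Proof.
by apply/row_matrixP => i; rewrite !rowE mul_f2mx id_lfunE r2vK mulmx1.
Qed.

Lemma f2mx_eigen U (f : 'End(U)) z : eigenvalue (f2mx f) z ->
  exists2 x : U, x != 0 & f x = z *: x.
Proof.
move=> /eigenvalueP[u uf nu]; exists (r2v u).
  by apply: contraNneq nu => x0; rewrite -[u]r2vK x0 linear0.
by rewrite -[LHS]v2rK -mul_f2mx uf linearZ.
Qed.

Lemma dim_limg U V (f : 'Hom(U, V)) : \dim (limg f) = \rank (f2mx f).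
Proof.
rewrite /dimv /lfun_img locked_withE /lfun_img_def mx2vsK; rewrite (eqmxMr _ (mx2vsK _)).
by rewrite mul1mx.
Qed.

(** Makes rank r visible as an invertible r x r product, whose determinant is a
    polynomial in A. *)
Lemma rank_witness p q (A : 'M[k]_(p, q)) :
  exists S T, S *m A *m T = 1%:M :> 'M_(\rank A).
Proof.
exists (pinvmx (col_base A)), (pinvmx (row_base A)).
have -> : pinvmx (col_base A) *m A = row_base A.
  rewrite -[X in _ *m X](mulmx_base A) mulmxA mulVpmx ?col_base_full //.
  by rewrite mul1mx.
by rewrite mulmxVp ?row_base_free.
Qed.

Definition polymx W p q (F : W -> 'M[k]_(p, q)) := forall i j, polyfun (fun w => F w i j).

Lemma polymxC W p q (A : 'M[k]_(p, q)) : polymx (fun _ : W => A).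
Proof. by move=> i j; apply: polyfunC. Qed.

Lemma polymxM W p q r (F : W -> 'M[k]_(p, q)) (G : W -> 'M_(q, r)) :
  polymx F -> polymx G -> polymx (fun w => F w *m G w).
Proof.
move=> HF HG i j; apply: (@polyfun_ext _ _ (fun w => \sum_l F w i l * G w l j)).
  by move=> w; rewrite mxE.
by apply: polyfun_sum => l; apply: polyfunM.
Qed.

Lemma polymx_det W n (F : W -> 'M[k]_n) : polymx F -> polyfun (fun w => \det (F w)).
Proof.
by move=> HF; apply: polyfun_sum => s; apply: polyfunM (polyfunC _ _) _; apply: polyfun_prod.
Qed.

Lemma polymx_adj W n (F : W -> 'M[k]_n) : polymx F -> polymx (fun w => \adj (F w)).
Proof.
move=> HF i j.
apply: (@polyfun_ext _ _ (fun w => (-1) ^+ (j + i) * \det (row' j (col' i (F w))))).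
  by move=> w; rewrite mxE.
apply: polyfunM (polyfunC _ _) _; apply: polymx_det => a b.
by apply: polyfun_ext (HF (lift j a) (lift i b)) => w; rewrite !mxE.
Qed.

Lemma polymap_f2mx W U V (F : W -> 'Hom(U, V)) : polymap F -> polymx (fun w => f2mx (F w)).
Proof.
move=> HF i j; apply: (@polymap_lin _ _ _ F (fun f => f2mx f i j : k^o)) HF.
by move=> c f g; rewrite f2mx_linear !mxE.
Qed.

Lemma polymx_row W V (F : W -> 'rV[k]_(dim V)) : polymx F -> polymap (fun w => r2v (F w) : V).
Proof.
move=> HF; apply: (@polymap_ext _ _ _
  (fun w => \sum_j F w 0 j *: (r2v (delta_mx 0 j) : V))) => [w|].
  by rewrite [F w in RHS]row_sum_delta linear_sum; apply: eq_bigr => j _; rewrite linearZ.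
by apply: polymap_sum => j; apply: polymapZ => //; apply: polymapC.
Qed.

Lemma polymx_Hom W U V (F : W -> 'M[k]_(dim U, dim V)) :
  polymx F -> polymap (fun w => Hom (F w) : 'Hom(U, V)).
Proof.
move=> HF; apply: (@polymap_ext _ _ _
  (fun w => \sum_i \sum_j F w i j *: (Hom (delta_mx i j) : 'Hom(U, V)))) => [w|].
  have L : linear (@Hom k U V).
    by move=> c A B; apply: f2mx_inj; rewrite f2mx_linear.
  pose L' : {linear 'M[k]_(dim U, dim V) -> 'Hom(U, V)} :=
    HB.pack (@Hom k U V) (GRing.isLinear.Build _ _ _ _ (@Hom k U V) L).
  rewrite -[RHS]/(L' (F w)) [F w in RHS]matrix_sum_delta linear_sum.
  by apply: eq_bigr => i _; rewrite linear_sum; apply: eq_bigr => j _; rewrite linearZ.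
do 2!apply: polymap_sum => ?; apply: polymapZ => //; exact: polymapC.
Qed.

(** The rank of a family can only drop on a proper closed subset: a nonzero
    minor at w0 is a nonzero minor nearby. *)
Lemma rank_semicont W U V (F : W -> 'Hom(U, V)) (w0 : W) : polymap F ->
  exists d : W -> k, [/\ polyfun d, d w0 != 0 &
    forall w, d w != 0 -> (\dim (limg (F w0)) <= \dim (limg (F w)))%N].
Proof.
move=> HF; have [S [T ST]] := rank_witness (f2mx (F w0)).
exists (fun w => \det (S *m f2mx (F w) *m T)); split.
- by apply: polymx_det; apply: polymxM (polymxC _ _); apply: polymxM (polymxC _ _) (polymap_f2mx HF).
- by rewrite ST det1 oner_neq0.
- move=> w; rewrite -unitfE -[_ \is a _]unitmxE => /mxrank_unit rk.
  rewrite !dim_limg -[X in (X <= _)%N]rk; apply: leq_trans (mxrankM_maxl _ _) _.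
  exact: mxrankM_maxr.
Qed.

(** Where the rank is maximal the kernels form a vector bundle, so a kernel
    vector extends to a polynomial family of kernel vectors: multiply u0 by the
    minor det A and correct it by Cramer's rule. *)
Lemma ker_lift W U V (F : W -> 'Hom(U, V)) (w0 : W) (u0 : U) : polymap F ->
  (forall w, \dim (limg (F w)) <= \dim (limg (F w0)))%N -> F w0 u0 = 0 ->
  exists d : W -> k, exists g : W -> U,
    [/\ polyfun d, d w0 != 0, polymap g, g w0 = u0 & forall w, d w != 0 -> F w (g w) = 0].
Proof.
move=> HF rkF Fu0; pose M w := f2mx (F w).
have [S [T ST]] := rank_witness (M w0).
pose A w := S *m M w *m T.
have HM : polymx M by apply: polymap_f2mx.
have HA : polymx A by apply: polymxM (polymxC _ _); apply: polymxM (polymxC _ _) HM.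
pose u := v2r u0.
exists (fun w => \det (A w)).
exists (fun w => \det (A w) *: u0 - r2v (u *m M w *m T *m \adj (A w) *m S)).
have uM0 : u *m M w0 = 0 by rewrite /M mul_f2mx v2rK Fu0 linear0.
split.
- exact: polymx_det.
- by rewrite /A ST det1 oner_neq0.
- apply: polymapD; first by apply: polymapZ (polymapC _ _); apply: polymx_det.
  apply: polymapN; apply: polymx_row; apply: polymxM (polymxC _ _).
  apply: polymxM (polymx_adj HA); apply: polymxM (polymxC _ _).
  exact: polymxM (polymxC _ _) HM.
- by rewrite /A ST det1 scale1r uM0 !mul0mx linear0 subr0.
- move=> w dw.
  have uA : A w \in unitmx by rewrite unitmxE unitfE.
  pose x := \det (A w) *: u - u *m M w *m T *m \adj (A w) *m S.
  suff xM : x *m M w = 0.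
    rewrite [X in F w X](_ : _ = r2v x); last by rewrite linearB linearZ /= v2rK.
    by apply: (can_inj v2rK); rewrite -mul_f2mx xM linear0.
  have xMT : x *m (M w *m T) = 0.
    rewrite mulmxBl -scalemxAl -!mulmxA [S *m (_ *m _)]mulmxA -/(A w).
    by rewrite mul_adj_mx mul_mx_scalar -!scalemxAr subrr.
  (* The rank of M w cannot exceed that of A w, so T adds nothing to the kernel. *)
  have : (kermx (M w) :=: kermx (M w *m T))%MS.
    apply/eqmxP; rewrite -(geq_leqif (mxrank_leqif_eq _)).
      rewrite !mxrank_ker leq_sub2l //.
      apply: leq_trans (_ : \rank (A w) <= _)%N; last first.
        by rewrite /A -mulmxA; apply: mxrankM_maxr.
      rewrite mxrank_unit // -!dim_limg; exact: rkF.
    by rewrite sub_kermx mulmxA mulmx_ker mul0mx.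
  move=> e; have : (x <= kermx (M w))%MS by rewrite e sub_kermx xMT.
  by rewrite sub_kermx => /eqP.
Qed.

(** Cramer's rule in families. *)
Lemma inv_family W U V (F : W -> 'Hom(U, V)) (w0 : W) : polymap F ->
  \dim {:U} = \dim {:V} -> lker (F w0) = 0%VS ->
  exists d : W -> k, exists J : W -> 'Hom(V, U),
    [/\ polyfun d, d w0 != 0, polymap J,
        forall w, (F w \o J w)%VF = d w *: \1%VF
      & forall w, d w != 0 -> (J w \o F w)%VF = d w *: \1%VF].
Proof.
move=> HF dUV k0; pose M w := f2mx (F w).
have HM : polymx M by apply: polymap_f2mx.
have fM : limg (F w0) = fullv.
  apply/eqP; rewrite -(geq_leqif (dimv_leqif_eq (subvf _))) -dUV.
  by rewrite limg_dim_eq // k0 capv0.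
have [S [T ST]] : exists S T, S *m M w0 *m T = 1%:M :> 'M_(dim V) /\ T = 1%:M.
  exists (pinvmx (M w0)), 1%:M; rewrite mulmx1 mulVpmx //.
  by rewrite -col_leq_rank -dim_limg fM dimvf.
move: ST => [ST eT]; rewrite {T}eT mulmx1 in ST.
pose A w := S *m M w; have HA : polymx A by apply: polymxM HM; apply: polymxC.
pose J w : 'Hom(V, U) := Hom (\adj (A w) *m S).
have FJ w : (F w \o J w)%VF = \det (A w) *: \1%VF.
  apply: f2mx_inj; rewrite f2mx_comp f2mxZ f2mx1 /=.
  by rewrite -mulmxA -/(M w) -/(A w) mul_adj_mx scalemx1.
exists (fun w => \det (A w)), J; split=> //.
- exact: polymx_det.
- by rewrite /A ST det1 oner_neq0.
- by apply: polymx_Hom; apply: polymxM (polymxC _ _); apply: polymx_adj.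
move=> w dw.
have k0w : lker (F w) = 0%VS.
  apply/eqP; rewrite -dimv_eq0.
  have := limg_ker_dim (F w) fullv; rewrite capfv dUV.
  suff -> : limg (F w) = fullv by move/eqP; rewrite -[X in _ == X]add0n eqn_add2r.
  apply/eqP; rewrite eqEsubv subvf /=; apply/subvP => v _.
  have := congr1 (fun h : 'End(V) => h ((\det (A w))^-1 *: v)) (FJ w).
  rewrite comp_lfunE scale_lfunE id_lfunE scalerA divff // scale1r => <-.
  by rewrite memv_img ?memvf.
apply/lfunP => x; move/eqP/lker0P: k0w; apply.
have := congr1 (fun h : 'End(V) => h (F w x)) (FJ w).
by rewrite !comp_lfunE !scale_lfunE !id_lfunE linearZ.
Qed.

End Families.

(** * Polynomials with prescribed root multiplicities form a closed set *)

Section RootPattern.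
Variables (k : closedFieldType) (N : nat) (J : finType) (c : 'I_N -> J).

Let block (x : 'I_N * 'I_N) := c x.1 == c x.2.

(* A linear form in the roots, polynomial in t, all of whose coefficients in t
   vanish exactly when the roots, permuted by s, are constant on the fibres of
   c; the product over all s is symmetric in the roots. *)
Let lform (t : k) (s : 'S_N) : {mpoly k[N]} :=
  \sum_(x | block x) t ^+ enum_rank x *: ('X_(s x.1) - 'X_(s x.2)).
Let hform t : {mpoly k[N]} := \prod_(s : 'S_N) lform t s.

Let hform_sym t : hform t \is symmetric.
Proof.
apply/issymP => s; rewrite /hform rmorph_prod /=.
rewrite [RHS](reindex_inj (mulIg s)) /=; apply: eq_bigr => u _.
rewrite /lform raddf_sum; apply: eq_bigr => x _ /=.
rewrite msymZ; congr (_ *: _); rewrite raddfB /=.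
by rewrite /msym !mmapX !mmap1U !permM.
Qed.

Lemma polyfun_meval (W : vectType k) n (p : {mpoly k[n]}) (v : 'I_n -> W -> k) :
  (forall i, polyfun (v i)) -> polyfun (fun w : W => p.@[fun i => v i w]).
Proof.
move=> Hv; apply: (@polyfun_ext _ _
  (fun w => \sum_(m <- msupp p) p@_m * \prod_i v i w ^+ m i)) => [w|].
  by rewrite mevalE.
apply: polyfun_sum => m; apply: polyfunM (polyfunC _ _) _; apply: polyfun_prod => i; exact: polyfunX.
Qed.

(** The polynomials whose roots can be numbered such that they are constant on
    the fibres of c form a closed set: hform t is symmetric, hence a polynomial
    in the coefficients, and it vanishes for all t exactly on this set, since
    k[t] is a domain. *)
Lemma root_pattern_closed (W : vectType k) (D : W -> Prop) (a : W -> {poly k}) : dense D ->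
  (forall w, a w \is monic /\ size (a w) = N.+1) ->
  (forall i, polyfun (fun w => (a w)`_i)) ->
  (forall w, D w -> exists l : J -> k, a w = \prod_i ('X - (l (c i))%:P)) ->
  forall w, exists l : J -> k, a w = \prod_i ('X - (l (c i))%:P).
Proof.
move=> HD Ha pa Hl w.
pose T t := projT1 (sym_fundamental (hform_sym t)).
have HT t : T t \mPo [tuple mesym N k i.+1 | i < N] = hform t.
  by rewrite /T; case: (sym_fundamental _) => /= p [].
pose e i w : k := (-1) ^+ i.+1 * (a w)`_(N - i.+1).
pose h t w := (T t).@[fun i : 'I_N => e i w].
have hP t v (r : 'I_N -> k) : a v = \prod_i ('X - (r i)%:P) ->
    h t v = \prod_(s : 'S_N) \sum_(x | block x)
              t ^+ enum_rank x * (r (s x.1) - r (s x.2)).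
  move=> av; have -> : h t v = (hform t).@[r].
    rewrite -HT comp_mpoly_meval; apply: meval_eq => i.
    rewrite tnth_mktuple /e av.
    have := mroots_coeff [tuple r i | i < N] (Ordinal (ltn_ord i : i.+1 < N.+1)%N).
    rewrite big_tuple /= => E.
    have -> : \prod_i0 ('X - (r i0)%:P) =
      \prod_(i0 < N) ('X - (tnth [tuple r i | i < N] i0)%:P).
      by apply: eq_bigr => j _; rewrite tnth_mktuple.
    rewrite E mulrA -exprMn mulrNN mulr1 expr1n mul1r.
    by apply: meval_eq => j; rewrite tnth_mktuple.
  rewrite /hform rmorph_prod /=; apply: eq_bigr => s _.
  rewrite /lform raddf_sum; apply: eq_bigr => x _.
  by rewrite /= mevalZ mevalB !mevalXU.
(* The factor of the identity permutation vanishes on D. *)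
have h0 t : h t w = 0.
  move: w; apply: HD.
    by apply: polyfun_meval => i; apply: polyfunM (polyfunC _ _) (pa _).
  move=> v /Hl[l av]; rewrite (hP t v (l \o c)) //.
  rewrite (bigD1 1%g) //= big1 ?mul0r // => x /eqP Ex.
  by rewrite !perm1 Ex subrr mulr0.
have [r ar] : exists r : 'I_N -> k, a w = \prod_i ('X - (r i)%:P).
  have [rs Ers] := closed_field_poly_normal (a w).
  have [mona sza] := Ha w; rewrite (monicP mona) scale1r in Ers.
  have srs : size rs == N.
    by rewrite -eqSS -sza Ers size_prod_XsubC.
  exists (tnth (Tuple srs)); rewrite {1}Ers.
  by rewrite -[rs in LHS]/(tval (Tuple srs)) big_tuple.
(* The factor of s, as a polynomial in t. *)
pose P s : {poly k} :=
  \sum_(x | block x) (r (s x.1) - r (s x.2)) *: 'X^(enum_rank x).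
have /eqP : \prod_(s : 'S_N) P s = 0.
  apply: poly_zero => t; rewrite horner_prod -(h0 t) (hP t w r) //.
  apply: eq_bigr => s _; rewrite /P horner_sum; apply: eq_bigr => x _.
  by rewrite hornerZ hornerXn mulrC.
rewrite prodf_seq_eq0 => /hasP[s _ /= /eqP Ps].
have rc i j : c i = c j -> r (s i) = r (s j).
  move=> cij; have bij : block (i, j) by apply/eqP.
  have := congr1 (fun p : {poly k} => p`_(enum_rank (i, j))) Ps.
  rewrite /P coef_sum (bigD1 (i, j)) //= coefZ coefXn eqxx mulr1 coef0.
  rewrite big1 ?addr0 => [/eqP|x /andP[_ ne]]; first by rewrite subr_eq0 => /eqP.
  rewrite coefZ coefXn; case: eqP => [E|_]; last by rewrite mulr0.
  by case/eqP: ne; apply/esym/enum_rank_inj/val_inj.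
exists (fun j => if [pick i | c i == j] is Some i then r (s i) else 0).
rewrite ar (reindex_inj (@perm_inj _ s)); apply: eq_bigr => i _.
by case: pickP => [j /eqP/rc -> //|/(_ i)]; rewrite eqxx.
Qed.
End RootPattern.

(** * The category of representations *)

Notation "g \c f" := (rcomp g f) (at level 40, left associativity).
Notation "f .|[ v ]" := (at_vertex f v)
  (at level 2, left associativity, format "f .|[ v ]").

Section Cat.
Variables (k : fieldType) (n : nat) (Q : quiver n).
Notation rep := (rep k Q).
Implicit Types L M N A B C X Y : rep.
Local Notation id1 := (rid _).

Lemma rcompE L M N (g : rhom M N) (f : rhom L M) v : (g \c f).|[v] = (g.|[v] \o f.|[v])%VF.
Proof. exact: mk_rhomE. Qed.

Lemma ridE M v : (rid M).|[v] = \1%VF.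
Proof. exact: mk_rhomE. Qed.

Lemma atD M N (f g : rhom M N) v : (f + g).|[v] = f.|[v] + g.|[v].
Proof. by rewrite -[f in LHS]scale1r at_vertexP scale1r. Qed.

Lemma at0 M N v : (0 : rhom M N).|[v] = 0.
Proof. by apply: (addrI (0 : rhom M N).|[v]); rewrite -atD !addr0. Qed.

Lemma atZ M N c (f : rhom M N) v : (c *: f).|[v] = c *: f.|[v].
Proof. by rewrite -[_ *: f]addr0 at_vertexP at0 addr0. Qed.

Lemma at_sum M N (I : Type) (r : seq I) (P : pred I) (F : I -> rhom M N) v :
  (\sum_(i <- r | P i) F i).|[v] = \sum_(i <- r | P i) (F i).|[v].
Proof. exact: (big_morph (fun f => f.|[v]) (fun f g => atD f g v) (at0 M N v)). Qed.

Lemma rhom_ext M N (f g : rhom M N) : (forall v x, f.|[v] x = g.|[v] x) -> f = g.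
Proof. by move=> H; apply/rhomP => v; apply/lfunP => x. Qed.

Lemma rhom_nat M N (f : rhom M N) a x :
  rmap N a (f.|[src a] x) = f.|[tgt a] (rmap M a x).
Proof. by rewrite -!comp_lfunE rhomC. Qed.

Lemma rcompA L M N X (h : rhom N X) (g : rhom M N) (f : rhom L M) :
  h \c (g \c f) = h \c g \c f.
Proof. by apply/rhomP => v; rewrite !rcompE comp_lfunA. Qed.

Lemma rcomp1l M N (f : rhom M N) : id1 \c f = f.
Proof. by apply/rhomP => v; rewrite rcompE ridE comp_lfun1l. Qed.

Lemma rcomp1r M N (f : rhom M N) : f \c id1 = f.
Proof. by apply/rhomP => v; rewrite rcompE ridE comp_lfun1r. Qed.

(** The form in which inverse pairs occur inside left-nested composites. *)
Lemma rcompK L M N (u : rhom L M) (w : rhom M L) (f : rhom L N) :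
  w \c u = id1 -> f \c w \c u = f.
Proof. by move=> e; rewrite -rcompA e rcomp1r. Qed.

Lemma rcompDl L M N (g h : rhom M N) (f : rhom L M) : (g + h) \c f = g \c f + h \c f.
Proof. by apply/rhomP => v; rewrite rcompE !atD comp_lfunDl !rcompE. Qed.

Lemma rcompDr L M N (g : rhom M N) (f h : rhom L M) : g \c (f + h) = g \c f + g \c h.
Proof. by apply/rhomP => v; rewrite rcompE !atD comp_lfunDr !rcompE. Qed.

Lemma rcompZl L M N c (g : rhom M N) (f : rhom L M) : (c *: g) \c f = c *: (g \c f).
Proof. by apply/rhomP => v; rewrite rcompE !atZ -comp_lfunZl rcompE. Qed.

Lemma rcompZr L M N c (g : rhom M N) (f : rhom L M) : g \c (c *: f) = c *: (g \c f).
Proof. by apply/rhomP => v; rewrite rcompE !atZ -comp_lfunZr rcompE. Qed.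

Lemma rcompNl L M N (g : rhom M N) (f : rhom L M) : (- g) \c f = - (g \c f).
Proof. by rewrite -scaleN1r rcompZl scaleN1r. Qed.

Lemma rcompNr L M N (g : rhom M N) (f : rhom L M) : g \c (- f) = - (g \c f).
Proof. by rewrite -scaleN1r rcompZr scaleN1r. Qed.

Lemma rcompBl L M N (g h : rhom M N) (f : rhom L M) : (g - h) \c f = g \c f - h \c f.
Proof. by rewrite rcompDl rcompNl. Qed.

Lemma rcompBr L M N (g : rhom M N) (f h : rhom L M) : g \c (f - h) = g \c f - g \c h.
Proof. by rewrite rcompDr rcompNr. Qed.

Lemma rcomp0l L M N (f : rhom L M) : (0 : rhom M N) \c f = 0.
Proof. by rewrite -[0 in LHS](subrr (0 : rhom M N)) rcompBl subrr. Qed.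

Lemma rcomp0r L M N (g : rhom M N) : g \c (0 : rhom L M) = 0.
Proof. by rewrite -[0 in LHS](subrr (0 : rhom L M)) rcompBr subrr. Qed.

Lemma rcompK0 L M N X (u : rhom L M) (w : rhom M N) (f : rhom N X) :
  w \c u = 0 -> f \c w \c u = 0.
Proof. by move=> e; rewrite -rcompA e rcomp0r. Qed.

Lemma rcomp_suml L M N (I : Type) (r : seq I) (P : pred I) (F : I -> rhom M N)
    (f : rhom L M) :
  (\sum_(i <- r | P i) F i) \c f = \sum_(i <- r | P i) (F i \c f).
Proof.
exact: (big_morph (fun g => g \c f) (fun g h => rcompDl g h f) (rcomp0l N f)).
Qed.

Lemma rcomp_sumr L M N (I : Type) (r : seq I) (P : pred I) (F : I -> rhom L M)
    (g : rhom M N) :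
  g \c (\sum_(i <- r | P i) F i) = \sum_(i <- r | P i) (g \c F i).
Proof.
exact: (big_morph (fun f => g \c f) (fun f h => rcompDr g f h) (rcomp0r L g)).
Qed.

Definition is_iso M N (f : rhom M N) := exists g : rhom N M, g \c f = id1 /\ f \c g = id1.

Lemma is_iso1 M : is_iso (rid M).
Proof. by exists id1; rewrite rcomp1l. Qed.

Lemma risoP M N : riso M N <-> exists f : rhom M N, is_iso f.
Proof. by split=> [[f [g H]]|[f [g H]]]; exists f; exists g. Qed.

Lemma riso_refl M : riso M M.
Proof. by apply/risoP; exists id1; apply: is_iso1. Qed.

Lemma riso_sym M N : riso M N -> riso N M.
Proof. by move=> [f [g [H1 H2]]]; exists g, f. Qed.

Lemma rinjP M N (f : rhom M N) : rinjective f -> forall v, injective f.|[v].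
Proof. by move=> H v; apply/lker0P; rewrite H. Qed.

Lemma rinjPn M N (f : rhom M N) : (forall v, injective f.|[v]) -> rinjective f.
Proof. by move=> H v; apply/eqP/lker0P/H. Qed.

Lemma rsurjP M N (f : rhom M N) : rsurjective f -> forall v y, exists x, y = f.|[v] x.
Proof.
move=> H v y; have : y \in limg f.|[v] by rewrite H memvf.
by case/memv_imgP => x _ ->; exists x.
Qed.

Lemma rsurjPn M N (f : rhom M N) : (forall v y, exists x, y = f.|[v] x) -> rsurjective f.
Proof.
move=> H v; apply/eqP; rewrite eqEsubv subvf; apply/subvP => y _.
by have [x ->] := H v y; rewrite memv_img ?memvf.
Qed.

Lemma rinj_can L M N (i : rhom M N) (f g : rhom L M) : rinjective i -> i \c f = i \c g -> f = g.
Proof.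
move=> ii e; apply: rhom_ext => v x; apply: (rinjP ii).
by rewrite -!comp_lfunE -!rcompE e.
Qed.

Lemma rsurj_can L M N (p : rhom L M) (f g : rhom M N) : rsurjective p -> f \c p = g \c p -> f = g.
Proof.
move=> ps e; apply: rhom_ext => v y; have [x ->] := rsurjP ps y.
by rewrite -!comp_lfunE -!rcompE e.
Qed.

Lemma retr_inj M N (i : rhom M N) (p : rhom N M) : p \c i = id1 -> rinjective i.
Proof.
move=> e; apply: rinjPn => v; apply: (@can_inj _ _ _ p.|[v]) => x.
by rewrite -comp_lfunE -rcompE e ridE id_lfunE.
Qed.

Lemma retr_surj M N (i : rhom M N) (p : rhom N M) : p \c i = id1 -> rsurjective p.
Proof.
move=> e; apply: rsurjPn => v y; exists (i.|[v] y).
by rewrite -comp_lfunE -rcompE e ridE id_lfunE.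
Qed.

Lemma rinj_comp L M N (g : rhom M N) (f : rhom L M) :
  rinjective g -> rinjective f -> rinjective (g \c f).
Proof.
move=> ig jf; apply: rinjPn => v x y; rewrite rcompE !comp_lfunE.
by move/(rinjP ig)/(rinjP jf).
Qed.

Lemma rsurj_comp L M N (g : rhom M N) (f : rhom L M) :
  rsurjective g -> rsurjective f -> rsurjective (g \c f).
Proof.
move=> sg sf; apply: rsurjPn => v y; have [z ->] := rsurjP sg y.
by have [x ->] := rsurjP sf z; exists x; rewrite rcompE comp_lfunE.
Qed.

Lemma iso_inj M N (f : rhom M N) : is_iso f -> rinjective f.
Proof. by move=> [g [H _]]; apply: retr_inj H. Qed.

Lemma iso_surj M N (f : rhom M N) : is_iso f -> rsurjective f.
Proof. by move=> [g [_ H]]; apply: retr_surj H. Qed.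

Lemma rsurj_dim M N (f : rhom M N) : rinjective f -> rsurjective f ->
  forall v, \dim {:M v} = \dim {:N v}.
Proof. by move=> fi fs v; rewrite -(fs v) limg_dim_eq // (fi v) capv0. Qed.

Lemma riso_dim M N : riso M N -> forall v, \dim {:M v} = \dim {:N v}.
Proof. by move/risoP=> [f Hf]; apply: rsurj_dim (iso_inj Hf) (iso_surj Hf). Qed.

Lemma dim_vecE M v : dim_vec M v 0 = \dim {:M v}.
Proof. by rewrite mxE. Qed.

Lemma riso_dim_vec M N : riso M N -> dim_vec M = dim_vec N.
Proof. by move=> /riso_dim H; apply/matrixP => v j; rewrite !mxE H. Qed.

Lemma factor_inj X K M (i : rhom K M) (g : rhom X M) : rinjective i ->
  (forall v x, g.|[v] x \in limg i.|[v]) -> exists h : rhom X K, i \c h = g.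
Proof.
move=> ii gi.
have VK v x : i.|[v] ((i.|[v])^-1%VF (g.|[v] x)) = g.|[v] x.
  by apply: limg_lfunVK; apply: gi.
have C a : (rmap K a \o ((i.|[src a])^-1 \o g.|[src a]) =
            (i.|[tgt a])^-1 \o g.|[tgt a] \o rmap X a)%VF.
  apply/lfunP => x; apply: (rinjP ii); rewrite !comp_lfunE VK.
  by rewrite -rhom_nat VK rhom_nat.
exists (mk_rhom (f := fun v => ((i.|[v])^-1 \o g.|[v])%VF) C).
by apply: rhom_ext => v x; rewrite rcompE comp_lfunE mk_rhomE comp_lfunE VK.
Qed.

Lemma subrep_exists M (U : forall v, {vspace M v}) :
  (forall a x, x \in U (src a) -> rmap M a x \in U (tgt a)) ->
  exists K, exists i : rhom K M, rinjective i /\ forall v, limg i.|[v] = U v.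
Proof.
move=> st.
pose K := @Rep k n Q (fun v => subvs_of (U v))
  (fun a => linfun (vsproj (U (tgt a))) \o (rmap M a \o linfun vsval))%VF.
have C a : (rmap M a \o linfun vsval = linfun vsval \o rmap K a)%VF.
  apply/lfunP => x; rewrite /= !comp_lfunE !lfunE /= vsprojK //.
  by apply: st; apply: subvsP.
exists K, (mk_rhom (M := K) (f := fun v => linfun vsval) C); split.
  by apply: rinjPn => v x y; rewrite mk_rhomE !lfunE => /subvs_inj.
move=> v; apply/eqP; rewrite eqEsubv mk_rhomE; apply/andP; split; apply/subvP => x.
  by case/memv_imgP => y _ ->; rewrite lfunE subvsP.
move=> xU; apply/memv_imgP; exists (vsproj (U v) x); rewrite ?memvf //.
by rewrite lfunE /= vsprojK.
Qed.

Lemma kernel_exists M N (p : rhom M N) :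
  exists K, exists i : rhom K M, rinjective i /\ forall v, limg i.|[v] = lker p.|[v].
Proof.
apply: subrep_exists => a x; rewrite !memv_ker => /eqP px.
by rewrite -rhom_nat px linear0.
Qed.

Lemma idem_split M (e : rhom M M) : e \c e = e ->
  exists A, exists i : rhom A M, exists p : rhom M A, p \c i = id1 /\ i \c p = e.
Proof.
move=> ee.
have [|A [i [ii im]]] := @subrep_exists M (fun v => limg e.|[v]).
  by move=> a x /memv_imgP[y _ ->]; rewrite rhom_nat memv_img ?memvf.
have [|p ip] := @factor_inj _ _ _ i e ii.
  by move=> v x; rewrite im memv_img ?memvf.
exists A, i, p; split=> //; apply: (rinj_can ii); rewrite rcompA ip rcomp1r.
apply: rhom_ext => v x; have : i.|[v] x \in limg e.|[v] by rewrite -im memv_img ?memvf.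
by case/memv_imgP => y _ E; rewrite rcompE comp_lfunE E -comp_lfunE -rcompE ee.
Qed.

(** Orthogonality p1 i2 = 0 = p2 i1 follows from these three equations. *)
Definition biprod M A B (i1 : rhom A M) (i2 : rhom B M) (p1 : rhom M A) (p2 : rhom M B) :=
  [/\ p1 \c i1 = id1, p2 \c i2 = id1 & i1 \c p1 + i2 \c p2 = id1].

Lemma biprod0 M A B (i1 : rhom A M) i2 p1 (p2 : rhom M B) :
  biprod i1 i2 p1 p2 -> p1 \c i2 = 0 /\ p2 \c i1 = 0.
Proof.
move=> [h1 h2 h]; split.
  have := congr1 (fun f => p1 \c f \c i2) h.
  rewrite rcompDr rcompDl !rcompA h1 rcomp1l -!rcompA h2 !rcomp1r rcomp1l.
  by rewrite -[X in _ = X]addr0 => /addrI.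
have := congr1 (fun f => p2 \c f \c i1) h.
rewrite rcompDr rcompDl !rcompA h2 rcomp1l -!rcompA h1 !rcomp1r rcomp1l.
by rewrite -[X in _ = X]add0r => /addIr.
Qed.

Definition bisum M A B := exists i1 i2 p1 p2, @biprod M A B i1 i2 p1 p2.

Lemma bisum_sym M A B : bisum M A B -> bisum M B A.
Proof. by move=> [i1 [i2 [p1 [p2 [h1 h2 h]]]]]; exists i2, i1, p2, p1; split; rewrite // addrC. Qed.

Lemma bisum_iso M M' A A' B B' :
  riso M M' -> riso A A' -> riso B B' -> bisum M A B -> bisum M' A' B'.
Proof.
move=> [m [m' [m1 m2]]] [a [a' [a1 a2]]] [b [b' [b1 b2]]] [i1 [i2 [p1 [p2 [h1 h2 h]]]]].
exists (m \c i1 \c a'), (m \c i2 \c b'), (a \c p1 \c m'), (b \c p2 \c m'); split.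
- by rewrite !rcompA (rcompK _ m1) (rcompK _ h1) a2.
- by rewrite !rcompA (rcompK _ m1) (rcompK _ h2) b2.
- rewrite !rcompA (rcompK _ a1) (rcompK _ b1).
  by rewrite -rcompDl -!(rcompA m) -rcompDr h rcomp1r.
Qed.

Lemma bisum_idem M (e : rhom M M) : e \c e = e ->
  exists A B i1 i2 p1 p2, @biprod M A B i1 i2 p1 p2 /\ i1 \c p1 = e.
Proof.
move=> ee; have [A [i [p [pi ip]]]] := idem_split ee.
have [|B [j [q [qj jq]]]] := @idem_split M (id1 - e).
  by rewrite rcompBl !rcompBr !rcomp1l !rcomp1r ee subrr subr0.
by exists A, B, i, j, p, q; split=> //; split=> //; rewrite ip jq addrC subrK.
Qed.

Lemma biprod_exact M A B (i1 : rhom A M) i2 p1 (p2 : rhom M B) :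
  biprod i1 i2 p1 p2 -> short_exact i1 p2.
Proof.
move=> H; have [h1 h2 h] := H; have [_ z] := biprod0 H; split.
- exact: retr_inj h1.
- exact: retr_surj h2.
move=> v; apply/eqP; rewrite eqEsubv; apply/andP; split; apply/subvP => x.
  by case/memv_imgP => y _ ->; rewrite memv_ker -comp_lfunE -rcompE z at0 zero_lfunE.
rewrite memv_ker => /eqP p0; apply/memv_imgP; exists (p1.|[v] x); first by rewrite memvf.
have := congr1 (fun f => f.|[v] x) h.
by rewrite atD !rcompE ridE add_lfunE !comp_lfunE id_lfunE p0 linear0 addr0.
Qed.

Lemma exact_dim A M B (i : rhom A M) (p : rhom M B) : short_exact i p ->
  forall v, \dim {:M v} = (\dim {:A v} + \dim {:B v})%N.
Proof.
move=> [ii ps ex] v; rewrite -(limg_ker_dim p.|[v] fullv) capfv (ps v) -ex.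
by rewrite limg_dim_eq // (ii v) capv0.
Qed.

Lemma bisum_dim M A B : bisum M A B -> forall v, \dim {:M v} = (\dim {:A v} + \dim {:B v})%N.
Proof. by move=> [i1 [i2 [p1 [p2 /biprod_exact H]]]]; apply: exact_dim H. Qed.

Lemma bisum_dim_vec M A B : bisum M A B -> dim_vec M = dim_vec A + dim_vec B.
Proof. by move/bisum_dim=> H; apply/matrixP => v j; rewrite !mxE H. Qed.

Lemma dim0P (V : vectType k) : \dim {:V} = 0%N <-> forall x : V, x = 0.
Proof.
split=> [d0 x|x0].
  have /eqP : (fullv : {vspace V}) == 0%VS by rewrite -dimv_eq0 d0.
  by move=> e; apply/eqP; rewrite -memv0 -e memvf.
apply/eqP; rewrite dimv_eq0 -subv0; apply/subvP => x _; by rewrite (x0 x) mem0v.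
Qed.

Lemma zero_hom0 M : is_zero M <-> rid M = 0.
Proof.
split=> [z|e v].
  by apply: rhom_ext => v x; have /dim0P H := z v; rewrite [LHS]H [RHS]H.
by apply/dim0P => x; rewrite -[x]id_lfunE -ridE e at0 zero_lfunE.
Qed.

Lemma is_zero_iso M N : riso M N -> is_zero M -> is_zero N.
Proof. by move=> /riso_dim H z v; rewrite -H z. Qed.

Section Rsum.
Variables (I : finType) (F : I -> rep).

Lemma rprj_subproof i a :
  (rmap (F i) a \o linfun (fun x : rsum F (src a) => dapp x i) =
   linfun (fun x : rsum F (tgt a) => dapp x i) \o rmap (rsum F) a)%VF.
Proof.
have L v : linear (fun x : rsum F v => dapp x i).
  by move=> c x y; rewrite dprodD dprodZ.
pose P v : {linear rsum F v -> F i v} := HB.pack (fun x : rsum F v => dapp x i)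
  (GRing.isLinear.Build _ _ _ _ (fun x : rsum F v => dapp x i) (L v)).
apply/lfunP => x; rewrite !comp_lfunE (lfunE (P (src a))) (lfunE (P (tgt a))) /=.
by rewrite dmapE.
Qed.
Definition rprj i : rhom (rsum F) (F i) :=
  mk_rhom (M := rsum F) (f := fun v => linfun (fun x : rsum F v => dapp x i))
    (rprj_subproof i).

Lemma rprjE i v (x : rsum F v) : (rprj i).|[v] x = dapp x i.
Proof.
have L : linear (fun x : rsum F v => dapp x i).
  by move=> c y z; rewrite dprodD dprodZ.
pose P : {linear rsum F v -> F i v} := HB.pack (fun x : rsum F v => dapp x i)
  (GRing.isLinear.Build _ _ _ _ (fun x : rsum F v => dapp x i) L).
by rewrite mk_rhomE (lfunE P).
Qed.

Section Tuple.
Variables (X : rep) (f : forall i, rhom X (F i)).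

Definition rtuple_fun v (x : X v) : rsum F v := dmk (fun i => (f i).|[v] x).

Fact rtuple_linear v : linear (@rtuple_fun v).
Proof. by move=> c x y; apply/dprodP => i; rewrite dprodD dprodZ !dmkE linearP. Qed.
HB.instance Definition _ v :=
  GRing.isLinear.Build k _ _ _ (@rtuple_fun v) (@rtuple_linear v).

Fact rtuple_subproof a :
  (rmap (rsum F) a \o linfun (@rtuple_fun (src a)) =
   linfun (@rtuple_fun (tgt a)) \o rmap X a)%VF.
Proof.
apply/lfunP => x; rewrite !comp_lfunE !lfunE /=.
by apply/dprodP => i; rewrite /= /dmap_fun !dmkE rhom_nat.
Qed.
Definition rtuple : rhom X (rsum F) :=
  mk_rhom (N := rsum F) (f := fun v => linfun (@rtuple_fun v)) rtuple_subproof.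

Lemma rprj_tuple i : rprj i \c rtuple = f i.
Proof.
apply: rhom_ext => v x; rewrite rcompE comp_lfunE rprjE mk_rhomE lfunE /=.
exact: (dmkE (fun i => (f i).|[v] x) i).
Qed.
End Tuple.

Lemma rprj_ext X (f g : rhom X (rsum F)) :
  (forall i, rprj i \c f = rprj i \c g) -> f = g.
Proof.
move=> H; apply: rhom_ext => v x; apply/dprodP => i.
by rewrite -!rprjE -!comp_lfunE -!rcompE H.
Qed.

Definition rinj i : rhom (F i) (rsum F) :=
  rtuple (fun j => dfwith (fun j => (0 : rhom (F i) (F j))) (rid (F i)) j).

Lemma rprj_inj i : rprj i \c rinj i = id1.
Proof. by rewrite rprj_tuple dfwith_in. Qed.

Lemma rprj_inj0 i j : i != j -> rprj j \c rinj i = 0.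
Proof. by move=> ne; rewrite rprj_tuple dfwith_out. Qed.

Lemma rsum_id : \sum_i rinj i \c rprj i = id1.
Proof.
apply: rprj_ext => j; rewrite rcomp_sumr (bigD1 j) //= rcompA rprj_inj rcomp1l.
by rewrite rcomp1r big1 ?addr0 // => i ne; rewrite rcompA rprj_inj0 // rcomp0l.
Qed.

Lemma rinj_ext X (f g : rhom (rsum F) X) :
  (forall i, f \c rinj i = g \c rinj i) -> f = g.
Proof.
move=> H; rewrite -[f]rcomp1r -[g]rcomp1r -rsum_id !rcomp_sumr.
by apply: eq_bigr => i _; rewrite !rcompA H.
Qed.

End Rsum.
End Cat.

(** * Polynomials in an endomorphism and indecomposable representations *)

Section Peval.
Variables (k : fieldType) (n : nat) (Q : quiver n) (M : rep k Q).
Implicit Types (f g e : rhom M M) (p q r : {poly k}).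

Definition rpow f i : rhom M M := iter i (fun g => f \c g) (rid M).

Definition peval f p : rhom M M := \sum_(i < size p) p`_i *: rpow f i.

Lemma peval_bound f p N : (size p <= N)%N -> peval f p = \sum_(i < N) p`_i *: rpow f i.
Proof.
move=> pN; rewrite /peval (big_ord_widen _ (fun i => p`_i *: rpow f i) pN).
rewrite big_mkcond /=; apply: eq_bigr => i _; case: ltnP => // pi.
by rewrite nth_default // scale0r.
Qed.

Lemma pevalD f p q : peval f (p + q) = peval f p + peval f q.
Proof.
pose N := maxn (size p) (size q).
rewrite !(@peval_bound _ _ N) ?leq_maxl ?leq_maxr ?size_polyD // -big_split.
by apply: eq_bigr => i _; rewrite coefD scalerDl.
Qed.

Lemma pevalZ f c p : peval f (c *: p) = c *: peval f p.
Proof.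
rewrite !(@peval_bound _ _ (size p)) ?size_scale_leq // scaler_sumr.
by apply: eq_bigr => i _; rewrite coefZ scalerA.
Qed.

Lemma pevalC f c : peval f c%:P = c *: rid M.
Proof.
by rewrite (@peval_bound _ _ 1) ?size_polyC ?leq_b1 // big_ord1 coefC.
Qed.

Lemma peval0 f : peval f 0 = 0.
Proof. by rewrite -[0]polyC0 pevalC scale0r. Qed.

Lemma pevalN f p : peval f (- p) = - peval f p.
Proof. by rewrite -scaleN1r pevalZ scaleN1r. Qed.

Lemma pevalMX f p : peval f (p * 'X) = f \c peval f p.
Proof.
rewrite (@peval_bound _ _ (size p).+1); last first.
  by rewrite (leq_trans (size_polyMleq _ _)) // size_polyX addnC.
rewrite big_ord_recl coefMX eqxx scale0r add0r /peval rcomp_sumr.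
by apply: eq_bigr => i _; rewrite coefMX /= rcompZr.
Qed.

Lemma pevalX f : peval f 'X = f.
Proof. by rewrite -[X in peval f X]mul1r pevalMX pevalC scale1r rcomp1r. Qed.

Lemma pevalM f p q : peval f (p * q) = peval f p \c peval f q.
Proof.
elim/poly_ind: p => [|p c IH]; first by rewrite mul0r peval0 rcomp0l.
rewrite mulrDl -mulrA ['X * q]mulrC mulrA !pevalD !pevalMX IH rcompDl rcompA.
by rewrite mul_polyC pevalZ pevalC rcompZl rcomp1l.
Qed.

Lemma pevalMC f p q : peval f p \c peval f q = peval f q \c peval f p.
Proof. by rewrite -!pevalM mulrC. Qed.

(** The powers of f are linearly dependent. *)
Lemma annihilator f : exists2 r, r != 0 & peval f r = 0.
Proof.
pose N := (\dim {:rhom M M}).+1.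
pose X := [tuple rpow f i | i < N].
have nf : ~~ free X.
  apply/negP; rewrite /free size_tuple => /eqP E.
  have := dimvS (subvf <<X>>%VS); rewrite E ltnn //.
have [c [i [c0 ci]]] : exists c : 'I_N -> k, exists i,
    \sum_(i < N) c i *: X`_i = 0 /\ c i != 0.
  apply: NNPP => H; case/negP: nf; apply/freeP => c c0 i.
  by apply/eqP; apply: contraT => ci; case: H; exists c, i.
exists (\poly_(i < N) (if insub i is Some j then c j else 0)).
  apply: contraNneq ci => /(congr1 (fun p : {poly k} => p`_i)).
  by rewrite coef_poly ltn_ord coef0 valK => ->.
rewrite (peval_bound f (size_poly _ _)) -[RHS]c0; apply: eq_bigr => j _.
by rewrite coef_poly ltn_ord valK -tnth_nth tnth_mktuple.
Qed.

(** A factorization of an annihilating polynomial into coprime factors gives a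
    projector, which is a polynomial in the endomorphism. *)
Lemma coprime_idem f p q : coprimep p q -> peval f (p * q) = 0 ->
  exists e, [/\ e \c e = e, e \c f = f \c e, peval f p \c e = 0
              & peval f q \c (rid M - e) = 0].
Proof.
move=> /Bezout_eq1_coprimepP[[u v] /= uv] pq0.
have id1 : rid M = peval f (u * p) + peval f (v * q).
  by rewrite -pevalD uv pevalC scale1r.
exists (peval f (v * q)); split.
- rewrite -[RHS]rcomp1l id1 rcompDl -!pevalM [u * p * _]mulrACA.
  by rewrite (pevalM _ (u * v)) pq0 rcomp0r add0r.
- by have := pevalMC f (v * q) 'X; rewrite pevalX.
- by rewrite -pevalM mulrCA pevalM pq0 rcomp0r.
- by rewrite id1 addrK -pevalM mulrCA [q * p]mulrC pevalM pq0 rcomp0r.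
Qed.

Lemma coprime_iso f p q : coprimep p q -> peval f q = 0 -> is_iso (peval f p).
Proof.
move=> /Bezout_eq1_coprimepP[[u v] /= uv] q0.
have E : peval f u \c peval f p = rid M.
  rewrite -pevalM -[LHS]addr0 -(rcomp0r _ (peval f v)) -q0 -pevalM -pevalD uv.
  by rewrite pevalC scale1r.
by exists (peval f u); split=> //; rewrite pevalMC.
Qed.

Lemma peval_eigen f p v x z : f.|[v] x = z *: x -> (peval f p).|[v] x = p.[z] *: x.
Proof.
move=> fx; elim/poly_ind: p => [|p c IH].
  by rewrite peval0 at0 zero_lfunE horner0 scale0r.
rewrite pevalD pevalMX pevalC atD add_lfunE rcompE comp_lfunE IH linearZ /= fx.
rewrite atZ scale_lfunE ridE id_lfunE hornerMXaddC scalerDl scalerA.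
by [].
Qed.

End Peval.

Section PevalSub.
Variables (k : fieldType) (n : nat) (Q : quiver n) (M A : rep k Q).

Lemma peval_intertwine (f : rhom M M) (g : rhom A A) (i : rhom A M) p :
  f \c i = i \c g -> peval f p \c i = i \c peval g p.
Proof.
move=> fi; elim/poly_ind: p => [|p c IH].
  by rewrite !peval0 rcomp0l rcomp0r.
rewrite !pevalD !pevalMX !pevalC rcompDl rcompDr rcompZl rcompZr rcomp1l rcomp1r.
by rewrite -rcompA IH !rcompA fi.
Qed.
End PevalSub.

Section Indec.
Variables (k : fieldType) (n : nat) (Q : quiver n).
Notation rep := (rep k Q).
Implicit Types (M N A B C X Y : rep).

Definition bsum A B : rep := rsum (fun b : bool => if b then A else B).

Lemma bsum_biprod A B : bisum (bsum A B) A B.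
Proof.
pose F := fun b : bool => if b then A else B.
exists (rinj F true), (rinj F false), (rprj F true), (rprj F false).
split; [exact: (rprj_inj F true) | exact: (rprj_inj F false) | ].
by have := rsum_id F; rewrite big_bool.
Qed.

Lemma bisum_uniq M N A B : bisum M A B -> bisum N A B -> riso M N.
Proof.
move=> [i1 [i2 [p1 [p2 H]]]] [j1 [j2 [q1 [q2 K]]]].
have [h1 h2 h] := H; have [g1 g2 g] := K.
have [h12 h21] := biprod0 H; have [g12 g21] := biprod0 K.
exists (j1 \c p1 + j2 \c p2), (i1 \c q1 + i2 \c q2); split.
  rewrite !rcompDl !rcompDr !rcompA (rcompK _ g1) (rcompK _ g2).
  by rewrite (rcompK0 _ g12) (rcompK0 _ g21) !rcomp0l addr0 add0r.
rewrite !rcompDl !rcompDr !rcompA (rcompK _ h1) (rcompK _ h2).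
by rewrite (rcompK0 _ h12) (rcompK0 _ h21) !rcomp0l addr0 add0r.
Qed.

Lemma indecP M : indecomposable M <->
  ~ is_zero M /\ forall A B, bisum M A B -> is_zero A \/ is_zero B.
Proof.
split=> -[nz H]; split=> // A B S; apply: H.
  exact: bisum_uniq S (bsum_biprod A B).
exact: bisum_iso (riso_sym S) (riso_refl A) (riso_refl B) (bsum_biprod A B).
Qed.

Lemma indec_idem M (e : rhom M M) : indecomposable M -> e \c e = e ->
  e = 0 \/ e = rid M.
Proof.
move=> /indecP[nz H] ee.
have [A [B [i1 [i2 [p1 [p2 [S e1]]]]]]] := bisum_idem ee.
have [_ _ h] := S.
have [|/zero_hom0 z|/zero_hom0 z] := H A B; first by exists i1, i2, p1, p2.
  by left; rewrite -e1 -[i1]rcomp1r z rcomp0r rcomp0l.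
right; rewrite -h e1 -[i2]rcomp1r z.
by rewrite rcomp0r rcomp0l addr0.
Qed.

Lemma indec_cases M : is_zero M \/ indecomposable M \/
  exists A B, [/\ bisum M A B, ~ is_zero A & ~ is_zero B].
Proof.
have [z|nz] := classic (is_zero M); [by left | right].
have [H|H] := classic (exists A B, [/\ bisum M A B, ~ is_zero A & ~ is_zero B]).
  by right.
left; apply/indecP; split=> // A B S; have [zA|nA] := classic (is_zero A); first by left.
by right; apply: NNPP => nB; case: H; exists A, B.
Qed.

Definition tdim M : nat := \sum_v \dim {:M v}.

Lemma tdim_bisum M A B : bisum M A B -> tdim M = (tdim A + tdim B)%N.
Proof. by move/bisum_dim=> H; rewrite /tdim -big_split; apply: eq_bigr => v _. Qed.

Lemma tdim0 M : tdim M = 0%N <-> is_zero M.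
Proof.
split=> [/eqP|z]; last by rewrite /tdim big1.
by rewrite sum_nat_eq0 => /forallP H v; apply/eqP/H.
Qed.

Lemma tdim_gt0 M : ~ is_zero M -> (0 < tdim M)%N.
Proof. by move=> nz; rewrite lt0n; apply/eqP => /tdim0. Qed.

(** The idempotent i p of B is 0 or 1. *)
Lemma indec_retract A B (i : rhom A B) (p : rhom B A) : ~ is_zero A ->
  indecomposable B -> p \c i = rid A -> is_iso i.
Proof.
move=> nzA iB pi.
have ee : (i \c p) \c (i \c p) = i \c p by rewrite rcompA (rcompK _ pi).
have [e0|e1] := indec_idem iB ee; last by exists p.
case: nzA; apply/zero_hom0.
have -> : rid A = p \c (i \c p) \c i by rewrite rcompA (rcompK _ pi) pi.
by rewrite e0 rcomp0r rcomp0l.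
Qed.

End Indec.

Section Local.
Variables (k : closedFieldType) (n : nat) (Q : quiver n).
Notation rep := (rep k Q).
Implicit Types (M N A B C X Y : rep).

(** Splits off all factors of one root. *)
Lemma mult_root (r : {poly k}) l : r != 0 -> root r l -> exists q m,
  [/\ r = q * ('X - l%:P) ^+ m, coprimep q (('X - l%:P) ^+ m),
      q != 0 & (size q < size r)%N].
Proof.
move=> nr rl; have [m [q]] := multiplicity_XsubC r l; rewrite nr /= => ql rE.
have nq : q != 0 by apply: contraNneq nr => q0; rewrite rE q0 mul0r.
exists q, m; split=> //; first by rewrite coprimep_expr // coprimep_XsubC.
case: m rE => [|m] rE; first by rewrite rE expr0 mulr1 in rl; rewrite rl in ql.
rewrite rE size_Mmonic ?monic_exp ?monicXsubC // size_exp_XsubC addnS /=.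
by rewrite addnS ltnS leq_addr.
Qed.

(** A second eigenvalue would split off a projector. *)
Lemma indec_nilp A (f : rhom A A) : indecomposable A ->
  exists l m, peval f (('X - l%:P) ^+ m) = 0.
Proof.
move=> iA; have [r nr r0] := annihilator f.
have [N] := ubnP (size r); elim: N r nr r0 => // N IH r nr r0 sr.
case: (eqVneq (size r) 1%N) => [/eqP/size_poly1P[c nc rc]|s1].
  exists 0, 0%N; rewrite expr0; move: r0; rewrite rc -[c%:P]mulr1 mul_polyC pevalZ.
  by move/eqP; rewrite scaler_eq0 (negPf nc) => /eqP.
have [l rl] := closed_rootP _ s1.
have [q [m [rE cop nq sq]]] := mult_root nr rl.
rewrite rE in r0; have [e [ee _ qe me]] := coprime_idem cop r0.
have [e0|e1] := indec_idem iA ee.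
  by exists l, m; rewrite -me e0 subr0 rcomp1r.
apply: (IH q) => //; last exact: leq_trans sq sr.
by rewrite -qe e1 rcomp1r.
Qed.

(** f has one eigenvalue, so f or 1 - f has only nonzero eigenvalues. *)
Lemma indec_local A (f g : rhom A A) : indecomposable A -> f + g = rid A ->
  is_iso f \/ is_iso g.
Proof.
move=> iA fg; have [l [m fl]] := indec_nilp f iA.
have [l0|nl] := eqVneq l 0; [right | left].
  have [h [h1 h2]] : is_iso (peval f ('X - 1%:P)).
    apply: coprime_iso fl; rewrite coprimep_expr // coprimep_XsubC l0.
    by rewrite rootE !hornerE oppr_eq0 oner_neq0.
  have gE : g = - peval f ('X - 1%:P).
    by rewrite pevalD pevalN pevalX pevalC scale1r opprB -fg addrC addKr.
  exists (- h); rewrite gE rcompNl rcompNr opprK h1 rcompNl rcompNr opprK h2.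
  by [].
rewrite -(pevalX f); apply: coprime_iso fl.
by rewrite coprimep_expr // coprimep_XsubC rootE hornerX.
Qed.

End Local.

(** * Decompositions into indecomposables: existence and the Krull-Schmidt theorem *)

Section KrullSchmidt.
Variables (k : closedFieldType) (n : nat) (Q : quiver n).
Notation rep := (rep k Q).
Implicit Types (M N A B C X Y : rep).
Implicit Types (s t : seq 'cV[nat]_n).

(** Only the dimension vectors are recorded: lists of vectors are what can be
    compared between different representations. *)
Inductive decomp : rep -> seq 'cV[nat]_n -> Prop :=
| Decomp0 M : is_zero M -> decomp M [::]
| DecompS M A B s : bisum M A B -> indecomposable A -> decomp B s ->
    decomp M (dim_vec A :: s).

Lemma decomp_iso M N s : riso M N -> decomp M s -> decomp N s.
Proof.
move=> MN D; case: D MN => {M s} [M z MN|M A B s S iA dB MN].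
  by apply: Decomp0; apply: is_zero_iso MN z.
by apply: (DecompS _ iA dB); apply: bisum_iso S => //; apply: riso_refl.
Qed.

Lemma biprod_assoc M A B C D (j1 : rhom A M) (j2 : rhom B M) q1 q2
    (c : rhom C B) (d : rhom D B) pc pd :
  biprod j1 j2 q1 q2 -> biprod c d pc pd ->
  exists y py, @biprod _ _ _ M C (bsum A D) (j2 \c c) y (pc \c q2) py.
Proof.
move=> H K; have [h1 h2 h] := H; have [g1 g2 g] := K.
have [h12 h21] := biprod0 H; have [g12 g21] := biprod0 K.
have [a [b [pa [pb T]]]] := bsum_biprod A D; have [t1 t2 t] := T.
have [t12 t21] := biprod0 T.
exists (j1 \c pa + j2 \c d \c pb), (a \c q1 + b \c pd \c q2); split.
- by rewrite !rcompA (rcompK _ h2).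
- rewrite !rcompDl !rcompDr !rcompA (rcompK _ h1) (rcompK _ h2).
  rewrite (rcompK _ g2) (rcompK0 _ h21) (rcompK0 _ h12) !rcomp0l addr0 add0r.
  exact: t.
- rewrite !rcompDl !rcompDr !rcompA (rcompK _ t1) (rcompK _ t2).
  rewrite (rcompK0 _ t12) (rcompK0 _ t21) !rcomp0l addr0 add0r addrCA.
  by rewrite -rcompDl -!(rcompA j2) -rcompDr g rcomp1r.
Qed.

(** If one diagonal entry of the matrix of the identity between two
    decompositions is invertible, its Schur complement is invertible as well. *)
Lemma cancel_summand M A X B Y (i1 : rhom A M) (i2 : rhom X M) p1 p2
    (j1 : rhom B M) (j2 : rhom Y M) q1 q2 :
  biprod i1 i2 p1 p2 -> biprod j1 j2 q1 q2 -> is_iso (q1 \c i1) -> riso X Y.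
Proof.
move=> H K [a [a1 a2]]; have [h1 h2 h] := H; have [g1 g2 g] := K.
have [h12 h21] := biprod0 H; have [g12 g21] := biprod0 K.
pose e := rid M - i1 \c a \c q1.
have qe : q1 \c e = 0.
  by rewrite rcompBr rcomp1r !rcompA a2 rcomp1l subrr.
have ei : e \c i1 = 0.
  by rewrite rcompBl rcomp1l -!rcompA a1 rcomp1r subrr.
have jq : j2 \c q2 = rid M - j1 \c q1 by rewrite -g addrC addKr.
have ip : i2 \c p2 = rid M - i1 \c p1 by rewrite -h addrC addKr.
exists (q2 \c e \c i2), (p2 \c j2); split.
  rewrite !rcompA -(rcompA p2) jq -(rcompA p2) rcompBl rcomp1l -(rcompA j1) qe.
  rewrite rcomp0r subr0 rcompBr rcompBl rcomp1r h2 !rcompA h21.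
  by rewrite !rcomp0l subr0.
rewrite !rcompA -(rcompA _ i2) ip -(rcompA q2) rcompBr rcomp1r rcompA ei.
rewrite rcomp0l subr0 rcompBr rcompBl rcomp1r g2 -!rcompA g12.
by rewrite !rcomp0r subr0.
Qed.

(** Since End A is local, the identity of A factors through A' or through B; in
    the first case A' and A cancel, in the second A is a summand of B. *)
Lemma exchange M s : decomp M s -> forall A X, bisum M A X -> indecomposable A ->
  exists t, perm_eq s (dim_vec A :: t) /\ decomp X t.
Proof.
move=> D; elim: D => {M s} [M z|M A' B s S iA' dB IH] A X.
  move=> /tdim_bisum dM [nzA _]; case: nzA; apply/tdim0.
  by move/tdim0: z; rewrite dM => /eqP; rewrite addn_eq0 => /andP[/eqP].
move=> [i1 [i2 [p1 [p2 H]]]] iA; have [nzA _] := iA.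
have [h1 h2 h] := H.
have [j1 [j2 [q1 [q2 K]]]] := S; have [g1 g2 g] := K.
have sum1 : (p1 \c j1) \c (q1 \c i1) + (p1 \c j2) \c (q2 \c i1) = rid A.
  by rewrite !rcompA -rcompDl -!(rcompA p1) -rcompDr g rcomp1r h1.
case: (indec_local iA sum1) => -[u [u1 u2]].
  have iso : is_iso (q1 \c i1).
    apply: (@indec_retract _ _ _ _ _ _ (u \c (p1 \c j1))) => //.
    by rewrite -rcompA.
  have AA : riso A A' by apply/risoP; exists (q1 \c i1).
  exists s; split; first by rewrite (riso_dim_vec AA).
  exact: decomp_iso (riso_sym (cancel_summand H K iso)) dB.
have hq : (u \c (p1 \c j2)) \c (q2 \c i1) = rid A by rewrite -rcompA.
set b := q2 \c i1 in hq; set r := u \c _ in hq.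
have [|C [c [d [dc cd]]]] := @idem_split _ _ _ B (rid B - b \c r).
  by rewrite rcompBl !rcompBr !rcomp1l !rcomp1r rcompA (rcompK _ hq) subrr subr0.
have BP : biprod b c r d by split; rewrite // cd addrC subrK.
have [|s1 [ps dC]] := IH A C _ iA; first by exists b, c, r, d.
have [y [py BP']] := biprod_assoc K BP.
have XY : riso X (bsum A' C).
  apply: (cancel_summand H BP'); rewrite -rcompA hq; exact: is_iso1.
exists (dim_vec A' :: s1); split.
  apply: (@perm_trans _ (dim_vec A' :: dim_vec A :: s1)); first by rewrite perm_cons.
  by apply/seq.permP => z /=; rewrite addnCA.
by apply: decomp_iso (riso_sym XY) _; apply: DecompS (bsum_biprod _ _) iA' dC.
Qed.

Lemma krull_schmidt M s t : decomp M s -> decomp M t -> perm_eq s t.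
Proof.
move=> Ds Dt; elim: Dt s Ds => {M t} [M z|M A B t S iA dB IH] s Ds.
  case: Ds z => // {M s} M A B s S [nzA _] _ /tdim0.
  rewrite (tdim_bisum S) => /eqP; rewrite addn_eq0 => /andP[/eqP/tdim0 zA _].
  by case: nzA.
have [s1 [ps dB']] := exchange Ds S iA.
by apply: perm_trans ps _; rewrite perm_cons; apply: IH.
Qed.

Lemma decomp_mem M s b : decomp M s -> b \in s ->
  exists A B, [/\ bisum M A B, indecomposable A, dim_vec A = b & decomp B (rem b s)].
Proof.
move=> D; elim: D b => {M s} [M z|M A B s S iA dB IH] b //.
rewrite inE; have [->|ne] := eqVneq b (dim_vec A).
  by move=> _; exists A, B; rewrite /= eqxx.
move=> /= /IH[C [D [S' iC dC dD]]].
have [j1 [j2 [q1 [q2 K]]]] := S; have [c [d [pc [pd K']]]] := S'.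
have [y [py BP]] := biprod_assoc K K'.
exists C, (bsum A D); split=> //; first by exists (j2 \c c), y, (pc \c q2), py.
by rewrite eq_sym (negPf ne); apply: DecompS dD => //; apply: bsum_biprod.
Qed.

Lemma decomp_perm M s t : perm_eq s t -> decomp M s -> decomp M t.
Proof.
elim: t s M => [|b t IH] s M pst D.
  by move/perm_nilP: pst D => ->.
have bs : b \in s by rewrite (perm_mem pst) mem_head.
have pr : perm_eq (rem b s) t by rewrite -(perm_cons b) -(permPl (perm_to_rem bs)).
have [A [B [S iA bA dB]]] := decomp_mem D bs.
by rewrite -bA; apply: DecompS S iA (IH _ _ pr dB).
Qed.

Lemma decomp_bisum M A B s t : bisum M A B -> decomp A s -> decomp B t ->
  decomp M (s ++ t).
Proof.
move=> S D; elim: D M S => {A s} [A z|A A1 A2 s S1 iA1 dA2 IH] M S dB /=.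
  apply: decomp_iso dB; have [i1 [i2 [p1 [p2 [h1 h2 h]]]]] := S.
  exists i2, p2; split=> //; rewrite -h -[i1]rcomp1r.
  by have /zero_hom0 -> := z; rewrite rcomp0r rcomp0l add0r.
have [j1 [j2 [q1 [q2 K]]]] := bisum_sym S; have [c [d [pc [pd K']]]] := S1.
have [y [py BP]] := biprod_assoc K K'.
apply: (@DecompS _ _ (bsum B A2)) iA1 (IH _ _ dB).
  by exists (j2 \c c), y, (pc \c q2), py.
exact/bisum_sym/bsum_biprod.
Qed.

Lemma decomp_exists M : exists s, decomp M s.
Proof.
have [N] := ubnP (tdim M); elim: N M => // N IH M sM.
have [z|[iM|[A [B [S nA nB]]]]] := indec_cases M.
- by exists [::]; apply: Decomp0.
- exists [:: dim_vec M]; apply: (@DecompS M M (zero_rep k Q)) => //.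
    exists (rid M), 0, (rid M), 0; split; rewrite ?rcomp1l ?rcomp0l ?addr0 //.
    by apply: rhom_ext => v x; rewrite at0 zero_lfunE; apply/rowP => -[].
  by apply: Decomp0 => v; rewrite dimvf /dim /= muln0.
have dM := tdim_bisum S.
have [s dA] : exists s, decomp A s.
  apply: IH; rewrite dM ltnS in sM; apply: leq_trans sM.
  by rewrite -[X in (X < _)%N]addn0 ltn_add2l tdim_gt0.
have [t dB] : exists t, decomp B t.
  apply: IH; rewrite dM ltnS in sM; apply: leq_trans sM.
  by rewrite -[X in (X < _)%N]add0n ltn_add2r tdim_gt0.
by exists (s ++ t); apply: decomp_bisum S dA dB.
Qed.

Lemma decomp_dim M s : decomp M s -> dim_vec M = \sum_(b <- s) b.
Proof.
elim=> {M s} [M z|M A B s S _ _ IH].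
  by rewrite big_nil; apply/matrixP => v j; rewrite !mxE z.
by rewrite big_cons -IH; apply: bisum_dim_vec.
Qed.

Lemma decomp_nonzero M s b : decomp M s -> b \in s -> b != 0.
Proof.
move=> D /(decomp_mem D)[A [B [_ [nz _] <- _]]]; apply/eqP => A0; apply: nz => v.
by rewrite -dim_vecE A0 mxE.
Qed.

(** * Eigenvalues of endomorphisms *)

Definition chi M (f : rhom M M) v : {poly k} :=
  char_poly (VectorInternalTheory.f2mx f.|[v]).

(** A change of basis to block diagonal form; m = a + b is a consequence of the
    equations. *)
Lemma char_poly_biprod a b m (I1 : 'M[k]_(a, m)) (I2 : 'M_(b, m)) P1 P2
    (A : 'M_a) (B : 'M_b) :
  I1 *m P1 = 1%:M -> I2 *m P2 = 1%:M -> I1 *m P2 = 0 -> I2 *m P1 = 0 ->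
  P1 *m I1 + P2 *m I2 = 1%:M ->
  char_poly (P1 *m A *m I1 + P2 *m B *m I2) = char_poly A * char_poly B.
Proof.
move=> h1 h2 h12 h21 h.
have IP : col_mx I1 I2 *m row_mx P1 P2 = 1%:M.
  by rewrite mul_col_row h1 h2 h12 h21 -scalar_mx_block.
have PI : row_mx P1 P2 *m col_mx I1 I2 = 1%:M by rewrite mul_row_col.
have em : m = (a + b)%N.
  by apply/eqP; rewrite eqn_leq (mulmx1_min PI) (mulmx1_min IP).
move: I1 I2 P1 P2 {h1 h2 h12 h21 h} IP PI; rewrite em => I1 I2 P1 P2 IP PI.
have -> : P1 *m A *m I1 + P2 *m B *m I2 =
  row_mx P1 P2 *m block_mx A 0 0 B *m col_mx I1 I2.
  by rewrite mul_row_block !mulmx0 addr0 add0r mul_row_col.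
set R := row_mx _ _ in IP PI *; set C := col_mx _ _ in IP PI *.
have E : char_poly_mx (R *m block_mx A 0 0 B *m C) =
  map_mx polyC R *m char_poly_mx (block_mx A 0 0 B) *m map_mx polyC C.
  rewrite /char_poly_mx mulmxBr mulmxBl -!map_mxM; congr (_ - _).
  by rewrite mul_mx_scalar -scalemxAl -map_mxM PI map_mx1 scalemx1.
rewrite /char_poly E !det_mulmx mulrAC -det_mulmx -map_mxM PI map_mx1 det1 mul1r.
by rewrite char_block_diag_mx det_ublock.
Qed.

Lemma chi_biprod M A B (i1 : rhom A M) (i2 : rhom B M) p1 p2 a b v :
  biprod i1 i2 p1 p2 ->
  chi (i1 \c a \c p1 + i2 \c b \c p2) v = chi a v * chi b v.
Proof.
move=> H; have [h1 h2 h] := H; have [h12 h21] := biprod0 H.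
have E X Y (f g : rhom X Y) : f = g ->
  VectorInternalTheory.f2mx f.|[v] = VectorInternalTheory.f2mx g.|[v] by move=> ->.
have Z X Y : VectorInternalTheory.f2mx (0 : rhom X Y).|[v] = 0.
  by have := f2mxZ 0 (0 : 'Hom(X v, Y v)); rewrite !scale0r at0.
have D X Y (f g : rhom X Y) : VectorInternalTheory.f2mx (f + g).|[v] =
  VectorInternalTheory.f2mx f.|[v] + VectorInternalTheory.f2mx g.|[v].
  by rewrite atD -[f.|[v] in LHS]scale1r f2mx_linear scale1r.
have := E _ _ _ _ h; have := E _ _ _ _ h12; have := E _ _ _ _ h21.
have := E _ _ _ _ h1; have := E _ _ _ _ h2.
rewrite /chi !D !Z !rcompE !f2mx_comp !ridE !f2mx1 => e2 e1 e21 e12 e.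
by rewrite !mulmxA; apply: char_poly_biprod.
Qed.

Lemma chi_nilp M (f : rhom M M) l m v : peval f (('X - l%:P) ^+ m) = 0 ->
  chi f v = ('X - l%:P) ^+ \dim {:M v}.
Proof.
move=> fl; have [rs E] := closed_field_poly_normal (chi f v).
have mc : chi f v \is monic := char_poly_monic _.
rewrite (monicP mc) scale1r in E.
have rsl z : z \in rs -> z = l.
  move=> zrs; have : root (chi f v) z by rewrite E root_prod_XsubC.
  rewrite -eigenvalue_root_char => /f2mx_eigen[x nx fx].
  have := peval_eigen (('X - l%:P) ^+ m) fx; rewrite fl at0 zero_lfunE.
  move/esym/eqP; rewrite scaler_eq0 (negPf nx) orbF.
  by rewrite horner_exp hornerXsubC expf_eq0 subr_eq0 => /andP[_ /eqP].
have -> : \dim {:M v} = size rs.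
  by rewrite dimvf; apply: succn_inj; rewrite -(size_char_poly (VectorInternalTheory.f2mx f.|[v])) -/(chi f v) E size_prod_XsubC.
rewrite E; elim: rs rsl {E} => [|z rs IH] rsl; first by rewrite big_nil expr0.
rewrite big_cons exprS (rsl z) ?mem_head // IH // => y yrs.
by apply: rsl; rewrite inE yrs orbT.
Qed.

Lemma chi_zero M (f : rhom M M) v : is_zero M -> chi f v = 1.
Proof.
move=> z; rewrite (@chi_nilp _ _ 0 0); first by rewrite z expr0.
by rewrite expr0 pevalC scale1r; apply/zero_hom0.
Qed.

(** Let f act by the scalars ls on the indecomposable summands. *)
Lemma chi_scalars M s (ls : seq k) : decomp M s -> size ls = size s ->
  exists f : rhom M M, forall v,
    chi f v = \prod_(x <- zip ls s) ('X - x.1%:P) ^+ x.2 v 0.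
Proof.
move=> D; elim: D ls => {M s} [M z|M A B s S iA dB IH] [|l ls] //=.
  by move=> _; exists 0 => v; rewrite big_nil chi_zero.
move=> [/IH[g Hg]]; have [i1 [i2 [p1 [p2 K]]]] := S.
exists (i1 \c (l *: rid A) \c p1 + i2 \c g \c p2) => v.
rewrite (chi_biprod _ _ _ K) Hg big_cons (@chi_nilp _ _ l 1) ?dim_vecE //.
by rewrite expr1 pevalD pevalN pevalX pevalC subrr.
Qed.

(** The generalized eigenspaces of f are subrepresentations, since spectral
    projectors are polynomials in f. *)
Lemma spectral_split M (f : rhom M M) : ~ is_zero M ->
  exists l m A B i1 i2 p1 p2 a b,
    [/\ @biprod _ _ _ M A B i1 i2 p1 p2, ~ is_zero A,
        f = i1 \c a \c p1 + i2 \c b \c p2 & peval a (('X - l%:P) ^+ m) = 0].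
Proof.
move=> nz; have [r nr r0] := annihilator f.
have [N] := ubnP (size r); elim: N r nr r0 => // N IH r nr r0 sr.
have s1 : size r != 1%N.
  apply/eqP => /eqP/size_poly1P[c nc rc]; apply/nz/zero_hom0.
  by move: r0; rewrite rc pevalC => /eqP; rewrite scaler_eq0 (negPf nc) => /eqP.
have [l rl] := closed_rootP _ s1.
have [q [m [rE cop nq sq]]] := mult_root nr rl.
rewrite rE in r0; have [e [ee ef qe me]] := coprime_idem cop r0.
have [e1|ne1] := eqVneq e (rid M).
  apply: (IH q) => //; last exact: leq_trans sq sr.
  by rewrite -qe e1 rcomp1r.
have ee' : (rid M - e) \c (rid M - e) = rid M - e.
  by rewrite rcompBl !rcompBr !rcomp1l !rcomp1r ee subrr subr0.
have [A [B [i1 [i2 [p1 [p2 [K ie]]]]]]] := bisum_idem ee'.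
have [h1 h2 h] := K; have [h12 h21] := biprod0 K.
have i2e : i2 \c p2 = e by move: h; rewrite ie => /(canRL (addKr _)) ->; rewrite opprB subrK.
have ei1 : e \c i1 = 0 by rewrite -i2e rcompK0.
have p1e : p1 \c e = 0 by rewrite -i2e rcompA h12 rcomp0l.
have ei2 : e \c i2 = i2 by rewrite -i2e (rcompK _ h2).
have i1f : i1 \c p1 \c f \c i1 = f \c i1.
  by rewrite ie rcompBl rcomp1l rcompBl ef -(rcompA f) ei1 rcomp0r subr0.
exists l, m, A, B, i1, i2, p1, p2, (p1 \c f \c i1), (p2 \c f \c i2); split=> //.
- move=> zA; case/eqP: ne1; apply/esym/eqP; rewrite -subr_eq0 -ie -[i1]rcomp1r.
  by have /zero_hom0 -> := zA; rewrite rcomp0r rcomp0l.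
- rewrite !rcompA i1f -(rcompA f) ie i2e.
  by rewrite -(rcompA _ i2) i2e ef -(rcompA f) ee rcompBr rcomp1r subrK.
- have fi : f \c i1 = i1 \c (p1 \c f \c i1) by rewrite !rcompA i1f.
  have := peval_intertwine (('X - l%:P) ^+ m) fi.
  rewrite -[X in _ \c X = _](rcompK _ h1) ie rcompA me rcomp0l => E.
  by rewrite -[LHS]rcomp1l -h1 -rcompA -E rcomp0r.
Qed.

Lemma spectrum_exists M (f : rhom M M) : exists z : seq (k * 'cV[nat]_n),
  decomp M (unzip2 z) /\
  forall v, chi f v = \prod_(x <- z) ('X - x.1%:P) ^+ x.2 v 0.
Proof.
have [N] := ubnP (tdim M); elim: N M f => // N IH M f sM.
have [z|nz] := classic (is_zero M).
  exists [::]; split=> [|v]; first exact: Decomp0.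
  by rewrite big_nil chi_zero.
have [l [m [A [B [i1 [i2 [p1 [p2 [a [b [K nA fE al]]]]]]]]]]] := spectral_split f nz.
have S : bisum M A B by exists i1, i2, p1, p2.
have [|z [dz Hz]] := IH B b.
  rewrite (tdim_bisum S) ltnS in sM; apply: leq_trans sM.
  by rewrite -[X in (X < _)%N]add0n ltn_add2r tdim_gt0.
have [s dA] := decomp_exists A.
exists ([seq (l, c) | c <- s] ++ z); split.
  rewrite /unzip2 map_cat -map_comp map_id; exact: decomp_bisum S dA dz.
move=> v; rewrite fE (chi_biprod _ _ _ K) Hz big_cat big_map /=; congr (_ * _).
rewrite (chi_nilp _ al) -dim_vecE (decomp_dim dA) summxE.
by rewrite expr_sum.
Qed.

(** By Krull-Schmidt the multiplicities of the eigenvalues are sums of entries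
    of the type of M. *)
Lemma spectrum M s (f : rhom M M) : decomp M s -> exists z : seq (k * 'cV[nat]_n),
  perm_eq (unzip2 z) s /\
  forall v, chi f v = \prod_(x <- z) ('X - x.1%:P) ^+ x.2 v 0.
Proof.
move=> D; have [z [dz Hz]] := spectrum_exists f.
by exists z; split=> //; apply: krull_schmidt dz D.
Qed.

End KrullSchmidt.

(** * Dimensions of Hom spaces and vanishing of Ext *)

Section HomExt.
Import VectorInternalTheory.
Variables (k : fieldType) (n : nat) (Q : quiver n).
Notation rep := (rep k Q).
Implicit Types (M N A B C K P X Y : rep).

Definition hom M N : nat := \dim {:rhom M N}.

Definition postcomp M N X (p : rhom M N) (f : rhom X M) : rhom X N := p \c f.
Fact postcomp_linear M N X (p : rhom M N) : linear (@postcomp M N X p).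
Proof. by move=> c f g; rewrite /postcomp rcompDr rcompZr. Qed.
HB.instance Definition _ M N X (p : rhom M N) :=
  GRing.isLinear.Build k _ _ _ (@postcomp M N X p) (@postcomp_linear M N X p).

Lemma dim_mid (U V W : vectType k) (a : {linear U -> V}) (b : {linear V -> W}) :
  (forall x, b x = 0 -> exists y, x = a y) ->
  (\dim {:V} <= \dim {:U} + \dim (limg (linfun b)))%N.
Proof.
move=> ex; rewrite -(limg_ker_dim (linfun b) fullv) capfv leq_add2r.
apply: (@leq_trans (\dim (limg (linfun a)))); last first.
  by rewrite -(limg_ker_dim (linfun a) fullv) leq_addl.
apply: dimvS; apply/subvP => x; rewrite memv_ker lfunE => /eqP/ex[y ->].
by rewrite -(lfunE a) memv_img ?memvf.
Qed.

Lemma factor_surj P B X (p : rhom P B) (g : rhom P X) : rsurjective p ->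
  (forall v x, p.|[v] x = 0 -> g.|[v] x = 0) -> exists s : rhom B X, s \c p = g.
Proof.
move=> ps z.
have VK v y : p.|[v] ((p.|[v])^-1%VF y) = y.
  by apply: limg_lfunVK; rewrite ps memvf.
have gV v x : g.|[v] ((p.|[v])^-1%VF (p.|[v] x)) = g.|[v] x.
  by apply/eqP; rewrite -subr_eq0 -linearB; apply/eqP/z; rewrite linearB /= VK subrr.
have C a : (rmap X a \o (g.|[src a] \o (p.|[src a])^-1) =
            g.|[tgt a] \o (p.|[tgt a])^-1 \o rmap B a)%VF.
  apply/lfunP => y; have [x ->] := rsurjP ps y.
  by rewrite !comp_lfunE gV (rhom_nat p) gV (rhom_nat g).
exists (mk_rhom (f := fun v => (g.|[v] \o (p.|[v])^-1)%VF) C).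
by apply: rhom_ext => v x; rewrite rcompE comp_lfunE mk_rhomE comp_lfunE gV.
Qed.

Lemma exact_comp0 A X B (i : rhom A X) (p : rhom X B) : short_exact i p -> p \c i = 0.
Proof.
move=> [ii ps ex]; apply: rhom_ext => v x; rewrite at0 zero_lfunE rcompE comp_lfunE.
by apply/eqP; rewrite -memv_ker -ex memv_img ?memvf.
Qed.

Lemma exact_factor_l A X B N (i : rhom A X) (p : rhom X B) (f : rhom X N) :
  short_exact i p -> f \c i = 0 -> exists s : rhom B N, s \c p = f.
Proof.
move=> [ii ps ex] fi; apply: factor_surj ps _ => v x px.
have : x \in limg i.|[v] by rewrite ex memv_ker px.
by case/memv_imgP => y _ ->; rewrite -comp_lfunE -rcompE fi at0 zero_lfunE.
Qed.

Lemma exact_factor_r A X B N (i : rhom A X) (p : rhom X B) (f : rhom N X) :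
  short_exact i p -> p \c f = 0 -> exists s : rhom N A, i \c s = f.
Proof.
move=> [ii ps ex] pf0; apply: factor_inj ii _ => v x.
by rewrite ex memv_ker -comp_lfunE -rcompE pf0 at0 zero_lfunE.
Qed.

Lemma hom_exact_l A X B (i : rhom A X) (p : rhom X B) N : short_exact i p ->
  (hom X N <= hom B N + \dim (limg (linfun (@precomp _ _ _ A X N i))))%N.
Proof.
move=> ex; apply: (@dim_mid _ _ _ (@precomp _ _ _ X B N p) (@precomp _ _ _ A X N i)) => f fi.
by have [s sp] := exact_factor_l ex fi; exists s.
Qed.

Lemma hom_exact_le_l A X B (i : rhom A X) (p : rhom X B) N : short_exact i p ->
  (hom X N <= hom A N + hom B N)%N.
Proof.
move=> ex; apply: leq_trans (hom_exact_l N ex) _.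
by rewrite addnC leq_add2r dimvS ?subvf.
Qed.

Lemma hom_exact_le_r A X B (i : rhom A X) (p : rhom X B) N : short_exact i p ->
  (hom N X <= hom N A + hom N B)%N.
Proof.
move=> ex; rewrite /hom.
apply: leq_trans (_ : \dim {:rhom N A} + \dim (limg (linfun (@postcomp X B N p))) <= _)%N.
  apply: (@dim_mid _ _ _ (@postcomp A X N i) (@postcomp X B N p)) => f fi.
  by have [s si] := exact_factor_r ex fi; exists s.
by rewrite leq_add2l dimvS ?subvf.
Qed.

(** The identity of A does not extend to X, so hom X A is less than for the
    direct sum. *)
Lemma hom_nonsplit A X B (i : rhom A X) (p : rhom X B) : short_exact i p ->
  (forall r : rhom X A, r \c i <> rid A) ->
  (hom X X < hom A A + hom A B + hom B A + hom B B)%N.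
Proof.
move=> ex ns; apply: leq_ltn_trans (hom_exact_le_r X ex) _.
have lt : (hom X A < hom B A + hom A A)%N.
  apply: leq_ltn_trans (hom_exact_l A ex) _; rewrite ltn_add2l.
  rewrite (ltn_leqif (dimv_leqif_eq (subvf _))).
  apply/eqP => e; have : rid A \in limg (linfun (@precomp _ _ _ A X A i)).
    by rewrite e memvf.
  by case/memv_imgP => r _; rewrite lfunE => /esym/ns.
have le := hom_exact_le_l B ex.
apply: leq_trans (_ : (hom B A + hom A A) + (hom A B + hom B B) <= _)%N.
  by rewrite -addSn leq_add.
by rewrite [(hom B A + _)%N]addnC !addnA leq_add2r -!addnA leq_add2l addnC.
Qed.

Lemma hom_iso M M' N N' : riso M M' -> riso N N' -> hom M N = hom M' N'.
Proof.
suff le A A' B B' : riso A A' -> riso B B' -> (hom A B <= hom A' B')%N.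
  by move=> m o; apply/eqP; rewrite eqn_leq !le //; apply: riso_sym.
move=> [a [a' [a1 a2]]] [b [b' [b1 b2]]].
pose L (f : rhom A B) := b \c f \c a'.
have lL : linear L.
  by move=> c f g; rewrite /L rcompDr rcompDl rcompZr rcompZl.
pose LL : {linear rhom A B -> rhom A' B'} :=
  HB.pack L (GRing.isLinear.Build _ _ _ _ L lL).
rewrite /hom -(@limg_dim_eq _ _ _ (linfun LL) fullv).
  by rewrite dimvS ?subvf.
apply/eqP; rewrite capfv; apply/lker0P => f g; rewrite !lfunE /= /L => e.
have := congr1 (fun h => b' \c h \c a) e.
by rewrite !rcompA b1 !rcomp1l !(rcompK _ a1).
Qed.

(** Ext(M, N) = 0 in the form of cocycles modulo coboundaries, where it is a rank
    condition on matrices. *)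
Definition ext0 M N : Prop := forall c : (forall a : arrow Q, 'Hom(M (src a), N (tgt a))),
  exists y : forall v, 'Hom(M v, N v),
  forall a, c a = ((rmap N a \o y (src a)) - (y (tgt a) \o rmap M a))%VF.

Lemma ext0P M N : ext0 M N <-> limg (linfun (@commutator k n Q M N)) = fullv.
Proof.
split=> [H|H c].
  apply/eqP; rewrite eqEsubv subvf /=; apply/subvP => c _.
  have [y Hy] := H (dapp c); apply/memv_imgP; exists (dmk y); rewrite ?memvf //.
  by rewrite lfunE /=; apply/dprodP => a; rewrite commutatorE Hy !dmkE.
have : dmk c \in limg (linfun (@commutator k n Q M N)) by rewrite H memvf.
case/memv_imgP => y _ Hy; exists (dapp y) => a.
by move/dprodP/(_ a): Hy; rewrite dmkE lfunE /= commutatorE.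
Qed.

Lemma ext0_bisum_l M A B N : bisum M A B -> ext0 A N -> ext0 B N -> ext0 M N.
Proof.
move=> [i1 [i2 [p1 [p2 [h1 h2 h]]]]] HA HB c.
have [y Hy] := HA (fun a => c a \o i1.|[src a])%VF.
have [z Hz] := HB (fun a => c a \o i2.|[src a])%VF.
exists (fun v => (y v \o p1.|[v]) + (z v \o p2.|[v]))%VF => a.
have e : (c a = (c a \o i1.|[src a] \o p1.|[src a]) + (c a \o i2.|[src a] \o p2.|[src a]))%VF.
  by rewrite -!comp_lfunA -comp_lfunDr -!rcompE -atD h ridE comp_lfun1r.
rewrite {1}e Hy Hz !comp_lfunDl !comp_lfunDr !comp_lfunNl -!comp_lfunA -!rhomC.
by rewrite !comp_lfunA opprD addrACA.
Qed.

Lemma ext0_bisum_r M N A B : bisum N A B -> ext0 M A -> ext0 M B -> ext0 M N.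
Proof.
move=> [i1 [i2 [p1 [p2 [h1 h2 h]]]]] HA HB c.
have [y Hy] := HA (fun a => p1.|[tgt a] \o c a)%VF.
have [z Hz] := HB (fun a => p2.|[tgt a] \o c a)%VF.
exists (fun v => (i1.|[v] \o y v) + (i2.|[v] \o z v))%VF => a.
have e : (c a = (i1.|[tgt a] \o (p1.|[tgt a] \o c a)) + (i2.|[tgt a] \o (p2.|[tgt a] \o c a)))%VF.
  by rewrite !comp_lfunA -comp_lfunDl -!rcompE -atD h ridE comp_lfun1l.
rewrite {1}e Hy Hz !comp_lfunDr !comp_lfunDl !comp_lfunNr !comp_lfunA -!rhomC.
by rewrite opprD addrACA.
Qed.

Lemma ext0_retract M M' N N' (i : rhom M M') (p : rhom M' M)
    (j : rhom N N') (q : rhom N' N) : p \c i = rid M -> q \c j = rid N ->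
  ext0 M' N' -> ext0 M N.
Proof.
move=> pi qj H c; have [y Hy] := H (fun a => j.|[tgt a] \o c a \o p.|[src a])%VF.
exists (fun v => q.|[v] \o y v \o i.|[v])%VF => a.
have -> : (c a = q.|[tgt a] \o (j.|[tgt a] \o c a \o p.|[src a]) \o i.|[src a])%VF.
  by rewrite !comp_lfunA -rcompE qj ridE comp_lfun1l -comp_lfunA -rcompE pi ridE comp_lfun1r.
rewrite Hy comp_lfunDr comp_lfunDl comp_lfunNr comp_lfunNl !comp_lfunA -rhomC.
by rewrite -(comp_lfunA _ _ (rmap M a)) -rhomC !comp_lfunA.
Qed.

Lemma ext0_iso M M' N N' : riso M M' -> riso N N' -> ext0 M' N' -> ext0 M N.
Proof.
move=> [i [p [pi _]]] [j [q [qj _]]]; exact: ext0_retract pi qj.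
Qed.

(** The cocycle c is an upper triangular entry of an extension of B by A, and a
    splitting of the extension writes c as a coboundary. *)
Lemma cocycle_ext A B (c : forall a : arrow Q, 'Hom(B (src a), A (tgt a))) :
  exists X (i : rhom A X) (p : rhom X B), [/\ short_exact i p,
    forall r : rhom X A, r \c i = rid A ->
      exists y : forall v, 'Hom(B v, A v),
      forall a, c a = ((rmap A a \o y (src a)) - (y (tgt a) \o rmap B a))%VF
  & forall s : rhom B X, p \c s = rid B ->
      exists y : forall v, 'Hom(B v, A v),
      forall a, c a = ((rmap A a \o y (src a)) - (y (tgt a) \o rmap B a))%VF].
Proof.
have [M [i1 [i2 [p1 [p2 H]]]]] : exists M, bisum M A B.
  by exists (bsum A B); apply: bsum_biprod.
have [h1 h2 h] := H; have [h12 h21] := biprod0 H.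
have E1 v : (p1.|[v] \o i1.|[v] = \1)%VF by rewrite -rcompE h1 ridE.
have E2 v : (p2.|[v] \o i2.|[v] = \1)%VF by rewrite -rcompE h2 ridE.
have E12 v : (p1.|[v] \o i2.|[v] = 0)%VF by rewrite -rcompE h12 at0.
have E21 v : (p2.|[v] \o i1.|[v] = 0)%VF by rewrite -rcompE h21 at0.
have z21 v x : p2.|[v] (i1.|[v] x) = 0 by rewrite -comp_lfunE E21 zero_lfunE.
have [_ _ ex] := biprod_exact H.
pose X := @Rep k n Q M (fun a => rmap M a + (i1.|[tgt a] \o c a \o p2.|[src a]))%VF.
have XE a : rmap X a = (rmap M a + (i1.|[tgt a] \o c a \o p2.|[src a]))%VF by [].
have Ci a : (rmap X a \o i1.|[src a] = i1.|[tgt a] \o rmap A a)%VF.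
  apply/lfunP => x; rewrite XE comp_lfunE add_lfunE !comp_lfunE.
  by rewrite (rhom_nat i1) z21 linear0 linear0 addr0.
have Cp a : (rmap B a \o p2.|[src a] = p2.|[tgt a] \o rmap X a)%VF.
  apply/lfunP => x; rewrite XE !comp_lfunE add_lfunE !comp_lfunE linearD /=.
  by rewrite z21 addr0 (rhom_nat p2).
pose i : rhom A X := mk_rhom (N := X) (f := fun v => i1.|[v]) Ci.
pose p : rhom X B := mk_rhom (M := X) (f := fun v => p2.|[v]) Cp.
have iE v : i.|[v] = i1.|[v] := mk_rhomE (N := X) Ci v.
have pE v : p.|[v] = p2.|[v] := mk_rhomE (M := X) Cp v.
exists X, i, p; split.
- split=> v; rewrite ?iE ?pE; last exact: ex.
    by case: (biprod_exact H) => ii _ _; apply: ii.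
  by case: (biprod_exact H) => _ ps _; apply: ps.
- move=> r ri; exists (fun v => r.|[v] \o i2.|[v])%VF => a.
  have ri1 x : r.|[tgt a] (i1.|[tgt a] x) = x.
    by have := congr1 (fun f => f.|[tgt a] x) ri; rewrite /= rcompE comp_lfunE ridE id_lfunE iE.
  apply/lfunP => x; rewrite add_lfunE opp_lfunE !comp_lfunE.
  rewrite (rhom_nat r) XE add_lfunE !comp_lfunE linearD /= (rhom_nat i2).
  by rewrite ri1 -[p2.|[_] _]comp_lfunE E2 id_lfunE addrC addKr.
- move=> s ps; exists (fun v => - (p1.|[v] \o s.|[v]))%VF => a.
  have ps1 x : p2.|[src a] (s.|[src a] x) = x.
    by have := congr1 (fun f => f.|[src a] x) ps; rewrite /= rcompE comp_lfunE ridE id_lfunE pE.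
  apply/lfunP => x.
  have e0 : rmap M a (s.|[src a] x) + i1.|[tgt a] (c a (p2.|[src a] (s.|[src a] x))) =
    s.|[tgt a] (rmap B a x) :> M (tgt a).
    by rewrite -(rhom_nat s) XE add_lfunE !comp_lfunE.
  have := congr1 (fun y : M (tgt a) => p1.|[tgt a] y) e0; rewrite linearD /= -(rhom_nat p1).
  rewrite -[p1.|[_] (i1.|[_] _)]comp_lfunE E1 id_lfunE ps1 => e.
  rewrite add_lfunE opp_lfunE !comp_lfunE !opp_lfunE !comp_lfunE linearN /= opprK.
  by rewrite -e addKr.
Qed.

Lemma nonsplit_exists A B : ~ ext0 B A -> exists X (i : rhom A X) (p : rhom X B),
  short_exact i p /\ forall r : rhom X A, r \c i <> rid A.
Proof.
move=> ne; apply: NNPP => H; apply: ne => c.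
have [X [i [p [ex Hr _]]]] := cocycle_ext c.
apply: NNPP => nc; apply: H; exists X, i, p; split=> // r ri.
exact: nc (Hr r ri).
Qed.

(** An extension X of B by B' splits if the map K -> B' induced by a lift
    P -> X of p extends to P: the lift minus the extension descends to a section. *)
Lemma ext1_dim0_ext0 B B' : ext1_dim B B' 0 -> ext0 B B'.
Proof.
move=> [K [P [i [p [pP ex /esym/eqP]]]]]; rewrite subn_eq0 => le c.
have onto (f : rhom K B') : exists g : rhom P B', g \c i = f.
  have : f \in limg (linfun (@precomp _ _ _ K P B' i)).
    by have -> : limg (linfun (@precomp _ _ _ K P B' i)) = fullv;
      rewrite ?memvf //; apply/eqP; rewrite -(geq_leqif (dimv_leqif_eq (subvf _))).
  by case/memv_imgP => g _ ->; exists g; rewrite lfunE.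
have [X [j [q [ex' _ Hs]]]] := cocycle_ext c.
have [p' qp'] := pP X B q p (let: And3 _ h _ := ex' in h).
have [f jf] : exists f : rhom K B', j \c f = p' \c i.
  by apply: exact_factor_r ex' _; rewrite rcompA qp' (exact_comp0 ex).
have [g gi] := onto f.
have [s sp] : exists s : rhom B X, s \c p = p' - j \c g.
  by apply: exact_factor_l ex _; rewrite rcompBl -rcompA gi jf subrr.
apply: (Hs s); have [_ ps _] := ex; apply: (rsurj_can ps).
by rewrite -rcompA sp rcompBr qp' rcompA (exact_comp0 ex') rcomp0l subr0 rcomp1l.
Qed.

(** Linear sections s of p and retractions t of i turn f : K -> B' into a
    cocycle; if it is the coboundary of h, then f t (1 - s p) + h p is a
    homomorphism which extends f. *)
Lemma ext0_ext1_dim B B' K P (i : rhom K P) (p : rhom P B) :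
  projective P -> short_exact i p -> ext0 B B' -> ext1_dim B B' 0.
Proof.
move=> pP ex e0; exists K, P, i, p; split=> //; apply/esym/eqP.
have [ii ps exk] := ex.
rewrite subn_eq0 dimvS //; apply/subvP => f _.
pose s v := (p.|[v])^-1%VF; pose t v := (i.|[v])^-1%VF.
have sK v y : p.|[v] (s v y) = y by apply: limg_lfunVK; rewrite ps memvf.
have tK v x : t v (i.|[v] x) = x.
  by apply: (rinjP ii); apply: limg_lfunVK; rewrite memv_img ?memvf.
have tV v x : p.|[v] x = 0 -> i.|[v] (t v x) = x.
  by move=> px; apply: limg_lfunVK; rewrite exk memv_ker px.
have pik v x : p.|[v] (i.|[v] x) = 0.
  by rewrite -comp_lfunE -rcompE (exact_comp0 ex) at0 zero_lfunE.
have [h Hh] := e0 (fun a => f.|[tgt a] \o (t (tgt a) \o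
  ((rmap P a \o s (src a)) - (s (tgt a) \o rmap B a))))%VF.
have C a : (rmap B' a \o ((f.|[src a] \o t (src a) \o (\1 - (s (src a) \o p.|[src a])))
               + (h (src a) \o p.|[src a]))
   = ((f.|[tgt a] \o t (tgt a) \o (\1 - (s (tgt a) \o p.|[tgt a])))
               + (h (tgt a) \o p.|[tgt a])) \o rmap P a)%VF.
  apply/lfunP => x; rewrite !comp_lfunE !add_lfunE !comp_lfunE !add_lfunE !opp_lfunE.
  rewrite !comp_lfunE !id_lfunE -(rhom_nat p) linearD /=.
  have := congr1 (fun g : 'Hom(_, _) => g (p.|[src a] x)) (Hh a).
  rewrite /= !comp_lfunE !add_lfunE !opp_lfunE !comp_lfunE => E.
  have {E} -> : rmap B' a (h (src a) (p.|[src a] x)) =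
    f.|[tgt a] (t (tgt a) (rmap P a (s (src a) (p.|[src a] x)) -
      s (tgt a) (rmap B a (p.|[src a] x)))) + h (tgt a) (rmap B a (p.|[src a] x)).
    by rewrite E subrK.
  rewrite addrA (rhom_nat f) -linearD /=; congr (f.|[_] _ + _).
  apply: (rinjP ii); rewrite linearD /= -(rhom_nat i) !tV; first 1 last.
  - by rewrite linearB /= ?sK -?(rhom_nat p) ?sK subrr.
  - by rewrite linearB /= ?sK -?(rhom_nat p) ?sK subrr.
  - by rewrite linearB /= ?sK -?(rhom_nat p) ?sK subrr.
  by rewrite linearB /= addrA subrK.
apply/memv_imgP; exists (mk_rhom (f := fun v => ((f.|[v] \o t v \o
   (\1 - (s v \o p.|[v]))) + (h v \o p.|[v]))%VF) C); rewrite ?memvf // lfunE /= /precomp.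
apply: rhom_ext => v x; rewrite rcompE comp_lfunE mk_rhomE add_lfunE !comp_lfunE.
by rewrite add_lfunE opp_lfunE comp_lfunE id_lfunE pik !linear0 ?subr0 !addr0 tK.
Qed.

Lemma vect_iso (U V : vectType k) : \dim {:U} = \dim {:V} ->
  exists (f : 'Hom(U, V)) (g : 'Hom(V, U)), (g \o f = \1)%VF /\ (f \o g = \1)%VF.
Proof.
rewrite !dimvf => e.
exists (Hom (pid_mx (dim U))), (Hom (pid_mx (dim U))); split; apply: f2mx_inj;
  by rewrite f2mx_comp /= f2mx1 mul_pid_mx ?e !minnn pid_mx_1.
Qed.

Lemma rep_of_exists M : exists x : rep_space k Q (dim_vec M), riso M (rep_of x).
Proof.
have H v : exists fg : 'Hom(M v, 'rV[k]_(dim_vec M v 0)) * 'Hom('rV[k]_(dim_vec M v 0), M v),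
    ((fg.2 \o fg.1 == \1) && (fg.1 \o fg.2 == \1))%VF.
  have [|f [g [fg gf]]] := @vect_iso (M v) 'rV[k]_(dim_vec M v 0).
    by rewrite (dimvf 'rV[k]__) /dim /= mul1n dim_vecE.
  by exists (f, g); rewrite fg gf !eqxx.
pose f v := (xchoose (H v)).1; pose g v := (xchoose (H v)).2.
have gf v : (g v \o f v = \1)%VF by have /andP[/eqP] := xchooseP (H v).
have fg v : (f v \o g v = \1)%VF by have /andP[_ /eqP] := xchooseP (H v).
exists (dmk (fun a => (f (tgt a) \o rmap M a \o g (src a))%VF)).
set N := rep_of _.
have Nf a : rmap N a = (f (tgt a) \o rmap M a \o g (src a))%VF by apply: dmkE.
have C a : (rmap N a \o f (src a) = f (tgt a) \o rmap M a)%VF.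
  apply/lfunP => x; rewrite Nf !comp_lfunE; congr (f _ (rmap M a _)).
  by rewrite -[LHS]comp_lfunE gf id_lfunE.
have C' a : (rmap M a \o g (src a) = g (tgt a) \o rmap N a)%VF.
  apply/lfunP => x; rewrite Nf !comp_lfunE.
  by rewrite -[RHS]comp_lfunE gf id_lfunE.
exists (mk_rhom (M := M) (N := N) (f := f) C), (mk_rhom (M := N) (N := M) (f := g) C').
by split; apply/rhomP => v; rewrite rcompE !mk_rhomE ?gf ?fg.
Qed.

Lemma dim_rep_of b (x : rep_space k Q b) : dim_vec (rep_of x) = b.
Proof.
by apply/matrixP => v j; rewrite mxE (ord1 j) /= dimvf /dim /= mul1n.
Qed.

Lemma rep_of_exists_dim M b : dim_vec M = b ->
  exists x : rep_space k Q b, riso M (rep_of x).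
Proof. by move=> <-; apply: rep_of_exists. Qed.

(** * Semicontinuity of Hom and Ext *)

(** The commutator at points of representation spaces: its source and target do
    not vary with the points, so it is a polynomial family. *)
Definition comm_op (b c : 'cV[nat]_n) (x : rep_space k Q b) (y : rep_space k Q c) :
  'Hom(dprod (fun v => 'Hom('rV[k]_(b v 0), 'rV[k]_(c v 0)) : vectType k),
       dprod (fun a : arrow Q =>
                'Hom('rV[k]_(b (src a) 0), 'rV[k]_(c (tgt a) 0)) : vectType k)) :=
  linfun (@commutator k n Q (rep_of x) (rep_of y)).

Lemma comm_opE b c (x : rep_space k Q b) (y : rep_space k Q c) f a :
  dapp (comm_op x y f) a = ((y a \o f (src a)) - (f (tgt a) \o x a))%VF.
Proof.
have E := lfunE (@commutator k n Q (rep_of x) (rep_of y)) f.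
exact: etrans (congr1 (fun g => dapp g a) E) (commutatorE _ a).
Qed.

Section Semicont.
Variables (W : vectType k) (b c : 'cV[nat]_n).
Variables (F : W -> rep_space k Q b) (G : W -> rep_space k Q c).
Hypotheses (HF : polymap F) (HG : polymap G).

Lemma comm_fam_pmap : polymap (fun w => comm_op (F w) (G w)).
Proof.
have z d a : (0 : rep_space k Q d) a = 0 by apply: dmkE.
have l1 : linear (fun x : rep_space k Q b => comm_op x (0 : rep_space k Q c)).
  move=> s x y; apply/lfunP => f; rewrite add_lfunE scale_lfunE.
  apply/dprodP => a; rewrite dprodD dprodZ !comm_opE z !comp_lfun0l !sub0r.
  by rewrite dprodD dprodZ comp_lfunDr -comp_lfunZr opprD scalerN.
have l2 : linear (fun y : rep_space k Q c => comm_op (0 : rep_space k Q b) y).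
  move=> s x y; apply/lfunP => f; rewrite add_lfunE scale_lfunE.
  apply/dprodP => a; rewrite dprodD dprodZ !comm_opE z !comp_lfun0r !subr0.
  by rewrite dprodD dprodZ comp_lfunDl -comp_lfunZl.
apply: (@polymap_ext _ _ _ (fun w => comm_op (F w) (0 : rep_space k Q c) +
                                  comm_op (0 : rep_space k Q b) (G w))) => [w|].
  apply/lfunP => f; rewrite add_lfunE.
  apply/dprodP => a; rewrite dprodD !comm_opE !z comp_lfun0l comp_lfun0r.
  by rewrite sub0r subr0 addrC.
apply: polymapD; first exact: (polymapL l1).
exact: (polymapL l2).
Qed.

Lemma hom_rank w : (hom (rep_of (F w)) (rep_of (G w)) + \dim (limg (comm_op (F w) (G w))))%N =
  \dim {: dprod (fun v => 'Hom('rV[k]_(b v 0), 'rV[k]_(c v 0)) : vectType k)}.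
Proof.
rewrite -(limg_ker_dim (comm_op (F w) (G w)) fullv) capfv; congr (_ + _)%N.
by rewrite /hom dimvf.
Qed.

Lemma hom_semicont w0 : exists d : W -> k, [/\ polyfun d, d w0 != 0 & forall w, d w != 0 ->
  (hom (rep_of (F w)) (rep_of (G w)) <= hom (rep_of (F w0)) (rep_of (G w0)))%N].
Proof.
have [d [pd dw0 Hd]] := rank_semicont w0 comm_fam_pmap.
exists d; split=> // w /Hd le.
by rewrite -(leq_add2r (\dim (limg (comm_op (F w0) (G w0))))) hom_rank -(hom_rank w) leq_add2l.
Qed.

Lemma ext0_semicont w0 : ext0 (rep_of (F w0)) (rep_of (G w0)) ->
  exists d : W -> k, [/\ polyfun d, d w0 != 0 & forall w, d w != 0 ->
    ext0 (rep_of (F w)) (rep_of (G w))].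
Proof.
move=> /ext0P e0; have [d [pd dw0 Hd]] := rank_semicont w0 comm_fam_pmap.
exists d; split=> // w /Hd; rewrite {1}/comm_op e0 => le; apply/ext0P/eqP.
by rewrite -(geq_leqif (dimv_leqif_eq (subvf _))).
Qed.

End Semicont.
End HomExt.

(** * Existence of decompositions into Schur roots with vanishing Ext *)

Section HomAdd.
Variables (k : fieldType) (n : nat) (Q : quiver n).
Notation rep := (rep k Q).
Implicit Types (M N A B X : rep).

Lemma dim_mid_eq (U V W : vectType k) (a : {linear U -> V}) (b : {linear V -> W}) :
  (forall x, b (a x) = 0) -> injective a -> (forall y, exists x, y = b x) ->
  (\dim {:U} + \dim {:W} <= \dim {:V})%N.
Proof.
move=> ba ia sb; rewrite -(limg_ker_dim (linfun b) fullv) capfv leq_add //; last first.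
  apply: dimvS; apply/subvP => y _; have [x ->] := sb y.
  by rewrite -(lfunE b) memv_img ?memvf.
rewrite -(@limg_dim_eq _ _ _ (linfun a) fullv); last first.
  by apply/eqP; rewrite capfv; apply/lker0P => x y; rewrite !lfunE; apply: ia.
apply: dimvS; apply/subvP => x /memv_imgP[y _ ->].
by rewrite memv_ker !lfunE ba.
Qed.

Lemma hom_bisum_l M A B N : bisum M A B -> hom M N = (hom A N + hom B N)%N.
Proof.
move=> [i1 [i2 [p1 [p2 H]]]]; have [h1 h2 h] := H; have [h12 h21] := biprod0 H.
apply/eqP; rewrite eqn_leq (hom_exact_le_l N (biprod_exact H)).
apply: (@dim_mid_eq _ _ _ (@precomp _ _ _ M A N p1) (@precomp _ _ _ B M N i2)).
- by move=> f; rewrite /= /precomp rcompK0.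
- move=> f g /= e; have := congr1 (fun h => h \c i1) e.
  by rewrite /precomp !(rcompK _ h1).
- by move=> g; exists (g \c p2); rewrite /= /precomp rcompK.
Qed.

Lemma hom_bisum_r M A B N : bisum M A B -> hom N M = (hom N A + hom N B)%N.
Proof.
move=> [i1 [i2 [p1 [p2 H]]]]; have [h1 h2 h] := H; have [h12 h21] := biprod0 H.
apply/eqP; rewrite eqn_leq (hom_exact_le_r N (biprod_exact H)).
apply: (@dim_mid_eq _ _ _ (@postcomp _ _ _ A M N i1) (@postcomp _ _ _ M B N p2)).
- by move=> f; rewrite /= /postcomp rcompA h21 rcomp0l.
- move=> f g /= e; have := congr1 (fun h => p1 \c h) e.
  by rewrite /postcomp !rcompA h1 !rcomp1l.
- by move=> g; exists (i2 \c g); rewrite /= /postcomp rcompA h2 rcomp1l.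
Qed.

Definition homs (s t : seq rep) : nat := \sum_(A <- s) \sum_(B <- t) hom A B.

Lemma homs_cons_l A s t : homs (A :: s) t = (homs [:: A] t + homs s t)%N.
Proof. by rewrite /homs !big_cons big_nil addn0. Qed.

Lemma homs_cons_r A s t : homs s (A :: t) = (homs s [:: A] + homs s t)%N.
Proof. by rewrite /homs -big_split; apply: eq_bigr => B _; rewrite !big_cons big_nil addn0. Qed.

Lemma homs_cat_l s1 s2 t : homs (s1 ++ s2) t = (homs s1 t + homs s2 t)%N.
Proof. by rewrite /homs big_cat. Qed.

Lemma homs_cat_r s t1 t2 : homs s (t1 ++ t2) = (homs s t1 + homs s t2)%N.
Proof. by rewrite /homs -big_split; apply: eq_bigr => B _; rewrite big_cat. Qed.

Lemma homs11 A B : homs [:: A] [:: B] = hom A B.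
Proof. by rewrite /homs !big_seq1. Qed.

Definition hE := (homs_cat_l, homs_cat_r, homs11).

Lemma homs_nil_l t : homs [::] t = 0%N.
Proof. by rewrite /homs big_nil. Qed.

Lemma homs_nil_r s : homs s [::] = 0%N.
Proof. by rewrite /homs big1 // => A _; rewrite big_nil. Qed.

Lemma zero_repP : is_zero (zero_rep k Q).
Proof. by move=> v; rewrite dimvf /dim /= muln0. Qed.

End HomAdd.

Lemma min_exists (P : nat -> Prop) : (exists m, P m) ->
  exists m, P m /\ forall j, P j -> (m <= j)%N.
Proof.
move=> [m Pm]; have [N] := ubnP m; elim: N m Pm => // N IH m Pm mN.
have [[j [Pj jm]]|H] := classic (exists j, P j /\ (j < m)%N).
  by apply: (IH j) => //; apply: leq_trans jm mN.
exists m; split=> // j Pj; rewrite leqNgt; apply/negP => jm.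
by apply: H; exists j.
Qed.

Section KacExistence.
Variables (k : closedFieldType) (n : nat) (Q : quiver n).
Notation rep := (rep k Q).
Notation zr := (zero_rep k Q).
Implicit Types (M N A B X : rep) (s t : seq rep).

Definition dims s : 'cV[nat]_n := \sum_(N <- s) dim_vec N.

Definition all_nonzero s := forall i, (i < size s)%N -> ~ is_zero (nth zr s i).

Lemma all_nonzero_cat s t : all_nonzero (s ++ t) <-> all_nonzero s /\ all_nonzero t.
Proof.
split=> [H|[Hs Ht] i].
  split=> i si.
    by have := H i; rewrite nth_cat si; apply; rewrite size_cat ltn_addr.
  have := H (size s + i)%N; rewrite nth_cat [(_ + _ < size s)%N]ltnNge leq_addr /= addKn; apply.
  by rewrite size_cat ltn_add2l.
rewrite size_cat nth_cat; case: (ltnP i (size s)) => [si _|si it]; first exact: Hs.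
by apply: Ht; rewrite ltn_subLR.
Qed.

Lemma all_nonzero_cons A s : all_nonzero (A :: s) <-> ~ is_zero A /\ all_nonzero s.
Proof.
split=> [H|[HA Hs] [|i] //]; last exact: Hs.
by split=> [|i si]; [apply: (H 0%N) | apply: (H i.+1)].
Qed.

Lemma dims_cons A s : dims (A :: s) = dim_vec A + dims s.
Proof. by rewrite /dims big_cons. Qed.
Lemma dims_cat s t : dims (s ++ t) = dims s + dims t.
Proof. by rewrite /dims big_cat. Qed.

Lemma all_nonzero_size s : all_nonzero s -> (size s <= \sum_v dims s v 0%R)%N.
Proof.
elim: s => [|A s IH]; first by [].
rewrite all_nonzero_cons => -[nA /IH le]; rewrite dims_cons /=.
rewrite (eq_bigr (fun v => (\dim {:A v} + dims s v 0%R)%N)); last first.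
  by move=> v _; rewrite mxE dim_vecE.
by rewrite big_split -add1n leq_add // (tdim_gt0 nA).
Qed.

Lemma homs_semicont b (x0 : rep_space k Q b) t : exists d : rep_space k Q b -> k,
  [/\ polyfun d, d x0 != 0 & forall x, d x != 0 ->
    (homs [:: rep_of x] t <= homs [:: rep_of x0] t)%N /\
    (homs t [:: rep_of x] <= homs t [:: rep_of x0])%N].
Proof.
elim: t => [|N t [d [pd d0 Hd]]].
  exists (fun=> 1); split=> [||x _]; [exact: polyfunC | exact: oner_neq0 |].
  by rewrite !homs_nil_l !homs_nil_r.
have [y Ny] := rep_of_exists N.
have pid := @polymap_id _ (rep_space k Q b).
have [d1 [pd1 d10 H1]] := hom_semicont pid (polymapC (rep_space k Q b) y) x0.
have [d2 [pd2 d20 H2]] := hom_semicont (polymapC (rep_space k Q b) y) pid x0.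
exists (fun x => d x * (d1 x * d2 x)); split.
- by do 2!apply: polyfunM => //.
- by rewrite !mulf_neq0.
move=> x; rewrite !mulf_eq0 !negb_or => /and3P[/Hd[l r] /H1 l1 /H2 r1].
rewrite !(homs_cons_r N _ t) !(homs_cons_l N t).
have e1 y0 : hom (rep_of y0) N = hom (rep_of y0) (rep_of y).
  exact: hom_iso (riso_refl _) Ny.
have e2 y0 : hom N (rep_of y0) = hom (rep_of y) (rep_of y0).
  exact: hom_iso Ny (riso_refl _).
by rewrite !homs11 !e1 !e2; split; apply: leq_add.
Qed.

(** Among all lists of nonzero representations with total dimension vector b
    take one whose direct sum has the fewest endomorphisms and, among those,
    one with the most terms.  A nonsplit extension of two terms would lower the
    number of endomorphisms; if decomposable representations were dense in the
    dimension of a term, that term could be split further. *)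
Theorem kac_exists (b : 'cV[nat]_n) : exists s : seq rep, [/\ dims s = b,
  forall i j, (i < size s)%N -> (j < size s)%N -> i != j -> ext0 (nth zr s i) (nth zr s j)
  & forall i, (i < size s)%N -> schur_root k Q (dim_vec (nth zr s i))].
Proof.
pose cfg s := dims s = b /\ all_nonzero s.
have [s0 cs0] : exists s, cfg s.
  have [b0|nb] := eqVneq b 0.
    by exists [::]; split; [rewrite /dims big_nil b0 | case].
  exists [:: rep_of (0 : rep_space k Q b)]; split.
    by rewrite dims_cons dim_rep_of /dims big_nil addr0.
  rewrite all_nonzero_cons; split=> [z|[]//]; case/eqP: nb.
  by rewrite -(dim_rep_of (0 : rep_space k Q b)); apply/matrixP => v j; rewrite !mxE z.
(* e is the least number of endomorphisms, and s has the most terms for this e: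
   B bounds the number of terms, and B - size s is minimal. *)
have [e [[s1 [cs1 es1]] emin]] : exists e, (exists s, cfg s /\ homs s s = e) /\
    forall j, (exists s, cfg s /\ homs s s = j) -> (e <= j)%N.
  by apply: min_exists; exists (homs s0 s0), s0.
pose B := (\sum_v b v 0%R)%N.
have [d [[s [cs es ds]] dmin]] : exists d,
    (exists s, [/\ cfg s, homs s s = e & d = (B - size s)%N]) /\
    forall j, (exists s, [/\ cfg s, homs s s = e & j = (B - size s)%N]) -> (d <= j)%N.
  by apply: min_exists; exists (B - size s1)%N, s1.
have szB t : cfg t -> (size t <= B)%N.
  by move=> [dt nt]; rewrite /B -dt; apply: all_nonzero_size.
have smax t : cfg t -> (homs t t <= e)%N -> (size t <= size s)%N.
  move=> ct et; have ete : homs t t = e.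
    by apply/eqP; rewrite eqn_leq et; apply: emin; exists t.
  have := dmin (B - size t)%N; rewrite ds => /(_ _)H.
  have {H} : (B - size s <= B - size t)%N by apply: H; exists t.
  by rewrite leq_sub2lE // szB.
have [dimS nzS] := cs.
have pairs i j : (i < j)%N -> (j < size s)%N ->
    ext0 (nth zr s i) (nth zr s j) /\ ext0 (nth zr s j) (nth zr s i).
  move=> ij js; pose A := nth zr s i; pose C := nth zr s j.
  pose u1 := take i s; pose u2 := take (j - i.+1) (drop i.+1 s); pose u3 := drop j.+1 s.
  have sE : s = u1 ++ A :: u2 ++ C :: u3.
    rewrite -[LHS](cat_take_drop i) (drop_nth zr) ?(ltn_trans ij) //.
    congr (_ ++ _ :: _); rewrite -[LHS](cat_take_drop (j - i.+1)) drop_drop.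
    by rewrite subnK // (drop_nth zr js).
  pose t := u1 ++ u2 ++ u3.
  have [nzA [nzC nzt]] : ~ is_zero A /\ ~ is_zero C /\ all_nonzero t.
    move: nzS; rewrite sE !(all_nonzero_cat, all_nonzero_cons).
    by move=> [h1 [h2 [h3 [h4 h5]]]]; rewrite /t ?all_nonzero_cat.
  have dt : dim_vec A + dim_vec C + dims t = b.
    rewrite -dimS sE /t !(dims_cat, dims_cons) -addrA [RHS]addrCA.
    by rewrite [dims u2 + (_ + _)]addrCA [dims u1 + (dim_vec C + _)]addrCA.
  have Qs : homs s s = (hom A A + hom A C + hom C A + hom C C +
     (homs [:: A] t + homs t [:: A]) + (homs [:: C] t + homs t [:: C]) + homs t t)%N.
    rewrite {1 2}sE /t -[A :: _]cat1s -[C :: _]cat1s !hE; ring.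
  suff H : forall A C, ~ is_zero A -> ~ is_zero C -> dim_vec A + dim_vec C + dims t = b ->
     homs s s = (hom A A + hom A C + hom C A + hom C C +
     (homs [:: A] t + homs t [:: A]) + (homs [:: C] t + homs t [:: C]) + homs t t)%N ->
     ext0 C A.
    split; last exact: H Qs.
    by apply: H => //; [rewrite (addrC (dim_vec C)) | rewrite Qs; ring].
  move=> {A C sE nzA nzC dt Qs} A C nzA nzC dt Qs; apply: NNPP => /nonsplit_exists[X [x [p [ex ns]]]].
  have lt := hom_nonsplit ex ns.
  have cX : cfg (X :: t).
    split.
      rewrite dims_cons -dt; congr (_ + _); apply/matrixP => v l.
      by rewrite !mxE (exact_dim ex).
    rewrite all_nonzero_cons; split=> // zX; apply: nzA => v; apply/eqP.
    by have := zX v; rewrite (exact_dim ex) => /eqP; rewrite addn_eq0 => /andP[].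
  have : (e <= homs (X :: t) (X :: t))%N by apply: emin; exists (X :: t).
  rewrite -es Qs -[X :: _]cat1s (homs_cat_l [:: X] t) !(homs_cat_r _ [:: X] t) homs11.
  rewrite leqNgt => /negP; apply.
  have l1 : (homs [:: X] t <= homs [:: A] t + homs [:: C] t)%N.
    rewrite /homs !big_seq1 -big_split; apply: leq_sum => N _; exact: hom_exact_le_l ex.
  have l2 : (homs t [:: X] <= homs t [:: A] + homs t [:: C])%N.
    rewrite /homs -big_split; apply: leq_sum => N _; rewrite !big_seq1.
    exact: hom_exact_le_r ex.
  move: lt l1 l2; move: (hom X X) (homs [:: X] t) (homs t [:: X]) => h1 h2 h3.
  move: (hom A A) (hom A C) (hom C A) (hom C C) (homs t t) => ? ? ? ? ?.
  move: (homs [:: A] t) (homs t [:: A]) (homs [:: C] t) (homs t [:: C]) => ? ? ? ?.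
  clear; lia.
exists s; split=> //.
  move=> i j si sj; rewrite neq_ltn => /orP[ij|ji].
    by have [] := pairs i j ij sj.
  by have [] := pairs j i ji si.
move=> i si; apply: NNPP => /not_general_dense D.
pose A := nth zr s i; pose u1 := take i s; pose u2 := drop i.+1 s; pose t := u1 ++ u2.
have sE : s = u1 ++ A :: u2 by rewrite -[LHS](cat_take_drop i) (drop_nth zr).
have [nzA nzt] : ~ is_zero A /\ all_nonzero t.
  move: nzS; rewrite sE !(all_nonzero_cat, all_nonzero_cons).
  by move=> [h1 [h2 h3]]; rewrite /t ?all_nonzero_cat.
have dt : dim_vec A + dims t = b.
  by rewrite -dimS sE /t !(dims_cat, dims_cons) addrCA.
have Qs : homs s s = (hom A A + (homs [:: A] t + homs t [:: A]) + homs t t)%N.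
  by rewrite {1 2}sE /t -[A :: _]cat1s !hE; ring.
have [x0 Ax0] := rep_of_exists A.
have pid := @polymap_id _ (rep_space k Q (dim_vec A)).
have [d1 [pd1 d10 H1]] := hom_semicont pid pid x0.
have [d2 [pd2 d20 H2]] := homs_semicont x0 t.
have [x ndx] := dense_meet (g := fun x => d1 x * d2 x) D (polyfunM pd1 pd2) (mulf_neq0 d10 d20).
rewrite mulf_eq0 negb_or => /andP[/H1 le1 /H2[le2 le3]].
have nzx : ~ is_zero (rep_of x).
  move=> z; apply: nzA => v; rewrite -dim_vecE -(dim_rep_of x) dim_vecE; exact: z.
have [//|[//|[A1 [A2 [S nz1 nz2]]]]] := indec_cases (rep_of x).
have c' : cfg (A1 :: A2 :: t).
  split; last by rewrite !all_nonzero_cons.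
  by rewrite !dims_cons addrA -(bisum_dim_vec S) dim_rep_of.
have sz : size s = (size t).+1 by rewrite sE /t !size_cat addnS.
have := smax _ c'; rewrite sz /= ltnn => H; suff : false by [].
apply: H; rewrite -es Qs.
have e1 : homs (A1 :: A2 :: t) (A1 :: A2 :: t) =
   (hom (rep_of x) (rep_of x) + (homs [:: rep_of x] t + homs t [:: rep_of x]) + homs t t)%N.
  have el : homs [:: rep_of x] t = (homs [:: A1] t + homs [:: A2] t)%N.
    by rewrite /homs !big_seq1 -big_split; apply: eq_bigr => N _; apply: hom_bisum_l.
  have er : homs t [:: rep_of x] = (homs t [:: A1] + homs t [:: A2])%N.
    by rewrite /homs -big_split; apply: eq_bigr => N _; rewrite !big_seq1; apply: hom_bisum_r.
  rewrite el er (hom_bisum_l _ S) !(hom_bisum_r _ S).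
  by rewrite -[A1 :: _]cat1s -[A2 :: _]cat1s; move: (t) => r; rewrite !hE; ring.
have eA : hom A A = hom (rep_of x0) (rep_of x0) by apply: hom_iso.
have eAl : homs [:: A] t = homs [:: rep_of x0] t.
  by rewrite /homs !big_seq1; apply: eq_bigr => N _; apply: hom_iso (riso_refl N).
have eAr : homs t [:: A] = homs t [:: rep_of x0].
  by apply: eq_bigr => N _; rewrite !big_seq1; apply: hom_iso (riso_refl N) _.
by rewrite e1 eA eAl eAr !leq_add.
Qed.

End KacExistence.

(** * Density of direct sums with vanishing Ext *)

Section Jets.
Variable k : fieldType.
Implicit Types U V W : vectType k.

(** A polynomial curve through w with tangent vector T. *)
Definition jet V (c : k -> V) (w T : V) := exists e : k^o -> V,
  polymap e /\ forall t : k, c t = w + t *: (T + t *: e t).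

Lemma jet_line V (w T : V) : jet (fun t => w + t *: T) w T.
Proof.
by exists (fun=> 0); split=> [|t]; [exact: polymapC | rewrite scaler0 addr0].
Qed.

Lemma jetB U V W (B : U -> V -> W) c1 w1 T1 c2 w2 T2 :
  (forall v, linear (B v)) -> (forall v, linear (B^~ v)) ->
  jet c1 w1 T1 -> jet c2 w2 T2 ->
  jet (fun t => B (c1 t) (c2 t)) (B w1 w2) (B w1 T2 + B T1 w2).
Proof.
move=> l1 l2 [e1 [pe1 E1]] [e2 [pe2 E2]].
have Dr u x y : B u (x + y) = B u x + B u y by rewrite -[x]scale1r l1 !scale1r.
have Dl x y u : B (x + y) u = B x u + B y u by rewrite -[x]scale1r l2 !scale1r.
have Br0 u : B u 0 = 0 by apply: (addrI (B u 0)); rewrite -Dr !addr0.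
have Bl0 u : B 0 u = 0 by apply: (addrI (B 0 u)); rewrite -Dl !addr0.
have Zr u c x : B u (c *: x) = c *: B u x by rewrite -[c *: x]addr0 l1 Br0 addr0.
have Zl u c x : B (c *: x) u = c *: B x u by rewrite -[c *: x]addr0 l2 Bl0 addr0.
exists (fun t => B w1 (e2 t) + B (e1 t) w2 + B (T1 + t *: e1 t) (T2 + t *: e2 t)).
split=> [|t].
  have pm V' (T : V') e : polymap e -> polymap (fun t : k^o => T + t *: e t).
    by move=> pe; apply: polymapD (polymapC _ _) _; apply: polymapZ pe; apply: polyfun_self.
  apply: polymapD; last by apply: polymapB => //; apply: pm.
  by apply: polymapD; [apply: (polymapL (l1 w1)) | apply: (polymapL (l2 w2))].
set a1 := T1 + t *: e1 t; set a2 := T2 + t *: e2 t.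
have h1 : B w1 a2 = B w1 T2 + t *: B w1 (e2 t) by rewrite Dr Zr.
have h2 : B a1 w2 = B T1 w2 + t *: B (e1 t) w2 by rewrite Dl Zl.
rewrite E1 E2 -/a1 -/a2 Dl (Dr w1) (Zr w1) -addrA; congr (_ + _).
rewrite Zl (Dr _ w2) Zr -scalerDr; congr (_ *: _).
by rewrite h1 h2 !scalerDr -[X in _ + X]addrA addrACA !addrA.
Qed.
End Jets.

Section TwoBlocks.
Variables (k : closedFieldType) (n : nat) (Q : quiver n).
Notation rep := (rep k Q).
Variables b1 b2 b : 'cV[nat]_n.
Notation R := (rep_space k Q).
Notation V d v := ('rV[k]_(d v 0)).
Variables (I1 : forall v, 'Hom(V b1 v, V b v)) (I2 : forall v, 'Hom(V b2 v, V b v)).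
Variables (P1 : forall v, 'Hom(V b v, V b1 v)) (P2 : forall v, 'Hom(V b v, V b2 v)).
Hypothesis PI1 : forall v x, P1 v (I1 v x) = x.
Hypothesis PI2 : forall v x, P2 v (I2 v x) = x.
Hypothesis PI12 : forall v x, P1 v (I2 v x) = 0.
Hypothesis PI21 : forall v x, P2 v (I1 v x) = 0.
Hypothesis IP : forall v x, I1 v (P1 v x) + I2 v (P2 v x) = x.

Definition gl : vectType k := dprod (fun v => 'Hom(V b v, V b v) : vectType k).

Definition gmul (u w : gl) : gl := dmk (fun v => (u v \o w v)%VF).
Definition lact (u : gl) (x : R b) : R b := dmk (fun a => (u (tgt a) \o x a)%VF).
Definition ract (u : gl) (x : R b) : R b := dmk (fun a => (x a \o u (src a))%VF).
Definition gone : gl := dmk (fun v => \1%VF).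

Lemma gmulE u w v x : gmul u w v x = u v (w v x).
Proof. by rewrite dmkE comp_lfunE. Qed.
Lemma lactE u x a y : lact u x a y = u (tgt a) (x a y).
Proof. by rewrite dmkE comp_lfunE. Qed.
Lemma ractE u x a y : ract u x a y = x a (u (src a) y).
Proof. by rewrite dmkE comp_lfunE. Qed.
Lemma goneE v x : gone v x = x.
Proof. by rewrite dmkE id_lfunE. Qed.

Lemma dD (I : finType) (F G : I -> vectType k)
    (u w : dprod (fun i => 'Hom(F i, G i) : vectType k)) i x : (u + w) i x = u i x + w i x.
Proof. by rewrite dprodD add_lfunE. Qed.
Lemma dZ (I : finType) (F G : I -> vectType k) c
    (u : dprod (fun i => 'Hom(F i, G i) : vectType k)) i x : (c *: u) i x = c *: u i x.
Proof. by rewrite dprodZ scale_lfunE. Qed.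

Lemma dext (I : finType) (F G : I -> vectType k)
    (u w : dprod (fun i => 'Hom(F i, G i) : vectType k)) :
  (forall i x, u i x = w i x) -> u = w.
Proof. by move=> H; apply/dprodP => i; apply/lfunP => x. Qed.

Lemma gmul_linl u : linear (gmul u).
Proof. by move=> c x y; apply: dext => v z; rewrite gmulE !(dD, dZ) !gmulE linearP. Qed.
Lemma gmul_linr u : linear (gmul^~ u).
Proof. by move=> c x y; apply: dext => v z; rewrite gmulE !(dD, dZ) !gmulE. Qed.
Lemma lact_linl u : linear (lact u).
Proof. by move=> c x y; apply: dext => v z; rewrite lactE !(dD, dZ) !lactE linearP. Qed.
Lemma lact_linr u : linear (lact^~ u).
Proof. by move=> c x y; apply: dext => v z; rewrite lactE !(dD, dZ) !lactE. Qed.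
Lemma ract_linl u : linear (ract u).
Proof. by move=> c x y; apply: dext => v z; rewrite ractE !(dD, dZ) !ractE. Qed.
Lemma ract_linr u : linear (ract^~ u).
Proof. by move=> c x y; apply: dext => v z; rewrite ractE !(dD, dZ) !ractE linearP. Qed.

Lemma dN (I : finType) (F G : I -> vectType k)
    (u : dprod (fun i => 'Hom(F i, G i) : vectType k)) i x : (- u) i x = - u i x.
Proof. by rewrite -scaleN1r dZ scaleN1r. Qed.

Lemma unip_cancel (E : gl) : (forall v z, E v (E v z) = 0) ->
  forall t v z, (gone + t *: E) v ((gone + t *: - E) v z) = z.
Proof.
move=> E2 t v z; rewrite !(dD, dZ, dN) !goneE scalerN.
have -> : E v (z - t *: E v z) = E v z by rewrite linearB linearZ /= E2 scaler0 subr0.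
by rewrite subrK.
Qed.

Definition block1 (x : R b1) : R b := dmk (fun a => (I1 (tgt a) \o x a \o P1 (src a))%VF).
Definition block2 (y : R b2) : R b := dmk (fun a => (I2 (tgt a) \o y a \o P2 (src a))%VF).

Lemma block1E x a z : block1 x a z = I1 _ (x a (P1 _ z)).
Proof. by rewrite dmkE !comp_lfunE. Qed.
Lemma block2E x a z : block2 x a z = I2 _ (x a (P2 _ z)).
Proof. by rewrite dmkE !comp_lfunE. Qed.
Lemma block1_lin : linear block1.
Proof. by move=> c x y; apply: dext => v z; rewrite block1E !(dD, dZ) !block1E linearP. Qed.
Lemma block2_lin : linear block2.
Proof. by move=> c x y; apply: dext => v z; rewrite block2E !(dD, dZ) !block2E linearP. Qed.

Lemma block_bisum x y : bisum (rep_of (block1 x + block2 y)) (rep_of x) (rep_of y).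
Proof.
pose M := rep_of (block1 x + block2 y).
have ME a z : rmap M a z = I1 _ (x a (P1 _ z)) + I2 _ (y a (P2 _ z)).
  by rewrite -[LHS]/((block1 x + block2 y) a z) dD block1E block2E.
have c1 a : (rmap M a \o I1 (src a) = I1 (tgt a) \o rmap (rep_of x) a)%VF.
  by apply/lfunP => z; rewrite !comp_lfunE ME PI1 PI21 !linear0 addr0.
have c2 a : (rmap M a \o I2 (src a) = I2 (tgt a) \o rmap (rep_of y) a)%VF.
  by apply/lfunP => z; rewrite !comp_lfunE ME PI2 PI12 !linear0 add0r.
have d1 a : (rmap (rep_of x) a \o P1 (src a) = P1 (tgt a) \o rmap M a)%VF.
  by apply/lfunP => z; rewrite !comp_lfunE ME linearD /= PI1 PI12 addr0.
have d2 a : (rmap (rep_of y) a \o P2 (src a) = P2 (tgt a) \o rmap M a)%VF.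
  by apply/lfunP => z; rewrite !comp_lfunE ME linearD /= PI2 PI21 add0r.
exists (mk_rhom (M := rep_of x) (N := M) (f := I1) c1).
exists (mk_rhom (M := rep_of y) (N := M) (f := I2) c2).
exists (mk_rhom (M := M) (N := rep_of x) (f := P1) d1).
exists (mk_rhom (M := M) (N := rep_of y) (f := P2) d2).
split; apply: rhom_ext => v z.
- by rewrite rcompE comp_lfunE !mk_rhomE ?ridE id_lfunE PI1.
- by rewrite rcompE comp_lfunE !mk_rhomE ?ridE id_lfunE PI2.
- by rewrite atD !rcompE add_lfunE !comp_lfunE !mk_rhomE ?ridE id_lfunE IP.
Qed.

Lemma conj_iso (u u' : gl) (x : R b) : gmul u u' = gone -> gmul u' u = gone ->
  riso (rep_of x) (rep_of (ract u' (lact u x))).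
Proof.
move=> uu' u'u.
have E v z : u v (u' v z) = z by rewrite -gmulE uu' goneE.
have E' v z : u' v (u v z) = z by rewrite -gmulE u'u goneE.
set y := ract _ _.
have c a : (rmap (rep_of y) a \o u (src a) = u (tgt a) \o rmap (rep_of x) a)%VF.
  by apply/lfunP => z; rewrite !comp_lfunE -[LHS]/(y a (u _ z)) ractE lactE E'.
have c' a : (rmap (rep_of x) a \o u' (src a) = u' (tgt a) \o rmap (rep_of y) a)%VF.
  by apply/lfunP => z; rewrite !comp_lfunE -[RHS]/(u' _ (y a z)) ractE lactE E'.
exists (mk_rhom (M := rep_of x) (N := rep_of y) (f := dapp u) c).
exists (mk_rhom (M := rep_of y) (N := rep_of x) (f := dapp u') c').
split; apply: rhom_ext => v z; rewrite rcompE comp_lfunE !mk_rhomE ?ridE id_lfunE.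
  exact: E'.
exact: E.
Qed.

(** At x0 + y0, with Ext vanishing in both directions, the tangent directions
    of block diagonal matrices and of conjugation by block unipotent matrices
    fill the whole space, so the conjugates of block diagonal representations
    with blocks in dense sets are dense. *)
Lemma two_block_dense (D1 : R b1 -> Prop) (D2 : R b2 -> Prop) (D : R b -> Prop) (x0 : R b1) (y0 : R b2) :
  dense D1 -> dense D2 ->
  (forall x y w, D1 x -> D2 y -> bisum (rep_of w) (rep_of x) (rep_of y) -> D w) ->
  ext0 (rep_of x0) (rep_of y0) -> ext0 (rep_of y0) (rep_of x0) -> dense D.
Proof.
move=> HD1 HD2 HD exy eyx G pG G0.
apply: (polyfun_curves (w0 := block1 x0 + block2 y0) pG) => T.
have [X HX] := eyx (fun a => - (P1 (tgt a) \o T a \o I2 (src a)))%VF.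
have [Y HY] := exy (fun a => - (P2 (tgt a) \o T a \o I1 (src a)))%VF.
(* X and Y account for the off-diagonal blocks of T. *)
have {}HX a z : P1 _ (T a (I2 _ z)) = X _ (y0 a z) - x0 a (X _ z).
  have := congr1 (fun f : 'Hom(_, _) => f z) (HX a).
  by rewrite /= opp_lfunE add_lfunE opp_lfunE !comp_lfunE => /(canRL (@opprK _)) ->; rewrite opprB.
have {}HY a z : P2 _ (T a (I1 _ z)) = Y _ (x0 a z) - y0 a (Y _ z).
  have := congr1 (fun f : 'Hom(_, _) => f z) (HY a).
  by rewrite /= opp_lfunE add_lfunE opp_lfunE !comp_lfunE => /(canRL (@opprK _)) ->; rewrite opprB.
pose E : gl := dmk (fun v => I1 v \o X v \o P2 v)%VF.
pose F : gl := dmk (fun v => I2 v \o Y v \o P1 v)%VF.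
have EE v z : E v z = I1 _ (X _ (P2 _ z)) by rewrite dmkE !comp_lfunE.
have FE v z : F v z = I2 _ (Y _ (P1 _ z)) by rewrite dmkE !comp_lfunE.
have E2 v z : E v (E v z) = 0 by rewrite !EE PI21 !linear0.
have F2 v z : F v (F v z) = 0 by rewrite !FE PI12 !linear0.
pose u t := gmul (gone + t *: E) (gone + t *: F).
pose u' t := gmul (gone + t *: - F) (gone + t *: - E).
have cE := unip_cancel E2; have cF := unip_cancel F2.
have cE' t v z : (gone + t *: - E) v ((gone + t *: E) v z) = z.
  have := @unip_cancel (- E) _ t v z; rewrite opprK; apply=> w y.
  by rewrite !dN linearN /= E2 !oppr0.
have cF' t v z : (gone + t *: - F) v ((gone + t *: F) v z) = z.
  have := @unip_cancel (- F) _ t v z; rewrite opprK; apply=> w y.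
  by rewrite !dN linearN /= F2 !oppr0.
have uu' t : gmul (u t) (u' t) = gone.
  apply: dext => v z; rewrite goneE gmulE (gmulE (gone + t *: E)).
  by rewrite (gmulE (gone + t *: - F)) cF cE.
have u'u t : gmul (u' t) (u t) = gone.
  apply: dext => v z; rewrite goneE gmulE (gmulE (gone + t *: - F)).
  by rewrite (gmulE (gone + t *: E)) cE' cF'.
pose cj t w := ract (u' t) (lact (u t) w).
have G1 t x y : G (cj t (block1 x + block2 y)) = 0.
  have pcj H : polymap H -> polyfun (fun x => G (cj t (H x))).
    by move=> pH; apply: polyfun_comp pG _; apply: (polymapL (ract_linl _)); apply: (polymapL (lact_linl _)).
  move: x; apply: HD1.
    by apply: pcj; apply: polymapD (polymapC _ _); apply: (polymapL block1_lin); apply: polymap_id.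
  move=> x D1x; move: y; apply: HD2.
    by apply: pcj; apply: polymapD (polymapC _ _) _; apply: (polymapL block2_lin); apply: polymap_id.
  move=> y D2y; apply: G0; apply: (HD x y) => //.
  apply: bisum_iso (riso_refl _) (riso_refl _) (block_bisum x y).
  exact: conj_iso.
pose T1 : R b1 := dmk (fun a => P1 (tgt a) \o T a \o I1 (src a))%VF.
pose T2 : R b2 := dmk (fun a => P2 (tgt a) \o T a \o I2 (src a))%VF.
have J1 : jet (fun t => (block1 x0 + block2 y0) + t *: (block1 T1 + block2 T2)) (block1 x0 + block2 y0) (block1 T1 + block2 T2).
  exact: jet_line.
have Ju : jet u gone (E + F).
  have := jetB gmul_linl gmul_linr (jet_line gone E) (jet_line gone F).
  have -> : gmul gone gone = gone by apply: dext => v z; rewrite gmulE !goneE.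
  have -> // : gmul gone F + gmul E gone = E + F.
  by apply: dext => v z; rewrite !dD !gmulE !goneE addrC.
have Ju' : jet u' gone (- E - F).
  have := jetB gmul_linl gmul_linr (jet_line gone (- F)) (jet_line gone (- E)).
  have -> : gmul gone gone = gone by apply: dext => v z; rewrite gmulE !goneE.
  have -> // : gmul gone (- E) + gmul (- F) gone = - E - F.
  by apply: dext => v z; rewrite !dD !gmulE !goneE.
have := jetB ract_linl ract_linr Ju' (jetB lact_linl lact_linr Ju J1).
have l1 w : lact gone w = w by apply: dext => a z; rewrite lactE goneE.
have r1 w : ract gone w = w by apply: dext => a z; rewrite ractE goneE.
rewrite !l1 !r1.
set T' := (X in jet _ _ X); have -> : T' = T.
  apply: dext => a z; rewrite /T' !dD lactE ractE !dD !dN.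
  set p := P1 (src a) z; set q := P2 (src a) z.
  have zE : z = I1 _ p + I2 _ q by rewrite IP.
  have S0E y : (block1 x0 + block2 y0) a y = I1 _ (x0 a (P1 _ y)) + I2 _ (y0 a (P2 _ y)).
    by rewrite dD block1E block2E.
  rewrite !block1E !block2E !EE !FE -/p -/q.
  have e1 : P1 _ (- I1 _ (X _ q) - I2 _ (Y _ p)) = - X (src a) q.
    by rewrite linearB linearN /= PI1 PI12 subr0.
  have e2 : P2 _ (- I1 _ (X _ q) - I2 _ (Y _ p)) = - Y (src a) p.
    by rewrite linearB linearN /= PI2 PI21 oppr0 sub0r.
  have e3 : P1 _ (I1 _ (x0 a p) + I2 _ (y0 a q)) = x0 a p.
    by rewrite linearD /= PI1 PI12 addr0.
  have e4 : P2 _ (I1 _ (x0 a p) + I2 _ (y0 a q)) = y0 a q.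
    by rewrite linearD /= PI2 PI21 add0r.
  rewrite e1 e2 e3 e4.
  have t1 : T1 a p = P1 _ (T a (I1 _ p)) by rewrite dmkE !comp_lfunE.
  have t2 : T2 a q = P2 _ (T a (I2 _ q)) by rewrite dmkE !comp_lfunE.
  rewrite t1 t2 -[RHS]IP.
  have -> : P1 _ (T a z) = P1 _ (T a (I1 _ p)) + (X _ (y0 a q) - x0 a (X _ q)).
    by rewrite -HX -!linearD -zE.
  have -> : P2 _ (T a z) = P2 _ (T a (I2 _ q)) + (Y _ (x0 a p) - y0 a (Y _ p)).
    by rewrite -HY -!linearD addrC -zE.
  have n1 : x0 a (- X _ q) = - x0 a (X _ q) by rewrite linearN.
  have n2 : y0 a (- Y _ p) = - y0 a (Y _ p) by rewrite linearN.
  by rewrite n1 n2 !linearD /= [RHS]addrACA [X in _ = _ + X]addrACA !addrA.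
move=> [e [pe He]]; exists e; split=> // t; rewrite -He.
have := G1 t (x0 + t *: T1) (y0 + t *: T2); congr (G _ = 0).
congr ract; congr lact.
by rewrite [x0 + _]addrC block1_lin [y0 + _]addrC block2_lin addrACA -scalerDr addrC.
Qed.
End TwoBlocks.

Section DenseTypes.
Variables (k : closedFieldType) (n : nat) (Q : quiver n).
Notation rep := (rep k Q).
Notation zr := (zero_rep k Q).
Implicit Types (M N A B X : rep).

Definition has_type b (s : seq 'cV[nat]_n) (w : rep_space k Q b) := decomp (rep_of w) s.

(** two_block_dense in coordinates taken from a decomposition of x0 + y0. *)
Lemma two_block b1 b2 (D1 : rep_space k Q b1 -> Prop) (D2 : rep_space k Q b2 -> Prop)
    (D : rep_space k Q (b1 + b2) -> Prop) (x0 : rep_space k Q b1) (y0 : rep_space k Q b2) :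
  dense D1 -> dense D2 ->
  (forall x y w, D1 x -> D2 y -> bisum (rep_of w) (rep_of x) (rep_of y) -> D w) ->
  ext0 (rep_of x0) (rep_of y0) -> ext0 (rep_of y0) (rep_of x0) -> dense D.
Proof.
have S := bsum_biprod (rep_of x0) (rep_of y0).
have [|w Mw] := @rep_of_exists_dim _ _ _ (bsum (rep_of x0) (rep_of y0)) (b1 + b2).
  by rewrite (bisum_dim_vec S) !dim_rep_of.
have [i1 [i2 [p1 [p2 H]]]] := bisum_iso Mw (riso_refl _) (riso_refl _) S.
have [h1 h2 h] := H; have [h12 h21] := biprod0 H.
have E A B (f g : rhom A B) : f = g -> forall v x, f.|[v] x = g.|[v] x by move=> ->.
apply: (@two_block_dense _ _ _ _ _ _ (fun v => i1.|[v]) (fun v => i2.|[v])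
  (fun v => p1.|[v]) (fun v => p2.|[v])) => v x.
- by have := E _ _ _ _ h1 v x; rewrite rcompE comp_lfunE ridE id_lfunE.
- by have := E _ _ _ _ h2 v x; rewrite rcompE comp_lfunE ridE id_lfunE.
- by have := E _ _ _ _ h12 v x; rewrite rcompE comp_lfunE at0 zero_lfunE.
- by have := E _ _ _ _ h21 v x; rewrite rcompE comp_lfunE at0 zero_lfunE.
- by have := E _ _ _ _ h v x; rewrite atD !rcompE add_lfunE !comp_lfunE ridE id_lfunE.
Qed.

Lemma ext0_zero_l N : ext0 zr N.
Proof.
move=> c; exists (fun v => 0) => a; rewrite comp_lfun0r comp_lfun0l subr0.
apply/lfunP => x; have /dim0P H := zero_repP k Q (src a).
by rewrite (H x) !linear0.
Qed.

Lemma ext0_zero_r M : ext0 M zr.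
Proof.
move=> c; exists (fun v => 0) => a; rewrite comp_lfun0r comp_lfun0l subr0.
apply/lfunP => x; have /dim0P H := zero_repP k Q (tgt a).
by rewrite [LHS]H [RHS]H.
Qed.

Definition list_sum (s : seq rep) : rep := foldr (@bsum k n Q) zr s.

Lemma dim_list_sum s : dim_vec (list_sum s) = dims s.
Proof.
elim: s => [|A s IH] /=.
  by rewrite /dims big_nil; apply/matrixP => v j; rewrite !mxE zero_repP.
by rewrite dims_cons -IH; apply: bisum_dim_vec (bsum_biprod _ _).
Qed.

Lemma ext0_list_sum_r A s : (forall i, (i < size s)%N -> ext0 A (nth zr s i)) -> ext0 A (list_sum s).
Proof.
elim: s => [|B s IH] H /=; first exact: ext0_zero_r.
apply: ext0_bisum_r (bsum_biprod _ _) (H 0%N isT) (IH _) => i si.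
exact: (H i.+1).
Qed.

Lemma ext0_list_sum_l A s : (forall i, (i < size s)%N -> ext0 (nth zr s i) A) -> ext0 (list_sum s) A.
Proof.
elim: s => [|B s IH] H /=; first exact: ext0_zero_l.
apply: ext0_bisum_l (bsum_biprod _ _) (H 0%N isT) (IH _) => i si.
exact: (H i.+1).
Qed.

Definition rigid_list (s : seq rep) :=
  (forall i j, (i < size s)%N -> (j < size s)%N -> i != j -> ext0 (nth zr s i) (nth zr s j))
  /\ (forall i, (i < size s)%N -> schur_root k Q (dim_vec (nth zr s i))).

Definition dim_vecs (s : seq rep) := [seq dim_vec N | N <- s].

(** The first term against the sum of the others is a pair of blocks. *)
Theorem rigid_dense s : rigid_list s -> forall b, b = dims s ->
  dense (@has_type b (dim_vecs s)).
Proof.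
elim: s => [|A s IH] [es ss] b bE.
  apply: denseT => w; apply: Decomp0 => v.
  by rewrite -dim_vecE dim_rep_of bE /dims big_nil mxE.
rewrite dims_cons in bE; rewrite {}bE => {b}.
have [x0 Ax] := rep_of_exists A.
have [y0 By] := rep_of_exists_dim (dim_list_sum s).
apply: (two_block (D1 := fun x => indecomposable (rep_of x)) (D2 := has_type (dim_vecs s))
  (x0 := x0) (y0 := y0)).
- exact: general_dense (ss 0%N isT).
- apply: IH => //; split=> [i j si sj ij|i si].
    exact: (es i.+1 j.+1).
  exact: (ss i.+1).
- move=> x y w ix ty S; rewrite /has_type /=.
  by have := DecompS S ix ty; rewrite {1}dim_rep_of.
- apply: ext0_iso (riso_sym Ax) (riso_sym By) _; apply: ext0_list_sum_r => i si.
  exact: (es 0%N i.+1).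
- apply: ext0_iso (riso_sym By) (riso_sym Ax) _; apply: ext0_list_sum_l => i si.
  exact: (es i.+1 0%N).
Qed.

End DenseTypes.

(** * Two dense types coincide *)

Section Digits.

Lemma base_digit (B N v : nat) (c : nat -> nat) : (forall u, c u < B)%N -> (v < N)%N ->
  (((\sum_(u < N) B ^ u * c u) %/ B ^ v) %% B = c v)%N.
Proof.
elim: v N c => [|v IH] [|N] c cB // vN.
  rewrite expn0 divn1 big_ord_recl expn0 mul1n.
  rewrite (eq_bigr (fun u : 'I_N => B * (B ^ u * c u.+1))%N); last first.
    by move=> u _; rewrite expnS mulnA.
  by rewrite -big_distrr /= addnC mulnC modnMDl modn_small.
have B0 : (0 < B)%N by apply: leq_ltn_trans (cB 0%N).
rewrite big_ord_recl expn0 mul1n.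
rewrite (eq_bigr (fun u : 'I_N => B * (B ^ u * c u.+1))%N); last first.
  by move=> u _; rewrite expnS mulnA.
rewrite -big_distrr /= expnS divnMA addnC mulnC divnMDl // (divn_small (cB _)) addn0.
exact: (IH N (fun u => c u.+1)).
Qed.

Variables (n : nat).

(** The base B value of a vector: being additive, it turns a multiset of
    dimension vectors into a multiset of multiplicities of one polynomial; being
    injective for entries less than B, it loses nothing. *)
Definition encode B (c : 'cV[nat]_n) : nat := (\sum_(u < n) B ^ u * c u 0%R)%N.
Definition decode B x : 'cV[nat]_n := \col_v ((x %/ B ^ v) %% B)%N.

Lemma encodeK B (c : 'cV[nat]_n) : (forall v, c v 0%R < B)%N -> decode B (encode B c) = c.
Proof.
move=> cB; apply/matrixP => v j; rewrite (ord1 j) mxE.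
pose d u := if insub u is Some i then c i 0 else 0%N.
have dE (i : 'I_n) : d i = c i 0 by rewrite /d valK.
rewrite -[RHS](dE v) -(@base_digit B n v d) //; last first.
  rewrite /d => u; case: insubP => [i _ _ //|_].
  exact: leq_ltn_trans (cB v).
by congr (_ %/ _ %% _)%N; apply: eq_bigr => i _; rewrite dE.
Qed.

Lemma encode_gt0 B (c : 'cV[nat]_n) : (forall v, c v 0%R < B)%N -> c != 0 -> (0 < encode B c)%N.
Proof.
move=> cB; apply: contraNT; rewrite -eqn0Ngt => /eqP e0.
rewrite -(encodeK cB) e0; apply/eqP/matrixP => v j.
by rewrite !mxE div0n mod0n.
Qed.

End Digits.

Section Multiplicities.
Variable k : closedFieldType.

Definition mprod (ls : seq k) (ms : seq nat) : {poly k} :=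
  \prod_(x <- zip ls ms) ('X - x.1%:P) ^+ x.2.

Lemma root_mprod ls ms z : root (mprod ls ms) z =
  has (fun x => (x.1 == z) && (0 < x.2)%N) (zip ls ms).
Proof.
rewrite /mprod; elim: (zip ls ms) => [|x r IH] /=.
  by rewrite big_nil rootE hornerC oner_eq0.
rewrite big_cons rootM IH rootE horner_exp hornerXsubC expf_eq0 subr_eq0 andbC.
by rewrite eq_sym.
Qed.

Lemma zip_mem1 (ls : seq k) (ms : seq nat) z m : (z, m) \in zip ls ms -> z \in ls.
Proof.
elim: ls ms => [|l ls IH] [|m' ms] //=; rewrite !inE.
by case/orP => [/eqP[-> _]|/IH ->]; rewrite ?eqxx ?orbT.
Qed.

Lemma mem_zip (ls : seq k) (ms : seq nat) z : size ls = size ms -> z \in ls ->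
  (z, nth 0%N ms (index z ls)) \in zip ls ms.
Proof.
move=> sz zl; have <- : nth (0, 0%N) (zip ls ms) (index z ls) = (z, nth 0%N ms (index z ls)).
  by rewrite nth_zip // nth_index.
by apply: mem_nth; rewrite size_zip -sz minnn index_mem.
Qed.

Lemma mprod_mult ls ms z m : uniq ls -> size ls = size ms ->
  (z, m) \in zip ls ms -> exists2 q, mprod ls ms = q * ('X - z%:P) ^+ m & ~~ root q z.
Proof.
rewrite /mprod; elim: ls ms => [|l ls IH] [|m' ms] //= /andP[lls uls] [sz].
rewrite inE big_cons /= => /orP[/eqP[-> ->]|zin].
  exists (mprod ls ms); first by rewrite mulrC.
  rewrite root_mprod; apply: contra lls => /hasP[[y j] yin /andP[/eqP <- _]].
  exact: zip_mem1 yin.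
have [q qE nq] := IH ms uls sz zin.
exists (('X - l%:P) ^+ m' * q); first by rewrite qE mulrA.
rewrite rootM negb_or nq andbT rootE horner_exp hornerXsubC expf_eq0 subr_eq0.
apply/negP => /andP[_ /eqP zl]; case/negP: lls; rewrite -zl.
exact: zip_mem1 zin.
Qed.

Lemma mult_uniq (q q' : {poly k}) z m m' : ~~ root q z -> ~~ root q' z ->
  q * ('X - z%:P) ^+ m = q' * ('X - z%:P) ^+ m' -> m = m'.
Proof.
wlog le : q q' m m' / (m <= m')%N => [H|] nq nq' E.
  by have [le|/ltnW le] := leqP m m'; [apply: H E | apply/esym; apply: H (esym E)].
apply/eqP; rewrite eqn_leq le /= leqNgt; apply/negP => lt.
move: E; rewrite -(subnK le) exprD mulrA => /mulIf E.
case/negP: nq; rewrite E ?expf_neq0 ?polyXsubC_eq0 // rootM.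
by rewrite orbC rootE horner_exp hornerXsubC subrr expf_eq0 eqxx andbT subn_gt0 lt.
Qed.

(** The first factorization has the true roots and multiplicities, and the
    second refines it. *)
Lemma mprod_eq ls ms ls' ms' : uniq ls -> size ls = size ms -> size ls' = size ms' ->
  all (fun m => 0 < m)%N ms -> mprod ls ms = mprod ls' ms' ->
  (size ms <= size ms')%N /\ (size ms = size ms' -> perm_eq ms ms').
Proof.
move=> uls sz sz' pm E.
have sub : {subset ls <= ls'}.
  move=> z zls; have : root (mprod ls ms) z.
    rewrite root_mprod; apply/hasP; exists (z, nth 0%N ms (index z ls)).
      exact: mem_zip.
    by rewrite /= eqxx; apply: (allP pm); apply: mem_nth; rewrite -sz index_mem.
  rewrite E root_mprod => /hasP[[y j] yin /andP[/eqP <- _]].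
  exact: zip_mem1 yin.
split=> [|sm]; first by rewrite -sz -sz'; apply: uniq_leq_size.
have [uls' mls] : uniq ls' /\ ls =i ls'.
  have s1 : (size ls' <= size ls)%N by rewrite sz' -sm sz.
  split; first by apply: leq_size_uniq s1 => //.
  by have [] := uniq_min_size uls sub s1.
have zu (l : seq k) m : uniq l -> size l = size m -> uniq (zip l m).
  by move=> ul sl; apply: (@map_uniq _ _ fst); rewrite -/(unzip1 _) unzip1_zip ?sl.
have : perm_eq (zip ls ms) (zip ls' ms').
  apply: uniq_perm; [exact: zu | exact: zu |].
  have half l m l' m' : uniq l -> uniq l' -> size l = size m -> size l' = size m' ->
      {subset l <= l'} -> mprod l m = mprod l' m' -> {subset zip l m <= zip l' m'}.
    move=> ul ul' sl sl' ll' e [z j] zj.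
    have zl := zip_mem1 zj.
    have zl' := ll' _ zl; pose j' := nth 0%N m' (index z l').
    have zj' : (z, j') \in zip l' m' by apply: mem_zip.
    have [q qE nq] := mprod_mult ul sl zj.
    have [q' qE' nq'] := mprod_mult ul' sl' zj'.
    have -> // : j = j' by apply: (mult_uniq nq nq'); rewrite -qE -qE'.
  move=> x; apply/idP/idP; first exact: half.
  by apply: half => // y; rewrite mls.
move/(perm_map snd); rewrite -!/(unzip2 _) !unzip2_zip ?sz ?sz' //.
Qed.

Lemma uniq_scalars N : exists ls : seq k, uniq ls /\ size ls = N.
Proof.
elim: N => [|N [ls [uls sls]]]; first by exists [::].
have [z zP] : exists z, z \notin ls.
  apply: NNPP => H; have := @poly_zero k (\prod_(l <- ls) ('X - l%:P)).
  move=> /(_ _)/eqP; rewrite prodf_seq_eq0 => h.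
  have : has (fun l : k => 'X - l%:P == 0) ls.
    apply: h => z; apply/rootP; rewrite root_prod_XsubC.
    by apply: contraT => nz; case: H; exists z.
  by case/hasP => l _; rewrite polyXsubC_eq0.
by exists (z :: ls); rewrite /= zP uls sls.
Qed.

(** root_pattern_closed, with the block of j of size ms_j. *)
Lemma mprod_closed (W : vectType k) (D : W -> Prop) (a : W -> {poly k}) ms : dense D ->
  (forall w, a w \is monic /\ size (a w) = (\sum_(m <- ms) m).+1) ->
  (forall i, polyfun (fun w => (a w)`_i)) ->
  (forall w, D w -> exists ls, size ls = size ms /\ a w = mprod ls ms) ->
  forall w, exists ls, size ls = size ms /\ a w = mprod ls ms.
Proof.
move=> HD Ha pa Hl w.
pose J := 'I_(size ms); pose I := {j : J & 'I_(nth 0%N ms j)}.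
have cI : #|{: I}| = (\sum_(m <- ms) m)%N.
  rewrite card_tagged sumnE big_map big_enum /= (big_nth 0%N) big_mkord.
  by apply: eq_bigr => j _; rewrite card_ord.
have E (l : J -> k) : \prod_(i < #|{: I}|) ('X - (l (tag (enum_val i)))%:P) =
    mprod [seq l j | j <- enum J] ms.
  transitivity (\prod_(x : I) ('X - (l (tag x))%:P)).
    by rewrite [RHS](reindex _ (onW_bij _ (@enum_val_bij I))).
  rewrite -(@sig_big_dep _ _ _ J (fun j => 'I_(nth 0%N ms j)) xpredT (fun _ => xpredT)
      (fun j _ => 'X - (l j)%:P)) /=.
  have sz : size [seq l j | j <- enum J] = size ms by rewrite size_map size_enum_ord.
  rewrite /mprod (big_nth (0, 0%N)) size_zip sz minnn big_mkord.
  apply: eq_bigr => j _; rewrite prodr_const card_ord nth_zip //=.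
  by rewrite (nth_map j) ?size_enum_ord // nth_ord_enum.
have h1 v : a v \is monic /\ size (a v) = #|{: I}|.+1 by rewrite cI.
have h2 v : D v -> exists l : J -> k,
    a v = \prod_(i < #|{: I}|) ('X - (l (tag (enum_val i)))%:P).
  move=> /Hl[ls [sls av]]; pose l (j : J) := nth 0 ls j.
  exists l; rewrite av (E l); congr (mprod _ ms); apply: (@eq_from_nth _ 0).
    by rewrite size_map size_enum_ord.
  move=> i si; rewrite sls in si.
  by rewrite (nth_map (Ordinal si)) ?size_enum_ord // /l /J nth_enum_ord.
have [l al] := root_pattern_closed HD h1 pa h2 w.
exists [seq l j | j <- enum J]; rewrite size_map size_enum_ord; split=> //.
by rewrite al E.
Qed.

End Multiplicities.

Section PolyFamilies.
Variables (k : fieldType) (W : vectType k).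

Definition ppoly (a : W -> {poly k}) := forall i, polyfun (fun w => (a w)`_i).

Lemma ppoly_ext a b : a =1 b -> ppoly a -> ppoly b.
Proof. by move=> e H i; apply: polyfun_ext (H i) => w; rewrite e. Qed.

Lemma ppolyC (p : {poly k}) : ppoly (fun=> p).
Proof. by move=> i; apply: polyfunC. Qed.

Lemma ppolyM a b : ppoly a -> ppoly b -> ppoly (fun w => a w * b w).
Proof.
move=> Ha Hb i; apply: (@polyfun_ext _ _ (fun w => \sum_(j < i.+1) (a w)`_j * (b w)`_(i - j))).
  by move=> w; rewrite coefM.
by apply: polyfun_sum => j; apply: polyfunM.
Qed.

Lemma ppoly_sum (I : Type) (r : seq I) (P : pred I) F :
  (forall i, ppoly (F i)) -> ppoly (fun w => \sum_(i <- r | P i) F i w).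
Proof.
move=> H i; apply: (@polyfun_ext _ _ (fun w => \sum_(j <- r | P j) (F j w)`_i)).
  by move=> w; rewrite coef_sum.
by apply: polyfun_sum => j; apply: H.
Qed.

Lemma ppoly_prod (I : Type) (r : seq I) (P : pred I) F :
  (forall i, ppoly (F i)) -> ppoly (fun w => \prod_(i <- r | P i) F i w).
Proof.
move=> H; elim: r => [|i r IH].
  by apply: ppoly_ext (ppolyC 1) => w; rewrite big_nil.
case Pi: (P i); last by apply: ppoly_ext IH => w; rewrite big_cons Pi.
by apply: ppoly_ext (ppolyM (H i) IH) => w; rewrite big_cons Pi.
Qed.

Lemma ppolyX a m : ppoly a -> ppoly (fun w => a w ^+ m).
Proof.
move=> H; apply: (@ppoly_ext (fun w => \prod_(i < m) a w)).
  by move=> w; rewrite prodr_const card_ord.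
exact: ppoly_prod.
Qed.

Lemma ppoly_char d (F : W -> 'M[k]_d) : polymx F -> ppoly (fun w => char_poly (F w)).
Proof.
move=> HF; apply: ppoly_sum => s; apply: ppolyM (ppolyC _) _; apply: ppoly_prod => i.
move=> j; apply: (@polyfun_ext _ _ (fun w => ('X *+ (i == s i))`_j - (F w i (s i)) * (j == 0%N)%:R)).
  by move=> w; rewrite !mxE coefB coefC; case: (j == 0%N); rewrite ?mulr1 ?mulr0.
apply: polyfunD (polyfunC _ _) _; apply: polyfunN; exact: polyfunM (HF _ _) (polyfunC _ _).
Qed.

End PolyFamilies.

Section GenericType.
Variables (k : closedFieldType) (n : nat) (Q : quiver n).
Notation rep := (rep k Q).
Notation zr := (zero_rep k Q).
Implicit Types (s : seq 'cV[nat]_n).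

Lemma size_prod_monic (I : Type) (r : seq I) (F : I -> {poly k}) :
  (forall i, F i \is monic) ->
  size (\prod_(i <- r) F i) = (\sum_(i <- r) (size (F i)).-1).+1.
Proof.
move=> H; elim: r => [|i r IH]; first by rewrite !big_nil size_poly1.
rewrite !big_cons size_Mmonic ?monic_neq0 ?monic_prod // IH addnS /=.
have : (0 < size (F i))%N by rewrite lt0n size_poly_eq0 monic_neq0.
by case: (size (F i)).
Qed.

(** The weights B ^ v combine the characteristic polynomials at all vertices
    into one: an eigenvalue with multiplicities c v has multiplicity encode B c. *)
Definition total_chi B M (f : rhom M M : vectType k) : {poly k} :=
  \prod_(v < n) (@chi k n Q M f v) ^+ (B ^ v).

Lemma prod_encode B (z : seq (k * 'cV[nat]_n)) :
  \prod_(v < n) (\prod_(x <- z) ('X - x.1%:P) ^+ x.2 v 0) ^+ (B ^ v) =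
  mprod (unzip1 z) [seq encode B c | c <- unzip2 z].
Proof.
rewrite /mprod -map_comp zip_map big_map.
rewrite (eq_bigr (fun v : 'I_n => \prod_(x <- z) ('X - x.1%:P) ^+ (B ^ v * x.2 v 0))); last first.
  by move=> v _; rewrite -prodrXl; apply: eq_bigr => x _; rewrite -exprM mulnC.
by rewrite exchange_big; apply: eq_bigr => x _; rewrite prodrXr.
Qed.

Lemma mprod_perm (ls : seq k) ms ms' : size ls = size ms -> perm_eq ms' ms ->
  exists ls', size ls' = size ms' /\ mprod ls ms = mprod ls' ms'.
Proof.
move=> sz /(perm_iotaP 0%N)[Is pI ->].
exists [seq nth 0 ls i | i <- Is]; rewrite !size_map; split=> //.
rewrite /mprod zip_map big_map /= (perm_big _ pI) /= (big_nth (0, 0%N)) /=.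
rewrite size_zip sz minnn /index_iota subn0 !big_seq; apply: eq_bigr => i _.
by rewrite nth_zip.
Qed.

Lemma total_chi_type B M (f : rhom M M) s : decomp M s ->
  exists ls, size ls = size [seq encode B c | c <- s] /\
    total_chi B f = mprod ls [seq encode B c | c <- s].
Proof.
move=> /(spectrum f)[z [pz Hz]].
have p1 : perm_eq s (unzip2 z) by rewrite perm_sym.
have sz : size (unzip1 z) = size [seq encode B c | c <- unzip2 z] by rewrite !size_map.
have [ls [sls E]] := mprod_perm sz (perm_map (encode B) p1).
exists ls; split=> //; rewrite -E -prod_encode; apply: eq_bigr => v _.
by rewrite Hz.
Qed.

Lemma encode_sum B s : (\sum_(c <- s) encode B c)%N = encode B (\sum_(c <- s) c).
Proof.
rewrite /encode exchange_big; apply: eq_bigr => v _ /=.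
by rewrite summxE big_distrr.
Qed.

Lemma type_bound b s (w : rep_space k Q b) c v : has_type s w -> c \in s ->
  (c v 0%R <= b v 0%R)%N.
Proof.
move=> /decomp_dim; rewrite dim_rep_of => -> cs.
by rewrite summxE (big_rem c) //= leq_addr.
Qed.

(** At a point w0 of type s where the dimension of End is least, let f0 act by
    distinct scalars on the summands, and extend f0 to a polynomial family of
    endomorphisms near w0.  At the points of type s' the multiplicities of its
    eigenvalues are sums of entries of s'; this is a closed condition, so it
    holds at w0, where the multiplicities are the entries of s.  Hence s is
    obtained from s' by merging entries. *)
Lemma type_le b s s' : dense (@has_type k n Q b s) -> dense (@has_type k n Q b s') ->
  (size s <= size s')%N /\ (size s = size s' -> perm_eq s s').
Proof.
move=> Ds Ds'; pose R := rep_space k Q b.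
have pid := @polymap_id _ R.
have pL := comm_fam_pmap pid pid.
pose rk (w : R) : nat := \dim (limg (comm_op w w)).
have [w1 max1] : exists w1, forall w, (rk w <= rk w1)%N.
  pose N : nat := \dim {: dprod (fun a : arrow Q =>
                'Hom('rV[k]_(b (src a) 0), 'rV[k]_(b (tgt a) 0)) : vectType k)}.
  have rkN w : (rk w <= N)%N by rewrite dimvS ?subvf.
  have [m [[w1 m1] mmin]] : exists m, (exists w, m = N - rk w)%N /\
      forall j, (exists w, j = N - rk w)%N -> (m <= j)%N.
    by apply: min_exists; exists (N - rk 0%R)%N, 0.
  exists w1 => w; have : (m <= N - rk w)%N by apply: mmin; exists w.
  by rewrite m1 leq_sub2lE.
have [d1 [pd1 d11 Hd1]] := rank_semicont w1 pL.
have [w0 tw0 d10] := dense_meet Ds pd1 d11.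
have max0 w : (rk w <= rk w0)%N := leq_trans (max1 w) (Hd1 _ d10).
have [ls [uls sls]] := uniq_scalars k (size s).
have [f0 Hf0] := chi_scalars tw0 sls.
have Hf : comm_op w0 w0 (vsval f0) = 0.
  apply/dprodP => a; rewrite comm_opE dmkE; apply/eqP; rewrite subr_eq0; apply/eqP.
  exact: (rhomC f0 a).
have [d [g [pd dw0 pg gw0 Hg]]] := ker_lift pL max0 Hf.
pose B := (\sum_v b v 0%R).+1.
have bB (t : seq 'cV[nat]_n) w c v : @has_type k n Q b t w -> c \in t -> (c v 0%R < B)%N.
  move=> tw ct; rewrite ltnS; apply: leq_trans (type_bound v tw ct) _.
  by rewrite (bigD1 v) //= leq_addr.
pose a (w : R) := \prod_(v < n) char_poly (VectorInternalTheory.f2mx (g w v)) ^+ (B ^ v).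
have af w : d w != 0 -> exists f : rhom (rep_of w) (rep_of w), a w = total_chi B f.
  move=> /Hg gw.
  have C e : (rmap (rep_of w) e \o g w (src e) = g w (tgt e) \o rmap (rep_of w) e)%VF.
    apply/eqP; rewrite -subr_eq0; apply/eqP.
    by have := comm_opE w w (g w) e; rewrite gw dmkE => <-.
  exists (mk_rhom (M := rep_of w) (N := rep_of w) (f := g w) C).
  by apply: eq_bigr => v _; rewrite /chi mk_rhomE.
have [w' tw' _] := dense_meet Ds' pd dw0.
have E' : (\sum_(m <- [seq encode B c | c <- s']) m)%N = encode B b.
  by rewrite big_map encode_sum -(decomp_dim tw') dim_rep_of.
have [|||ls' [sls' al]] := @mprod_closed k _ _ a [seq encode B c | c <- s']
    (dense_open Ds' pd dw0) _ _ _ w0.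
- move=> w; rewrite E'; split; first by apply: monic_prod => v _; apply/monic_exp/char_poly_monic.
  rewrite size_prod_monic; last by move=> v; apply/monic_exp/char_poly_monic.
  congr _.+1; apply: eq_bigr => v _; rewrite size_exp size_char_poly /=.
  by rewrite mulnC /dim /= mul1n.
- apply: ppoly_prod => v; apply: ppolyX; apply: ppoly_char; apply: polymap_f2mx.
  by apply: (polymapL (L := fun y : dprod (fun v => 'Hom('rV[k]_(b v 0), 'rV[k]_(b v 0)) : vectType k) => dapp y v)) pg => c y z; rewrite dprodD dprodZ.
- by move=> w [tw /af[f ->]]; apply: total_chi_type.
have al0 : a w0 = mprod ls [seq encode B c | c <- s].
  rewrite /a gw0.
  transitivity (total_chi B f0); first exact: eq_bigr.
  have -> : mprod ls [seq encode B c | c <- s] =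
    mprod (unzip1 (zip ls s)) [seq encode B c | c <- unzip2 (zip ls s)].
    by rewrite unzip1_zip ?sls // unzip2_zip ?sls.
  by rewrite -prod_encode; apply: eq_bigr => v _; rewrite Hf0.
have pos : all (fun m => 0 < m)%N [seq encode B c | c <- s].
  apply/allP => _ /mapP[c cs ->]; apply: encode_gt0.
    by move=> v; apply: bB tw0 cs.
  exact: decomp_nonzero tw0 cs.
have sls2 : size ls = size [seq encode B c | c <- s] by rewrite size_map.
have [le eqm] := mprod_eq uls sls2 sls' pos (etrans (esym al0) al).
rewrite !size_map in le eqm; split=> // /eqm /(perm_map (decode n B)).
rewrite -!map_comp !map_id_in // => c cs /=; apply: encodeK => v.
  exact: bB tw' cs.
exact: bB tw0 cs.
Qed.

Theorem dense_type_uniq b s s' : dense (@has_type k n Q b s) ->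
  dense (@has_type k n Q b s') -> perm_eq s s'.
Proof.
move=> D D'; have [le eqs] := type_le D D'; have [le' _] := type_le D' D.
by apply/eqs/eqP; rewrite eqn_leq le.
Qed.

(** There are only finitely many types, and only one of them is dense. *)
Theorem dense_type_general b s : dense (@has_type k n Q b s) ->
  for_general (@has_type k n Q b s).
Proof.
move=> D; pose N := (\sum_v b v 0%R)%N.
pose T := {bseq N of {ffun 'I_n -> 'I_N.+1}}.
pose vec (f : {ffun 'I_n -> 'I_N.+1}) : 'cV[nat]_n := \col_v (f v : nat).
pose dec (x : T) : seq 'cV[nat]_n := map vec x.
have cover (w : rep_space k Q b) t : has_type t w -> exists x : T, dec x = t.
  move=> tw; have bd c v : c \in t -> (c v 0%R < N.+1)%N.
    move=> ct; rewrite ltnS; apply: leq_trans (type_bound v tw ct) _.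
    by rewrite /N (bigD1 v) //= leq_addr.
  have st : (size t <= N)%N.
    rewrite /N -(dim_rep_of w) (decomp_dim tw).
    rewrite (eq_bigr (fun v => \sum_(c <- t) c v 0%R)%N); last by move=> v _; rewrite summxE.
    rewrite exchange_big /= -sum1_size !big_seq; apply: leq_sum => c ct.
    have := decomp_nonzero tw ct; apply: contraNT; rewrite -ltnNge ltnS leqn0 sum_nat_eq0.
    move=> /forallP H; apply/eqP/matrixP => v j; rewrite (ord1 j) mxE.
    exact/eqP/H.
  pose x := [seq [ffun v => inord (c v 0) : 'I_N.+1] | c : 'cV[nat]_n <- t].
  have sx : (size x <= N)%N by rewrite size_map.
  exists (Bseq sx); rewrite /dec /= -map_comp map_id_in // => c ct /=.
  by apply/matrixP => v j; rewrite (ord1 j) mxE ffunE inordK // bd.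
have nd (x : T) : ~ dense (fun w : rep_space k Q b => has_type (dec x) w /\ ~~ perm_eq (dec x) s).
  move=> Dx; case: (boolP (perm_eq (dec x) s)) => [px|npx].
    have H (w : rep_space k Q b) : has_type (dec x) w /\ ~~ perm_eq (dec x) s -> (1 : k) = 0.
      by rewrite px => -[].
    by have /eqP := Dx (fun=> 1) (polyfunC _ 1) H 0; rewrite oner_eq0.
  case/negP: npx; apply: dense_type_uniq D.
  by apply: dense_sub Dx => w [].
case/for_generalP: (general_avoid nd) => f [pf_f nz_f Hf]; apply/for_generalP.
exists f; split=> // w /Hf H; have [t tw] := decomp_exists (rep_of w).
have [x xt] := cover w t tw; have := H x; rewrite xt.
case pt: (perm_eq t s); last by case.
move=> _.
exact: decomp_perm pt tw.
Qed.

End GenericType.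

(** * Paths and the Euler matrix *)

Section Paths.
Variables (n : nat) (Q : quiver n).
Implicit Types (u v w : 'I_n) (p q : seq (arrow Q)).

Lemma is_path_cat v p q u w : is_path v p u -> is_path u q w -> is_path v (p ++ q) w.
Proof.
elim: p v => [|a p IH] v /=; first by move=> /eqP ->.
by move=> /andP[-> pu] qw; apply: IH.
Qed.

Lemma is_path_rcons v p a u : is_path v (rcons p a) u = is_path v p (src a) && (tgt a == u).
Proof.
elim: p v => [|b p IH] v /=; first by rewrite (eq_sym v).
by rewrite IH andbA.
Qed.

Lemma is_path_prefix v p u w : is_path v p u -> w \in [seq tgt a | a <- p] ->
  exists2 q : seq (arrow Q), is_path v q w & q != [::].
Proof.
elim: p v => [|a p IH] v //= /andP[/eqP va pu]; rewrite inE.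
have [-> _|_ /= wp] := eqVneq w (tgt a); first by exists [:: a]; rewrite //= va !eqxx.
by have [q qw nq] := IH _ pu wp; exists (a :: q); rewrite //= va eqxx.
Qed.

Hypothesis acyc : acyclic Q.

Lemma is_path_uniq v p u : is_path v p u -> uniq (v :: [seq tgt a | a <- p]).
Proof.
elim: p v => [|a p IH] v //= pvu; have /andP[/eqP va pu] := pvu.
have := IH _ pu; rewrite /= => ->; rewrite andbT; apply/negP => vp.
by have [q /acyc -> //] := is_path_prefix (p := a :: p) pvu vp.
Qed.

Lemma is_path_size v p u : is_path v p u -> (size p < n)%N.
Proof.
move=> /is_path_uniq/card_uniqP e.
by have := max_card (mem (v :: [seq tgt a | a <- p])); rewrite e card_ord /= size_map.
Qed.

Definition pseq v u (x : qpath Q v u) : seq (arrow Q) := val x.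

Lemma pseqP v u (x : qpath Q v u) : is_path v (pseq x) u.
Proof. exact: valP x. Qed.

Lemma pseq_inj v u : injective (@pseq v u).
Proof. by move=> x y; move/val_inj/val_inj. Qed.

Lemma pseq_exists v u p : is_path v p u -> exists x : qpath Q v u, pseq x = p.
Proof.
move=> pu; have sp : (size p <= n)%N by apply/ltnW/(is_path_size pu).
by exists (exist (fun b : n.-bseq (arrow Q) => is_path v b u) (Bseq sp) pu).
Qed.

Definition npath u v : nat := #|qpath Q v u|.

Lemma npathE v u : npath u v = ((v == u) + \sum_(a : arrow Q | tgt a == u) npath (src a) v)%N.
Proof.
pose L w := [seq pseq x | x <- enum (qpath Q v w)].
have uL w : uniq (L w) by rewrite map_inj_uniq ?enum_uniq //; apply: pseq_inj.
have mL w p : (p \in L w) = is_path v p w.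
  apply/mapP/idP => [[x _ ->]|]; first exact: pseqP.
  by move=> /pseq_exists[x <-]; exists x; rewrite ?mem_enum.
have sL w : size (L w) = npath w v by rewrite size_map -cardE.
pose A := [seq a <- enum (arrow Q) | tgt a == u].
pose L1 := [seq rcons p a | a <- A, p <- L (src a)].
have -> : npath u v = size ((if v == u then [:: [::]] else [::]) ++ L1).
  rewrite -sL; apply: perm_size; apply: uniq_perm => //.
    rewrite cat_uniq; apply/and3P; split; first by case: eqP.
      apply/hasPn => _ /allpairsPdep[a [p [_ _ ->]]].
      by case: ifP; rewrite ?inE //; case: p.
    apply: allpairs_uniq_dep => [|a _|[a p] [b q] _ _ /=].
    - by rewrite /A filter_uniq // enum_uniq.
    - exact: uL.
    - by move/rcons_inj => [-> ->].
  move=> p; rewrite mL mem_cat; apply/idP/orP.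
    case: (lastP p) => [/= ->|q a]; first by left; rewrite inE.
    rewrite is_path_rcons => /andP[qa ta]; right; apply/allpairsPdep.
    by exists a, q; rewrite mem_filter ta mem_enum mL qa.
  case=> [|/allpairsPdep[a [q []]]]; first by case: ifP => // vu; rewrite inE => /eqP ->.
  rewrite mem_filter mem_enum mL => /andP[ta _] qa ->.
  by rewrite is_path_rcons qa ta.
rewrite size_cat size_allpairs_dep sumnE big_map; congr (_ + _)%N; first by case: eqP.
by rewrite big_filter big_enum_cond /=; apply: eq_bigr => a _; rewrite sL.
Qed.

Lemma no_loop (a : arrow Q) : src a != tgt a :> 'I_n.
Proof.
apply/eqP => e; have := @acyc (src a) [:: a]; rewrite /= eqxx /= e eqxx.
by move=> /(_ isT).
Qed.

Definition path_mx : 'M[int]_n := \matrix_(u, v) (npath u v)%:Z.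

(** A path is trivial or has a last arrow; this is the recursion npathE, written
    as a matrix equation. *)
Lemma euler_path : (euler_mx Q)^T *m path_mx = 1%:M.
Proof.
apply/matrixP => w v; rewrite !mxE (bigD1 w) //= !mxE eqxx mul1r.
rewrite npathE PoszD -addrA [X in _ + X](_ : _ = 0) ?addr0; last first.
  apply/eqP; rewrite addr_eq0 -sumrN; apply/eqP.
  rewrite (partition_big (fun a => src a) (fun u => u != w)) /=; last first.
    by move=> a /eqP <-; apply: no_loop.
  rewrite (big_morph Posz PoszD (erefl _)); apply: eq_bigr => u uw.
  rewrite !mxE (negPf uw) mulNr opprK.
  rewrite (eq_bigr (fun=> npath u v)) => [|a /andP[_ /eqP ->] //].
  rewrite sum_nat_const PoszM; congr (Posz _ * _); apply: eq_card => a.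
  by rewrite !inE andbC.
by rewrite (eq_sym v); case: (w == v).
Qed.

Lemma inv_euler : invmx (euler_mx Q)^T = path_mx.
Proof.
have [u _] := mulmx1_unit euler_path.
by rewrite -[LHS]mulmx1 -euler_path mulmxA mulVmx // mul1mx.
Qed.

Lemma path_euler : path_mx *m (euler_mx Q)^T = 1%:M.
Proof. by rewrite mulmx1C // euler_path. Qed.

(** It increases strictly along paths, and gives the order in which the entries
    of mu and gamma are determined. *)
Definition height u : nat := #|[set v | (0 < npath u v)%N]|.

Lemma npath_gt0 u v : (0 < npath u v)%N <-> exists p, is_path v p u.
Proof.
split=> [/card_gt0P[x _]|[p /pseq_exists[x _]]]; first by exists (pseq x); apply: pseqP.
by apply/card_gt0P; exists x.
Qed.

Lemma npath_diag u : npath u u = 1%N.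
Proof.
have H (x : qpath Q u u) : pseq x = [::] by apply: acyc (pseqP x).
have [|x0 _] := @pseq_exists u u [::]; first by rewrite /= eqxx.
have e : qpath Q u u =i pred1 x0.
  move=> x; rewrite inE [RHS]inE; apply/esym/eqP/pseq_inj.
  by rewrite (H x) (H x0).
by rewrite /npath (eq_card e) card1.
Qed.

Lemma height_lt u v : v != u -> (0 < npath u v)%N -> (height v < height u)%N.
Proof.
move=> vu /npath_gt0[p pvu]; apply: proper_card; apply/properP; split.
  apply/subsetP => w; rewrite !inE => /npath_gt0[q qw]; apply/npath_gt0.
  by exists (q ++ p); apply: is_path_cat pvu.
exists u; rewrite !inE ?npath_diag //; apply/negP => /npath_gt0[q quv].
have := acyc (is_path_cat quv pvu); case: q quv => //= /eqP uv.
by rewrite uv eqxx in vu.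
Qed.

Lemma pair_entry (mu gamma : 'cV[nat]_n) u :
  (toZ mu - path_mx *m toZ gamma) u 0 =
  (mu u 0)%:Z - (gamma u 0)%:Z - \sum_(v | v != u) (npath u v)%:Z * (gamma v 0)%:Z.
Proof.
rewrite !mxE (bigD1 u) //= !mxE npath_diag mul1r opprD addrA; congr (_ - _).
by apply: eq_bigr => v _; rewrite !mxE.
Qed.

Lemma disjoint_supp (mu gamma : 'cV[nat]_n) : [disjoint supp mu & supp gamma] <->
  forall u, mu u 0 = 0%N \/ gamma u 0 = 0%N.
Proof.
rewrite -setI_eq0; split=> [/eqP/setP H u|H].
  have := H u; rewrite !inE => /negbT; rewrite negb_and !negbK.
  by case/orP => /eqP; [left | right].
by apply/eqP/setP => u; rewrite !inE; case: (H u) => ->; rewrite ?eqxx ?andbF.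
Qed.

(** By induction on the height of u the sum over v != u in pair_entry is known;
    what remains is mu u - gamma u with one of them zero, which determines both. *)
Lemma pair_uniq (mu gamma mu' gamma' : 'cV[nat]_n) :
  [disjoint supp mu & supp gamma] -> [disjoint supp mu' & supp gamma'] ->
  toZ mu - path_mx *m toZ gamma = toZ mu' - path_mx *m toZ gamma' ->
  mu = mu' /\ gamma = gamma'.
Proof.
move=> /disjoint_supp D /disjoint_supp D' E.
suff H u : mu u 0 = mu' u 0 /\ gamma u 0 = gamma' u 0.
  by split; apply/matrixP => u j; rewrite (ord1 j); case: (H u).
have [N] := ubnP (height u); elim: N u => // N IH u hu.
have := congr1 (fun A : 'cV[int]_n => A u 0) E; rewrite /= !pair_entry.
rewrite (eq_bigr (fun v => (npath u v)%:Z * (gamma' v 0)%:Z)); last first.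
  move=> v vu; have [->|np] := posnP (npath u v); first by rewrite !mul0r.
  have [|_ -> //] := IH v; exact: leq_trans (height_lt vu np) hu.
move=> /addIr; case: (D u) (D' u) => e [] e'; rewrite ?e ?e' ?subr0 ?sub0r.
- by move=> /oppr_inj[->].
- by move: (gamma u 0) (mu' u 0) => x y; lia.
- by move: (gamma' u 0) (mu u 0) => x y; lia.
- by move=> [->].
Qed.

(** F computes gamma u from the entries of lower height, so its iterates become
    stationary. *)
Lemma pair_exists (alpha : 'cV[int]_n) : exists mu gamma : 'cV[nat]_n,
  [disjoint supp mu & supp gamma] /\ alpha = toZ mu - path_mx *m toZ gamma.
Proof.
pose z (g : 'cV[nat]_n) u : int := alpha u 0 + \sum_(v | v != u) (npath u v)%:Z * (g v 0)%:Z.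
pose F g : 'cV[nat]_n := \col_u (if (z g u < 0)%R then `|z g u|%N else 0%N).
have [g Hg] : exists g : 'cV[nat]_n, forall u, (height u < n.+1)%N -> g u 0 = F g u 0.
  elim: n.+1 => [|m [g Hg]]; first by exists 0.
  exists (F g) => u hu; rewrite [LHS]mxE [RHS]mxE.
  have -> // : z (F g) u = z g u; congr (_ + _); apply: eq_bigr => v vu.
  have [->|np] := posnP (npath u v); first by rewrite !mul0r.
  by rewrite -Hg //; apply: leq_trans (height_lt vu np) _.
have {}Hg u : g u 0 = F g u 0.
  by apply: Hg; rewrite ltnS (leq_trans (max_card _)) ?card_ord.
pose m : 'cV[nat]_n := \col_u (if (z g u < 0)%R then 0%N else `|z g u|%N).
exists m, g; split.
  by apply/disjoint_supp => u; rewrite Hg !mxE; case: ifP; [left | right].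
apply/matrixP => u j; rewrite (ord1 j) pair_entry; apply/eqP; rewrite eq_sym subr_eq.
rewrite -/(z g u) Hg !mxE; case: ifP => h; apply/eqP; lia.
Qed.

End Paths.

(** * Projective representations *)

Section PathAction.
Variables (k : fieldType) (n : nat) (Q : quiver n).
Notation rep := (rep k Q).
Implicit Types (N M : rep) (u v w : 'I_n) (p : seq (arrow Q)).

(** The end of a path agrees with the source of the next arrow only up to a
    provable equality of vertices. *)
Definition vcast N v u : 'Hom(N v, N u) :=
  match @eqP _ v u with
  | ReflectT e => match e in _ = w return 'Hom(N v, N w) with erefl => \1%VF end
  | ReflectF _ => 0
  end.

Lemma vcastE N v : vcast N v v = \1%VF.
Proof. by rewrite /vcast; case: eqP => // e; rewrite eq_axiomK. Qed.

Lemma vcast0 N v u : v != u -> vcast N v u = 0.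
Proof. by rewrite /vcast; case: eqP. Qed.

Lemma vcast_nat N M (f : rhom N M) v u x : f.|[u] (vcast N v u x) = vcast M v u (f.|[v] x).
Proof.
have [<-|ne] := eqVneq v u; first by rewrite !vcastE !id_lfunE.
by rewrite !vcast0 // !zero_lfunE linear0.
Qed.

(** Defined for all sequences of arrows, and zero if they do not compose: this
    avoids dependent recursion over paths. *)
Fixpoint path_act N (p : seq (arrow Q)) v u : 'Hom(N v, N u) :=
  if p is a :: p' then (path_act N p' (tgt a) u \o (rmap N a \o vcast N v (src a)))%VF
  else vcast N v u.

Lemma path_act_rcons N p a v x :
  path_act N (rcons p a) v (tgt a) x = rmap N a (path_act N p v (src a) x).
Proof.
elim: p v x => [|b p IH] v x /=; first by rewrite vcastE comp_lfunE comp_lfunE id_lfunE.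
by rewrite !comp_lfunE IH.
Qed.

Lemma path_act_nat N M (f : rhom N M) p v u x : f.|[u] (path_act N p v u x) = path_act M p v u (f.|[v] x).
Proof.
elim: p v x => [|a p IH] v x /=; first exact: vcast_nat.
by rewrite !comp_lfunE IH -rhom_nat vcast_nat.
Qed.

Lemma path_act_stable N (U : forall v, {vspace N v}) p v u x :
  (forall a x, x \in U (src a) -> rmap N a x \in U (tgt a)) ->
  x \in U v -> path_act N p v u x \in U u.
Proof.
move=> st; have vc v' u' y : y \in U v' -> vcast N v' u' y \in U u'.
  have [<-|ne] := eqVneq v' u'; first by rewrite vcastE id_lfunE.
  by rewrite vcast0 // zero_lfunE mem0v.
elim: p v x => [|a p IH] v x xU /=; first exact: vc.
by rewrite !comp_lfunE; apply/IH/st/vc.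
Qed.

Hypothesis acyc : acyclic Q.

Definition delta v u (p : qpath Q v u) : proj k Q v u := [ffun q => (q == p)%:R : k].

(** The trivial path, which generates P(v). *)
Definition gen v : proj k Q v v := [ffun q => (pseq q == [::])%:R : k].

Lemma delta_sum v u (x : proj k Q v u) : x = \sum_p x p *: delta p.
Proof.
apply/ffunP => q; rewrite sum_ffunE (bigD1 q) //= !ffunE eqxx.
rewrite big1 => [|p ne]; first by rewrite addr0 /GRing.scale /= mulr1.
by rewrite !ffunE eq_sym (negPf ne) scaler0.
Qed.

Lemma proj_arrow v (a : arrow Q) (x : proj k Q v (src a)) q :
  rmap (proj k Q v) a x q =
  \sum_(p : qpath Q v (src a) | rcons (pseq p) a == pseq q) x p.
Proof. by rewrite /= lfunE /= ffunE. Qed.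

Lemma delta_path_act v u (p : qpath Q v u) : delta p = path_act (proj k Q v) (pseq p) v u (gen v).
Proof.
have [m] := ubnP (size (pseq p)); elim: m u p => // m IH u p sm.
move: sm (pseqP p); move E: (pseq p) => pp; case: (lastP pp) E => [|q a] E sm.
  rewrite /= => /eqP vu; move: p E; rewrite -{u}vu => p E.
  rewrite vcastE id_lfunE; apply/ffunP => q; rewrite !ffunE -E.
  by rewrite (inj_eq (@pseq_inj _ _ _ _)).
rewrite is_path_rcons => /andP[/(pseq_exists acyc)[q' Eq] /eqP ta].
move: p E; rewrite -{u}ta => p E; rewrite path_act_rcons -Eq -IH; last first.
  by move: sm; rewrite size_rcons Eq.
apply/ffunP => r; rewrite proj_arrow ffunE.
rewrite (eq_bigr (fun s => (s == q')%:R)) => [|s _]; last by rewrite ffunE.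
have [->|ne] := eqVneq r p.
  rewrite (bigD1 q') /= ?Eq ?E // eqxx big1 ?addr0 // => s /andP[_ /negPf ->] //.
rewrite big1 // => s /eqP es; case: eqP => // sq; case/eqP: ne.
by apply: pseq_inj; rewrite -es sq Eq E.
Qed.

(** The homomorphism P(v) -> N which sends the generator to x. *)
Definition yoneda_fun N v (x : N v) u (phi : proj k Q v u) : N u :=
  \sum_(p : qpath Q v u) phi p *: path_act N (pseq p) v u x.

Fact yoneda_linear N v (x : N v) u : linear (@yoneda_fun N v x u).
Proof.
move=> c f g; rewrite /yoneda_fun scaler_sumr -big_split; apply: eq_bigr => p _.
by rewrite !ffunE scalerDl scalerA.
Qed.
HB.instance Definition _ N v (x : N v) u :=
  GRing.isLinear.Build k _ _ _ (@yoneda_fun N v x u) (@yoneda_linear N v x u).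

Fact yoneda_subproof N v (x : N v) a :
  (rmap N a \o linfun (@yoneda_fun N v x (src a)) =
   linfun (@yoneda_fun N v x (tgt a)) \o rmap (proj k Q v) a)%VF.
Proof.
apply/lfunP => f; rewrite !comp_lfunE; set g := rmap (proj k Q v) a f.
have gE := proj_arrow f; rewrite -/g in gE.
rewrite !lfunE /= /yoneda_fun linear_sum.
rewrite [RHS](eq_bigr (fun q => \sum_(p : qpath Q v (src a) | rcons (pseq p) a == pseq q)
  f p *: path_act N (rcons (pseq p) a) v (tgt a) x)) => [|q _]; last first.
  transitivity ((\sum_(p : qpath Q v (src a) | rcons (pseq p) a == pseq q) f p) *:
    path_act N (pseq q) v (tgt a) x); first by congr (_ *: _); exact: gE.
  by rewrite scaler_suml; apply: eq_bigr => p /eqP <-.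
rewrite [RHS](exchange_big_dep xpredT) //=; apply: eq_bigr => p _.
rewrite linearZ /= -path_act_rcons.
have [|q0 E0] := @pseq_exists _ _ acyc v (tgt a) (rcons (pseq p) a).
  by rewrite is_path_rcons pseqP eqxx.
rewrite (big_pred1 q0) // => q; rewrite -E0 (inj_eq (@pseq_inj _ _ _ _)).
exact: eq_sym.
Qed.
Definition yoneda N v (x : N v) : rhom (proj k Q v) N :=
  mk_rhom (M := proj k Q v) (f := fun u => linfun (@yoneda_fun N v x u)) (yoneda_subproof x).

Lemma yoneda_gen N v (x : N v) : (yoneda x).|[v] (gen v) = x.
Proof.
rewrite mk_rhomE lfunE /= /yoneda_fun.
have [|p0 E0] := @pseq_exists _ _ acyc v v [::]; first by rewrite /= eqxx.
rewrite (bigD1 p0) //= big1 => [|p ne].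
  by rewrite !ffunE E0 eqxx /= vcastE id_lfunE scale1r addr0.
rewrite ffunE -E0 (inj_eq (@pseq_inj _ _ _ _)) (negPf ne).
by rewrite scale0r.
Qed.

Lemma proj_ext N v (f g : rhom (proj k Q v) N) : f.|[v] (gen v) = g.|[v] (gen v) -> f = g.
Proof.
move=> e; apply: rhom_ext => u x; rewrite (delta_sum x) !linear_sum.
have E (p : qpath Q v u) : f.|[u] (delta p) = g.|[u] (delta p) by rewrite delta_path_act !path_act_nat e.
by apply: eq_bigr => p _; rewrite !linearZ /= E.
Qed.

Lemma proj_projective v : projective (proj k Q v).
Proof.
move=> X Y g h gs; have [x Ex] := rsurjP gs (h.|[v] (gen v)).
by exists (yoneda x); apply: proj_ext; rewrite rcompE comp_lfunE yoneda_gen.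
Qed.

Lemma rsum_projective (I : finType) (F : I -> rep) :
  (forall i, projective (F i)) -> projective (rsum F).
Proof.
move=> H X Y g h gs.
have ch i : exists h', g \c h' == h \c rinj F i.
  by have [h' E] := H i X Y g (h \c rinj F i) gs; exists h'; rewrite E.
exists (\sum_i xchoose (ch i) \c rprj F i).
rewrite rcomp_sumr -[RHS]rcomp1r -rsum_id rcomp_sumr; apply: eq_bigr => i _.
by rewrite !rcompA (eqP (xchooseP (ch i))).
Qed.

Lemma projs_projective g : projective (projs k Q g).
Proof. by apply: rsum_projective => i; apply: proj_projective. Qed.

Lemma retract_projective M N (i : rhom M N) (p : rhom N M) :
  p \c i = rid M -> projective N -> projective M.
Proof.
move=> pi pN X Y g h gs; have [h' E] := pN X Y g (h \c p) gs.
by exists (h' \c i); rewrite rcompA E rcompK.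
Qed.

Lemma proj_dim v u : \dim {:proj k Q v u} = npath Q u v.
Proof. by rewrite dimvf /dim /= muln1. Qed.

Lemma rsum_dim (I : finType) (F : I -> rep) v : \dim {:rsum F v} = (\sum_i \dim {:F i v})%N.
Proof.
have e : dim (rsum F v) = (#|{: {i : I & 'I_(dim (F i v))}}| * 1)%N by [].
rewrite dimvf e muln1 card_tagged sumnE big_map big_enum /=.
by apply: eq_bigr => i _; rewrite card_ord dimvf.
Qed.

Lemma projs_dim_vec g : toZ (dim_vec (projs k Q g)) = path_mx Q *m toZ g.
Proof.
apply/matrixP => u j; rewrite (ord1 j) !mxE rsum_dim.
rewrite (eq_bigr (fun x : {v & 'I_(g v 0)} => npath Q u (tag x))); last first.
  by move=> x _; rewrite proj_dim.
rewrite -(@sig_big_dep _ _ _ _ (fun v => 'I_(g v 0)) xpredT (fun _ => xpredT)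
   (fun v _ => npath Q u v)) /=.
rewrite (big_morph Posz PoszD (erefl _)); apply: eq_bigr => v _.
by rewrite sum_nat_const card_ord !mxE mulnC PoszM.
Qed.

Definition pgen (g : 'cV[nat]_n) v (z : 'I_(g v 0)) : projs k Q g v :=
  (rinj (fun x : {v : 'I_n & 'I_(g v 0)} => proj k Q (tag x))
    (Tagged (fun v => 'I_(g v 0)) z)).|[v] (gen v).

(** P(g) is free on the generators pgen; this and the next two lemmas are used
    instead of the summands of P(g). *)
Lemma projs_hom (g : 'cV[nat]_n) N (y : forall v, 'I_(g v 0) -> N v) :
  exists f : rhom (projs k Q g) N, forall v z, f.|[v] (pgen z) = y v z.
Proof.
pose F := fun x : {v : 'I_n & 'I_(g v 0)} => proj k Q (tag x).
exists (\sum_i yoneda (y (tag i) (tagged i)) \c rprj F i) => v z.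
pose i := Tagged (fun v => 'I_(g v 0)) z.
rewrite -comp_lfunE -rcompE rcomp_suml (bigD1 i) //= big1 => [|j ne].
  by rewrite addr0 (rcompK _ (rprj_inj F i)) yoneda_gen.
by rewrite eq_sym in ne; rewrite (rcompK0 _ (rprj_inj0 F ne)).
Qed.

Lemma projs_span (g : 'cV[nat]_n) (U : forall u, {vspace projs k Q g u}) :
  (forall a x, x \in U (src a) -> rmap (projs k Q g) a x \in U (tgt a)) ->
  (forall v (z : 'I_(g v 0)), pgen z \in U v) -> forall u x, x \in U u.
Proof.
move=> st gU u x; pose F := fun x : {v : 'I_n & 'I_(g v 0)} => proj k Q (tag x).
have -> : x = \sum_i (rinj F i).|[u] ((rprj F i).|[u] x).
  rewrite -[LHS]id_lfunE -ridE -rsum_id at_sum sum_lfunE.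
  by apply: eq_bigr => i _; rewrite rcompE comp_lfunE.
apply: memv_suml => -[v z] _; set i := existT _ _ _.
rewrite [X in _.|[_] X](delta_sum ((rprj F i).|[u] x)) linear_sum.
apply: memv_suml => p _; rewrite linearZ /= memvZ //.
have -> : (rinj F i).|[u] (delta p) = path_act (rsum F) (pseq p) v u (pgen z).
  by rewrite delta_path_act path_act_nat.
exact: (@path_act_stable (rsum F) U (pseq p) v u _ st (gU v z)).
Qed.

Lemma projs_ext (g : 'cV[nat]_n) N (f h : rhom (projs k Q g) N) :
  (forall v (z : 'I_(g v 0)), f.|[v] (pgen z) = h.|[v] (pgen z)) -> f = h.
Proof.
move=> H; apply: rinj_ext => -[v z]; apply: proj_ext.
by rewrite !rcompE !comp_lfunE; exact: H.
Qed.

Lemma enough_projectives M : exists g, exists p : rhom (projs k Q g) M, rsurjective p.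
Proof.
pose g := dim_vec M.
have dE v : (g v 0%R = \dim {:M v})%N by rewrite dim_vecE.
have [p Hp] := @projs_hom g M (fun v (z : 'I_(g v 0)) => (vbasis {:M v})`_z).
exists g, p => v; apply/eqP; rewrite eqEsubv subvf /=.
rewrite -(span_basis (vbasisP {:M v})); apply/span_subvP => y /(nthP 0)[j].
rewrite size_tuple => jv <-; have jg : (j < g v 0%R)%N by rewrite dE.
have := Hp v (Ordinal jg); rewrite /= => <-.
by rewrite memv_img ?memvf.
Qed.

Lemma ext_isP (b c : 'cV[nat]_n) : ext_is k Q b c 0 <->
  exists B C : rep, [/\ dim_vec B = b, dim_vec C = c & ext0 B C].
Proof.
split=> [[[B [C [dB dC /ext1_dim0_ext0 e]]] _]|[B [C [dB dC e]]]]; first by exists B, C.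
split=> //; exists B, C; split=> //.
have [g [p ps]] := enough_projectives B.
have [K [i [ii im]]] := kernel_exists p.
apply: (ext0_ext1_dim (i := i) (p := p)) e; first exact: projs_projective.
by split.
Qed.

End PathAction.

(** * Canonical decompositions and generic types *)

Section Canonical.
Variables (k : closedFieldType) (n : nat) (Q : quiver n).
Notation rep := (rep k Q).
Notation zr := (zero_rep k Q).
Hypothesis acyc : acyclic Q.
Implicit Types (betas : seq 'cV[nat]_n) (gamma : 'cV[nat]_n).

Lemma common_nonzero (W : vectType k) (I : finType) (d : I -> W -> k) :
  (forall i, polyfun (d i)) -> (forall i, exists x, d i x != 0) -> exists x, forall i, d i x != 0.
Proof.
move=> pd nz.
have nD i : ~ dense (fun x => d i x = 0).
  by move=> D; have [x /eqP] := nz i; apply; apply: D.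
have /for_generalP[f [_ [x fx] H]] := general_avoid nD.
by exists x => i; apply/eqP/H.
Qed.

(** Each ext_is provides its own pair of representations; since vanishing of Ext
    is open, one point of the product of the representation spaces serves all
    pairs. *)
Lemma simultaneous_ext0 betas :
  (forall i j : 'I_(size betas), i != j -> ext_is k Q betas`_i betas`_j 0) ->
  exists s : seq rep, dim_vecs s = betas /\
    forall i j, (i < size s)%N -> (j < size s)%N -> i != j -> ext0 (nth zr s i) (nth zr s j).
Proof.
move=> H; pose m := size betas.
pose V (i : 'I_m) : vectType k := rep_space k Q betas`_i.
pose W : vectType k := dprod V.
have P (i : 'I_m) : polymap (fun w : W => dapp w i).
  apply: (@polymapL _ _ _ _ (@id W) (fun w : W => dapp w i)); last exact: polymap_id.
  by move=> c u v; rewrite dprodD dprodZ.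
have D (p : 'I_m * 'I_m) : exists d : W -> k, [/\ polyfun d, exists w, d w != 0 &
    p.1 != p.2 -> forall w, d w != 0 -> ext0 (rep_of (dapp w p.1)) (rep_of (dapp w p.2))].
  have [_|ij] /= := eqVneq p.1 p.2.
    by exists (fun=> 1); split=> //; [exact: polyfunC | exists 0; apply: oner_neq0].
  have /(ext_isP _ acyc)[B [C [dB dC e]]] := H _ _ ij.
  have [x Bx] := rep_of_exists_dim dB; have [y Cy] := rep_of_exists_dim dC.
  pose w0 : W := dmk (@dfwith _ V (@dfwith _ V (fun l => 0) p.1 x) p.2 y).
  have w01 : dapp w0 p.1 = x.
    by rewrite dmkE dfwith_out 1?eq_sym // dfwith_in.
  have w02 : dapp w0 p.2 = y by rewrite dmkE dfwith_in.
  have [|d [pd dw0 Hd]] := @ext0_semicont k n Q W _ _ _ _ (P p.1) (P p.2) w0.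
    rewrite w01 w02; exact: ext0_iso (riso_sym Bx) (riso_sym Cy) e.
  by exists d; split=> //; exists w0.
have /fin_all_exists[d Hd] := D.
have [|i|w Hw] := @common_nonzero W _ d; [by move=> i; case: (Hd i) | by case: (Hd i) |].
pose s := [seq rep_of (dapp w i) | i <- enum 'I_m].
have sz : size s = m by rewrite size_map size_enum_ord.
have nths (i : 'I_m) : nth zr s i = rep_of (dapp w i).
  by rewrite (nth_map i) ?size_enum_ord // nth_ord_enum.
exists s; split.
  apply: (@eq_from_nth _ 0); rewrite size_map sz // => i im.
  by rewrite (nth_map zr) ?sz // (nths (Ordinal im)) dim_rep_of.
rewrite sz => i j im jm ij; rewrite (nths (Ordinal im)) (nths (Ordinal jm)).
by case: (Hd (Ordinal im, Ordinal jm)) => _ _; apply.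
Qed.

Lemma dims_dim_vecs (s : seq rep) : dims s = \sum_(b <- dim_vecs s) b.
Proof. by rewrite /dims big_map. Qed.

Lemma toZ_sum (I : Type) (r : seq I) (F : I -> 'cV[nat]_n) :
  toZ (\sum_(i <- r) F i) = \sum_(i <- r) toZ (F i).
Proof.
elim: r => [|i r IH]; first by rewrite !big_nil; apply/matrixP => u j; rewrite !mxE.
by rewrite !big_cons -IH; apply/matrixP => u j; rewrite !mxE PoszD.
Qed.

Lemma disjoint_sum betas gamma :
  (forall b, b \in betas -> [disjoint supp b & supp gamma]) <->
  [disjoint supp (\sum_(b <- betas) b) & supp gamma].
Proof.
split=> [H|/disjoint_supp H b bs].
  apply/disjoint_supp => u; have [->|gu] := eqVneq (gamma u 0) 0%N; [by right | left].
  rewrite summxE big_seq big1 // => b /H/disjoint_supp/(_ u)[//|g0].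
  by rewrite g0 eqxx in gu.
apply/disjoint_supp => u; case: (H u) => [|->]; last by right.
by rewrite summxE (big_rem b) //=; left; lia.
Qed.

(** The two choices in a decomposition of alpha, separated: the pair (mu, gamma)
    depends on alpha alone, and then the list on mu. *)
Theorem canonical_decompositionP alpha betas gamma :
  canonical_decomposition k Q alpha betas gamma <->
  [/\ [disjoint supp (\sum_(b <- betas) b) & supp gamma],
      alpha = toZ (\sum_(b <- betas) b) - path_mx Q *m toZ gamma
    & exists s : seq rep, rigid_list s /\ dim_vecs s = betas].
Proof.
split=> [[aE dis e sr]|[dis aE [s [[e sr] ds]]]].
  split; first exact/disjoint_sum; first by rewrite aE inv_euler // toZ_sum.
  have [s [ds es]] := simultaneous_ext0 e; exists s; split=> //; split=> // i si.
  by apply: sr; rewrite -ds -(nth_map zr 0) // mem_nth // size_map.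
have sz : size s = size betas by rewrite -ds size_map.
have nthb i : (i < size betas)%N -> betas`_i = dim_vec (nth zr s i).
  by move=> ib; rewrite -ds (nth_map zr) // sz.
split; first by rewrite aE inv_euler // toZ_sum.
- exact/disjoint_sum.
- move=> i j ij; apply/(ext_isP _ acyc); exists (nth zr s i), (nth zr s j).
  by rewrite !nthb //; split=> //; apply: e; rewrite // sz.
move=> b /(nthP 0)[i ib <-]; rewrite nthb //; apply: sr; by rewrite sz.
Qed.

Theorem canonical_decomposition_exists alpha :
  exists betas gamma, canonical_decomposition k Q alpha betas gamma.
Proof.
have [mu [gamma [dis aE]]] := pair_exists acyc alpha.
have [s [ds e sr]] := kac_exists k Q mu.
exists (dim_vecs s), gamma; apply/canonical_decompositionP.
by rewrite -dims_dim_vecs ds; split=> //; exists s.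
Qed.

Lemma canonical_type alpha betas gamma : canonical_decomposition k Q alpha betas gamma ->
  forall b, b = \sum_(c <- betas) c -> dense (@has_type k n Q b betas).
Proof.
move=> /canonical_decompositionP[_ _ [s [rs <-]]] b ->; apply: rigid_dense => //.
by rewrite dims_dim_vecs.
Qed.

Theorem canonical_decomposition_uniq alpha betas gamma betas' gamma' :
  canonical_decomposition k Q alpha betas gamma ->
  canonical_decomposition k Q alpha betas' gamma' ->
  perm_eq betas' betas /\ gamma' = gamma.
Proof.
move=> H H'; have D := canonical_type H; have D' := canonical_type H'.
move: H H' => /canonical_decompositionP[d aE _] /canonical_decompositionP[d' aE' _].
have [|mE gE] := pair_uniq acyc d' d; first by rewrite -aE -aE'.
split=> //; exact: dense_type_uniq (D' _ (esym mE)) (D _ (erefl _)).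
Qed.

End Canonical.

(** * The general presentation *)

Section ProductMaps.
Variables (k : fieldType) (I : finType) (V : I -> vectType k).

Lemma dapp_sum (J : Type) (r : seq J) (F : J -> dprod V) i :
  dapp (\sum_(j <- r) F j) i = \sum_(j <- r) dapp (F j) i.
Proof.
exact: (big_morph (fun x : dprod V => dapp x i) (fun x y => dprodD x y i) (dmkE _ i)).
Qed.

Lemma polymap_dmk (W : vectType k) (F : forall i, W -> V i) :
  (forall i, polymap (F i)) -> polymap (fun w => dmk (fun i => F i w) : dprod V).
Proof.
move=> H; pose em i (x : V i) : dprod V := dmk (@dfwith _ V (fun=> 0) i x).
apply: (@polymap_ext _ _ _ (fun w => \sum_i em i (F i w))) => [w|].
  apply/dprodP => i; rewrite dapp_sum (bigD1 i) //= big1 => [|j ji].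
    by rewrite addr0 !dmkE dfwith_in.
  by rewrite dmkE dfwith_out.
apply: polymap_sum => i; apply: (@polymapL _ _ _ _ (F i) (em i)) (H i) => c x y.
apply/dprodP => j; rewrite dprodD dprodZ !dmkE.
have [<-|ij] := eqVneq i j; first by rewrite !dfwith_in.
by rewrite !dfwith_out // scaler0 addr0.
Qed.

End ProductMaps.

Section Presentation.
Variables (k : closedFieldType) (n : nat) (Q : quiver n).
Notation rep := (rep k Q).
Hypothesis acyc : acyclic Q.

Notation pgen z := (pgen k Q z).

(** Defined on generators, so that no isomorphism of index types is needed. *)
Lemma projs_split (g g' h : 'cV[nat]_n) : (forall v, h v 0 = (g v 0%R + g' v 0%R)%N) ->
  exists i1 i2 p1 p2, @biprod _ _ _ (projs k Q h) (projs k Q g) (projs k Q g') i1 i2 p1 p2.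
Proof.
move=> hE.
have [i1 H1] := @projs_hom _ _ _ acyc g (projs k Q h)
  (fun v x => pgen (cast_ord (esym (hE v)) (lshift _ x))).
have [i2 H2] := @projs_hom _ _ _ acyc g' (projs k Q h)
  (fun v x => pgen (cast_ord (esym (hE v)) (rshift _ x))).
have [p1 K1] := @projs_hom _ _ _ acyc h (projs k Q g) (fun v x =>
  if split (cast_ord (hE v) x) is inl z then pgen z else 0).
have [p2 K2] := @projs_hom _ _ _ acyc h (projs k Q g') (fun v x =>
  if split (cast_ord (hE v) x) is inr z then pgen z else 0).
exists i1, i2, p1, p2; split; apply: (projs_ext acyc) => v x.
- rewrite rcompE comp_lfunE ridE id_lfunE H1 K1 cast_ordKV.
  by rewrite (unsplitK (inl _ x)).
- rewrite rcompE comp_lfunE ridE id_lfunE H2 K2 cast_ordKV.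
  by rewrite (unsplitK (inr _ x)).
rewrite atD add_lfunE !rcompE !comp_lfunE ridE id_lfunE K1 K2.
have : x = cast_ord (esym (hE v)) (unsplit (split (cast_ord (hE v) x))).
  by rewrite splitK cast_ordK.
case: (split _) => z /= ->; first by rewrite linear0 addr0 H1.
by rewrite linear0 add0r H2.
Qed.

Lemma hom_projs_disjoint g M : [disjoint supp (dim_vec M) & supp g] ->
  forall f : rhom (projs k Q g) M, f = 0.
Proof.
move=> /disjoint_supp D f; apply: (projs_ext acyc) => v x.
rewrite at0 zero_lfunE; case: (D v) => [d0|g0].
  have /dim0P H : \dim {:M v} = 0%N by rewrite -dim_vecE.
  exact: H.
by exfalso; move: (valP x); move: (val x) => y /=; rewrite g0.
Qed.

Variable mu : 'cV[nat]_n.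
(** mu - E^t mu, written with natural numbers. *)
Definition kappa : 'cV[nat]_n := \col_v (\sum_(a : arrow Q | tgt a == v) mu (src a) 0%R)%N.
Notation P0 := (projs k Q mu).
Notation K := (projs k Q kappa).
Notation Mv v := ('rV[k]_(mu v 0)).

(** The inclusion of the span of the generators of P(mu). *)
Definition gens_fun v (x : Mv v) : P0 v :=
  \sum_j x 0 j *: pgen j.

Fact gens_linear v : linear (@gens_fun v).
Proof.
move=> c x y; rewrite /gens_fun scaler_sumr -big_split; apply: eq_bigr => j _.
by rewrite !mxE scalerDl scalerA.
Qed.
HB.instance Definition _ v := GRing.isLinear.Build k _ _ _ (@gens_fun v) (@gens_linear v).

Definition gens v : 'Hom(Mv v, P0 v) := linfun (@gens_fun v).

Lemma gens_delta v j : gens v (delta_mx 0 j) = pgen j.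
Proof.
rewrite lfunE /= /gens_fun (bigD1 j) //= big1 => [|i ij].
  by rewrite mxE !eqxx scale1r addr0.
by rewrite mxE eqxx (negPf ij) scale0r.
Qed.

(** When the generators together with the image of f span P0 at every vertex,
    the cokernel of f lives on the span of the generators. *)
Lemma cokernel_rep (f : rhom K P0) (e : forall v, 'Hom(P0 v, Mv v)) :
  rinjective f -> (forall v x y, e v (gens v x + f.|[v] y) = x) ->
  (forall v z, exists x y, z = gens v x + f.|[v] y) ->
  exists e' : rhom P0 (rep_of (dmk (fun a =>
     (e (tgt a) \o rmap P0 a \o gens (src a))%VF) : rep_space k Q mu)), short_exact f e'.
Proof.
move=> fi eK sp; set w : rep_space k Q mu := dmk _.
have wE a x : rmap (rep_of w) a x = e (tgt a) (rmap P0 a (gens (src a) x)).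
  by have -> : rmap (rep_of w) a = (e (tgt a) \o rmap P0 a \o gens (src a))%VF;
    rewrite ?comp_lfunE //; apply: dmkE.
have ef v y : e v (f.|[v] y) = 0.
  by have := eK v 0 y; rewrite linear0 add0r.
have C a : (rmap (rep_of w) a \o e (src a) = e (tgt a) \o rmap P0 a)%VF.
  apply/lfunP => z; rewrite !comp_lfunE wE.
  have [x [y ->]] := sp (src a) z; rewrite eK linearD /= (rhom_nat f).
  by rewrite [RHS]linearD /= ef addr0.
exists (mk_rhom (M := P0) (N := rep_of w) (f := e) C); split=> //.
  apply: rsurjPn => v x; exists (gens v x); rewrite mk_rhomE.
  by have := eK v x 0; rewrite linear0 addr0.
move=> v; apply/eqP; rewrite eqEsubv mk_rhomE; apply/andP; split; apply/subvP => z.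
  by case/memv_imgP => y _ ->; rewrite memv_ker ef.
rewrite memv_ker; have [x [y ->]] := sp v z; rewrite eK => /eqP ->.
by rewrite linear0 add0r memv_img ?memvf.
Qed.

Lemma toZ_kappa : toZ kappa = toZ mu - (euler_mx Q)^T *m toZ mu.
Proof.
apply/matrixP => v j; rewrite (ord1 j) !mxE.
rewrite [in RHS](bigD1 v) //= !mxE eqxx mul1r opprD addrA subrr add0r -sumrN.
rewrite (partition_big (fun a => src a) (fun u => u != v)) /=; last first.
  by move=> a /eqP <-; apply: no_loop.
rewrite (big_morph Posz PoszD (erefl _)); apply: eq_bigr => u uv.
rewrite !mxE (negPf uv) mulNr opprK.
rewrite (eq_bigr (fun=> mu u 0)) => [|a /andP[_ /eqP ->] //].
rewrite sum_nat_const PoszM; congr (Posz _ * _); apply: eq_card => a.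
by rewrite !inE andbC.
Qed.

Lemma kappa_dim v : \dim {: (Mv v * K v)%type} = \dim {:P0 v}.
Proof.
have H : toZ (dim_vec P0) = toZ mu + toZ (dim_vec K).
  rewrite !projs_dim_vec // toZ_kappa mulmxBr mulmxA path_euler // mul1mx.
  by rewrite addrC subrK.
have := congr1 (fun A : 'cV[int]_n => A v 0) H; rewrite !mxE -PoszD => -[->].
have e : dim (Mv v) = mu v 0 by rewrite /dim /= mul1n.
by rewrite !dimvf; exact: (congr1 (fun x => (x + dim (K v))%N) e).
Qed.

Notation Hop f v := ((gens v \o linfun fst) + ((f).|[v] \o linfun snd))%VF.

Lemma HopE (f : rhom K P0) v (x : (Mv v * K v)%type) :
  Hop f v x = gens v x.1 + f.|[v] x.2.
Proof. by rewrite add_lfunE !comp_lfunE !lfunE. Qed.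

(** The standard presentation of w: P(kappa) has a generator for each arrow a and
    each basis vector j at its source, and it goes to a.j - w_a(j). *)
Lemma std_presentation (w : rep_space k Q mu) : exists f : rhom K P0,
  (forall v, lker (Hop f v) = 0%VS) /\
  forall a x, exists y, rmap P0 a (gens (src a) x) = gens (tgt a) (w a x) + f.|[tgt a] y.
Proof.
pose S := {a : arrow Q & 'I_(mu (src a) 0)}.
pose A v := [set x : S | tgt (tag x) == v].
have cA v : kappa v 0 = #|A v|.
  rewrite mxE -sum1_card (eq_bigl (fun x : S => (tgt (tag x) == v) && true)); last first.
    by move=> x; rewrite inE andbT.
  rewrite -(@sig_big_dep _ _ _ _ (fun a : arrow Q => 'I_(mu (src a) 0)) (fun a => tgt a == v)
    (fun _ => xpredT) (fun _ _ => 1%N)) /=.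
  by apply: eq_bigr => a _; rewrite sum1_card card_ord.
pose y (x : S) : P0 (tgt (tag x)) :=
  rmap P0 (tag x) (gens _ (delta_mx 0 (tagged x))) - gens _ (w (tag x) (delta_mx 0 (tagged x))).
pose E v (z : 'I_(kappa v 0)) : S := enum_val (cast_ord (cA v) z).
have [f Hf] := @projs_hom _ _ _ acyc kappa P0
  (fun v z => vcast P0 (tgt (tag (E v z))) v (y (E v z))).
have rel (x : S) : exists z, f.|[tgt (tag x)] z = y x.
  pose v := tgt (tag x); have xA : x \in A v by rewrite inE.
  pose z := cast_ord (esym (cA v)) (enum_rank_in xA x).
  have Ez : E v z = x by rewrite /E cast_ordKV enum_rankK_in.
  by exists (pgen z); rewrite Hf Ez vcastE id_lfunE.
have relx a x : exists z, rmap P0 a (gens (src a) x) = gens (tgt a) (w a x) + f.|[tgt a] z.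
  have /fin_all_exists[z Hz] : forall j, exists z,
      f.|[tgt a] z = y (Tagged (fun a => 'I_(mu (src a) 0)) j) 
    by move=> j; exact: (rel (Tagged (fun a => 'I_(mu (src a) 0)) j)).
  exists (\sum_j x 0 j *: z j).
  have xE : x = \sum_j x 0 j *: delta_mx 0 j by rewrite {1}[x]row_sum_delta.
  rewrite {1 2}xE !linear_sum -big_split; apply: eq_bigr => j _.
  by rewrite !linearZ /= Hz /y /= -scalerDr addrC subrK.
exists f; split=> // v.
have : limg (Hop f v) = fullv.
  apply/eqP; rewrite eqEsubv subvf; apply/subvP => z _.
  apply: (projs_span acyc (U := fun v => limg (Hop f v))) => [a _ /memv_imgP[[x u] _ ->]|u j].
    rewrite HopE /= linearD /=; have [t ->] := relx a x; rewrite (rhom_nat f) -addrA -linearD /=.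
    by rewrite -(HopE f (w a x, _)) memv_img ?memvf.
  by rewrite -(gens_delta j) -[gens _ _]addr0 -(linear0 f.|[u]) -(HopE f (_, 0)) memv_img ?memvf.
move=> full; apply/eqP; rewrite -dimv_eq0.
have := limg_ker_dim (Hop f v) fullv; rewrite capfv full kappa_dim.
by move/eqP; rewrite -[X in _ == X]add0n eqn_add2r.
Qed.

(** Inverting the family Hop is rational in f, with a common denominator D; so
    the cokernel of f, written in the basis of the generators, is a rational
    function of f which takes every value of the representation space. *)
Theorem general_cokernel betas g1 (i1 : rhom K (projs k Q g1)) (p1 : rhom (projs k Q g1) K) :
  p1 \c i1 = rid K -> dense (@has_type k n Q mu betas) ->
  for_general (fun f : pres_space k Q mu g1 => exists M (e : rhom P0 M),
    [/\ decomp M betas, dim_vec M = mu & short_exact (f \c i1) e]).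
Proof.
move=> pi /dense_type_general/for_generalP[q [pq [w0 qw0] Hq]].
have [f0 [inj0 rel0]] := std_presentation w0.
pose W := pres_space k Q mu g1; pose h0 : W := f0 \c p1.
have h0i : h0 \c i1 = f0 by rewrite /h0 -rcompA pi rcomp1r.
pose G v (f : W) := Hop (f \c i1) v.
have GE v f (x : (Mv v * K v)%type) : G v f x = gens v x.1 + (f \c i1).|[v] x.2 by exact: HopE.
have pG v : polymap (G v).
  apply: polymapD; first exact: polymapC.
  apply: (@polymapL _ _ _ _ (@id W) (fun f : W => ((f \c i1).|[v] \o linfun snd)%VF)); last exact: polymap_id.
  by move=> c f g; rewrite rcompDl rcompZl atD atZ comp_lfunDl -comp_lfunZl.
have inv v : exists dJ : (W -> k) * (W -> 'Hom(P0 v, (Mv v * K v)%type)),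
    [/\ polyfun dJ.1, dJ.1 h0 != 0, polymap dJ.2, forall f, (G v f \o dJ.2 f)%VF = dJ.1 f *: \1%VF
      & forall f, dJ.1 f != 0 -> (dJ.2 f \o G v f)%VF = dJ.1 f *: \1%VF].
  have [|d [J H]] := inv_family (w0 := h0) (pG v) (kappa_dim v); last by exists (d, J).
  by rewrite /G h0i inj0.
have /fin_all_exists[dJ HdJ] := inv.
pose d v := (dJ v).1; pose J v := (dJ v).2.
pose D f := \prod_v d v f.
pose J' v f := (\prod_(u | u != v) d u f) *: J v f.
have pd v : polyfun (d v) by case: (HdJ v).
have pD : polyfun D by apply: polyfun_prod.
have DE v f : D f = (\prod_(u | u != v) d u f) * d v f by rewrite mulrC /D (bigD1 v).
have GJ v f : (G v f \o J' v f)%VF = D f *: \1%VF.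
  by case: (HdJ v) => _ _ _ e _; rewrite -comp_lfunZr e scalerA -DE.
have JG v f : D f != 0 -> (J' v f \o G v f)%VF = D f *: \1%VF.
  rewrite (DE v) mulf_eq0 negb_or => /andP[_ dn].
  by case: (HdJ v) => _ _ _ _ e; rewrite -comp_lfunZl e // scalerA.
pose num v f : 'Hom(P0 v, Mv v) := (linfun fst \o J' v f)%VF.
have pnum v : polymap (num v).
  apply: (@polymapL _ _ _ _ (J' v) (fun h => (linfun fst \o h)%VF)).
    by move=> c g h; rewrite comp_lfunDr -comp_lfunZr.
  by apply: polymapZ; [apply: polyfun_prod | case: (HdJ v)].
have numG v f x : D f != 0 -> num v f (G v f x) = D f *: x.1.
  move=> Df; rewrite comp_lfunE -[J' v f _]comp_lfunE JG // scale_lfunE id_lfunE.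
  by rewrite lfunE.
pose E : vectType k := dprod (fun v => 'Hom(P0 v, Mv v) : vectType k).
pose wn (e : E) : rep_space k Q mu :=
  dmk (fun a => (e (tgt a) \o rmap P0 a \o gens (src a))%VF).
have wnE e a : wn e a = (e (tgt a) \o rmap P0 a \o gens (src a))%VF by exact: dmkE.
have wn_lin : linear wn.
  move=> c x y; apply/dprodP => a; rewrite dprodD dprodZ !wnE dprodD dprodZ.
  by rewrite !comp_lfunDl -!comp_lfunZl.
have pnums : polymap (fun f => dmk (fun v => num v f) : E) by apply: polymap_dmk.
have pF := polymapL wn_lin pnums.
have [r [m [pr Er]]] := polyfun_frac pq pD pF.
have wE f : (D f)^-1 *: wn (dmk (fun v => num v f)) = dmk (fun a =>
    ((D f)^-1 *: num (tgt a) f \o rmap P0 a \o gens (src a))%VF) :> rep_space k Q mu.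
  by apply/dprodP => b; rewrite dprodZ wnE !dmkE -!comp_lfunZl.
apply/for_generalP; exists (fun f => D f * r f); split; first exact: polyfunM.
  have D0 : D h0 != 0 by apply/prodf_neq0 => v _; case: (HdJ v).
  exists h0; rewrite mulf_neq0 // Er // mulf_neq0 ?expf_neq0 //.
  set w := _ *: _; suff -> : w = w0 by [].
  apply/dprodP => a; apply/lfunP => x; rewrite /w dprodZ scale_lfunE wnE dmkE 2!comp_lfunE.
  have [y ->] := rel0 a x; rewrite -h0i -(GE _ _ (w0 a x, y)) numG //.
  by rewrite scalerA mulVf // scale1r.
move=> f; rewrite mulf_eq0 negb_or => /andP[Df].
rewrite Er // mulf_eq0 negb_or => /andP[_ /Hq ty].
have inj : rinjective (f \c i1).
  apply: rinjPn => v x y e; have JGx z := congr1 (fun h : 'End(_) => h z) (JG v f Df).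
  have := JGx (0, x); have := JGx (0, y).
  rewrite !comp_lfunE !GE /= e => ->; rewrite !scale_lfunE !id_lfunE.
  by move=> /(scalerI Df)[].
have [||e ex] := cokernel_rep (e := fun v => (D f)^-1 *: num v f) inj.
- move=> v x y; rewrite -(GE _ _ (x, y)) scale_lfunE numG //.
  by rewrite scalerA mulVf // scale1r.
- move=> v z; exists ((D f)^-1 *: (J' v f z)).1, ((D f)^-1 *: (J' v f z)).2.
  rewrite -GE linearZ /= -comp_lfunE GJ scale_lfunE id_lfunE scalerA mulVf //.
  by rewrite scale1r.
rewrite wE in ty; exists (rep_of (dmk (fun a =>
  ((D f)^-1 *: num (tgt a) f \o rmap P0 a \o gens (src a))%VF) : rep_space k Q mu)), e.
by split=> //; apply: dim_rep_of.
Qed.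

(** Since the modules of dimension vector mu receive no nonzero map from
    P(gamma), the splitting of P1 can be chosen such that the general f vanishes
    on the complement of P(kappa). *)
Theorem general_presentation betas gamma g1 :
  [disjoint supp mu & supp gamma] -> toZ g1 = toZ kappa + toZ gamma ->
  dense (@has_type k n Q mu betas) ->
  for_general (fun f : pres_space k Q mu g1 =>
    exists i1 i2 p1 p2 M (e : rhom P0 M),
    [/\ @biprod _ _ _ (projs k Q g1) K (projs k Q gamma) i1 i2 p1 p2, f \c i2 = 0,
        decomp M betas & short_exact (f \c i1) e]).
Proof.
move=> dis g1E D.
have g1E' v : g1 v 0 = (kappa v 0%R + gamma v 0%R)%N.
  by have := congr1 (fun A : 'cV[int]_n => A v 0) g1E; rewrite !mxE -PoszD => -[].
have [i1 [i2 [p1 [p2 H]]]] := projs_split g1E'; have [h1 h2 h] := H.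
have [h12 h21] := biprod0 H.
have /for_generalP[d [pd nz Hd]] := general_cokernel h1 D.
apply/for_generalP; exists d; split=> // f /Hd[M [e [dM vM ex]]].
have [|y fy] := exact_factor_r (f := f \c i2) ex.
  by apply: hom_projs_disjoint; rewrite vM.
exists i1, (i2 - i1 \c y), (p1 + y \c p2), p2, M, e; split=> //.
  split.
  - by rewrite rcompDl h1 -rcompA h21 rcomp0r addr0.
  - by rewrite rcompBr h2 rcompA h21 rcomp0l subr0.
  - by rewrite rcompDr rcompBl !rcompA -addrA [X in _ + X]addrC subrK.
by rewrite rcompBr rcompA fy subrr.
Qed.

End Presentation.

(** * Minimal resolutions and homotopy equivalence *)

Section Embedding.
Variables (k : fieldType) (n : nat) (Q : quiver n) (I J : finType) (A : I -> rep k Q).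
Variable phi : J -> I.

Definition rsum_incl : rhom (rsum (fun j => A (phi j))) (rsum A) :=
  \sum_j rinj A (phi j) \c rprj (fun j => A (phi j)) j.

Definition rsum_restr : rhom (rsum A) (rsum (fun j => A (phi j))) :=
  rtuple (fun j => rprj A (phi j)).

Lemma rprj_incl j : injective phi -> rprj A (phi j) \c rsum_incl = rprj _ j.
Proof.
move=> ip; rewrite rcomp_sumr (bigD1 j) //= rcompA rprj_inj rcomp1l big1 ?addr0 // => l lj.
by rewrite rcompA rprj_inj0 ?rcomp0l // (inj_eq ip).
Qed.

Lemma rprj_incl0 i : (forall j, phi j != i) -> rprj A i \c rsum_incl = 0.
Proof.
by move=> H; rewrite rcomp_sumr big1 // => j _; rewrite rcompA rprj_inj0 // rcomp0l.
Qed.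

Lemma restr_incl : injective phi -> rsum_restr \c rsum_incl = rid _.
Proof.
move=> ip; apply: rprj_ext => j.
by rewrite rcompA rprj_tuple rprj_incl // rcomp1r.
Qed.

End Embedding.

Section Resolutions.
Variables (k : fieldType) (n : nat) (Q : quiver n).
Notation rep := (rep k Q).
Implicit Types A B K L M N P X Y : rep.

Lemma rsum_sumtype (J Y : finType) (A : J + Y -> rep) :
  biprod (rsum_incl A inl) (rsum_incl A inr) (rsum_restr A inl) (rsum_restr A inr).
Proof.
have il : injective (@inl J Y) by move=> ? ? [].
have ir : injective (@inr J Y) by move=> ? ? [].
split; [exact: restr_incl | exact: restr_incl | apply: rprj_ext => -[j|y]].
  rewrite rcompDr !rcompA rprj_incl // rprj_incl0 // rcomp0l addr0.
  by rewrite rcomp1r; exact: (rprj_tuple (fun j => rprj A (inl j)) j).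
rewrite rcompDr !rcompA rprj_incl // rprj_incl0 // rcomp0l add0r.
by rewrite rcomp1r; exact: (rprj_tuple (fun y => rprj A (inr y)) y).
Qed.

Lemma rsum_ord_recl m (A : 'I_m.+1 -> rep) :
  bisum (rsum A) (A ord0) (rsum (fun j => A (lift ord0 j))).
Proof.
exists (rinj A ord0), (rsum_incl A (lift ord0)), (rprj A ord0), (rsum_restr A (lift ord0)).
have il : injective (@lift m.+1 ord0) by exact: lift_inj.
split; [exact: rprj_inj | exact: restr_incl |].
apply: rprj_ext => i; rewrite rcompDr !rcompA rcomp1r.
case: (unliftP ord0 i) => [j|] ->.
  by rewrite rprj_inj0 // rcomp0l add0r rprj_incl // rprj_tuple.
rewrite rprj_inj rcomp1l rprj_incl0 ?rcomp0l ?addr0 //.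
Qed.

(** The comparison of projective resolutions, in length one: lift the identity
    of M both ways, and factor the defects through the kernels. *)
Lemma resolution_homotopy K P0 L D0 M (f : rhom K P0) (e : rhom P0 M) (g : rhom L D0)
    (e' : rhom D0 M) : projective P0 -> projective D0 ->
  short_exact f e -> short_exact g e' -> homotopy_equiv (Cplx f) (Cplx g).
Proof.
move=> pP pD exf exg; have [fi es _] := exf; have [gi es' _] := exg.
have [u0 eu] := pP _ _ _ e es'; have [v0 ev] := pD _ _ _ e' es.
have [|u1 gu] := @exact_factor_r _ _ _ _ _ _ _ _ _ (u0 \c f) exg.
  by rewrite rcompA eu (exact_comp0 exf).
have [|v1 fv] := @exact_factor_r _ _ _ _ _ _ _ _ _ (v0 \c g) exf.
  by rewrite rcompA ev (exact_comp0 exg).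
have [|s fs] := @exact_factor_r _ _ _ _ _ _ _ _ _ (v0 \c u0 - rid _) exf.
  by rewrite rcompBr rcompA ev eu rcomp1r subrr.
have [|t gt] := @exact_factor_r _ _ _ _ _ _ _ _ _ (u0 \c v0 - rid _) exg.
  by rewrite rcompBr rcompA eu ev rcomp1r subrr.
exists u1, u0, v1, v0, s, t; split; rewrite //=; split=> //.
  apply: (rinj_can fi); rewrite rcompBr !rcompA fv fs rcomp1r rcompBl rcomp1l.
  by rewrite -!rcompA gu.
apply: (rinj_can gi); rewrite rcompBr !rcompA gu gt rcomp1r rcompBl rcomp1l.
by rewrite -!rcompA fv.
Qed.

(** A common summand on which both differentials vanish can be added to the
    terms of degree one. *)
Lemma homotopy_split K P0 L D0 P1 D1 G (f : rhom P1 P0) (g : rhom D1 D0)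
    i1 i2 p1 p2 j1 j2 q1 q2 :
  @biprod _ _ _ P1 K G i1 i2 p1 p2 -> @biprod _ _ _ D1 L G j1 j2 q1 q2 ->
  f \c i2 = 0 -> g \c j2 = 0 ->
  homotopy_equiv (Cplx (f \c i1)) (Cplx (g \c j1)) -> homotopy_equiv (Cplx f) (Cplx g).
Proof.
move=> H H' fi2 gj2 [u1 [u0 [v1 [v0 [s [t [/= gu fv [vu1 vu0] [uv1 uv0]]]]]]]].
have [h1 h2 h] := H; have [h12 h21] := biprod0 H.
have [g1 g2 g'] := H'; have [g12 g21] := biprod0 H'.
have fE : f = f \c i1 \c p1.
  by rewrite -{1}[f]rcomp1r -h rcompDr !rcompA fi2 rcomp0l addr0.
have gE : g = g \c j1 \c q1.
  by rewrite -{1}[g]rcomp1r -g' rcompDr !rcompA gj2 rcomp0l addr0.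
exists (j1 \c u1 \c p1 + j2 \c p2), u0, (i1 \c v1 \c q1 + i2 \c q2), v0, (i1 \c s), (j1 \c t).
split; rewrite /=.
- by rewrite rcompDr !rcompA gj2 rcomp0l addr0 gu [in RHS]fE !rcompA.
- by rewrite rcompDr !rcompA fi2 rcomp0l addr0 fv [in RHS]gE !rcompA.
- split; last by rewrite vu0 rcompA.
  rewrite rcompDl !rcompDr !rcompA (rcompK _ g1) (rcompK0 _ g21) (rcompK0 _ g12) (rcompK _ g2).
  rewrite !rcomp0l add0r addr0 -h opprD addrACA subrr addr0 [in RHS]fE !rcompA.
  have := congr1 (fun x => i1 \c x \c p1) vu1.
  by rewrite /= rcompBr rcompBl rcomp1r !rcompA => ->.
- split; last by rewrite uv0 rcompA.
  rewrite rcompDl !rcompDr !rcompA (rcompK _ h1) (rcompK0 _ h21) (rcompK0 _ h12) (rcompK _ h2).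
  rewrite !rcomp0l add0r addr0 -g' opprD addrACA subrr addr0 [in RHS]gE !rcompA.
  have := congr1 (fun x => j1 \c x \c q1) uv1.
  by rewrite /= rcompBr rcompBl rcomp1r !rcompA => ->.
Qed.

Lemma bisum_projective N A B : bisum N A B -> projective A -> projective B -> projective N.
Proof.
move=> [i1 [i2 [p1 [p2 [h1 h2 h]]]]] pA pB X Y g f gs.
have [a ga] := pA _ _ _ (f \c i1) gs; have [b gb] := pB _ _ _ (f \c i2) gs.
exists (a \c p1 + b \c p2).
by rewrite rcompDr !rcompA ga gb -!rcompA -rcompDr h rcomp1r.
Qed.

(** u1 v1 - 1 = t d makes the identity of deg1 D factor through deg1 C + deg0 D. *)
Lemma homotopy_projective (C D : cplx k Q) : homotopy_equiv C D ->
  projective (deg1 C) -> projective (deg0 D) -> projective (deg1 D).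
Proof.
move=> [u1 [u0 [v1 [v0 [s [t [_ _ _ [uv _]]]]]]]] pC pD.
have [i1 [i2 [p1 [p2 H]]]] := bsum_biprod (deg1 C) (deg0 D).
have [h1 h2 h] := H; have [h12 h21] := biprod0 H.
have S : bisum (bsum (deg1 C) (deg0 D)) (deg1 C) (deg0 D) by exists i1, i2, p1, p2.
apply: (retract_projective (i := i1 \c v1 - i2 \c diff D) (p := u1 \c p1 + t \c p2)).
  rewrite rcompDl !rcompBr !rcompA (rcompK _ h1) (rcompK0 _ h12) (rcompK0 _ h21) (rcompK _ h2).
  by rewrite !rcomp0l subr0 sub0r -uv opprB addrC subrK.
exact: bisum_projective S pC pD.
Qed.

Lemma zero_projective M : is_zero M -> projective M.
Proof.
move=> /zero_hom0 z X Y g h gs; exists 0; rewrite rcomp0r.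
by rewrite -[h]rcomp1r z rcomp0r.
Qed.

Lemma minimal_cover P N (p : rhom P N) : projective P -> rsurjective p ->
  exists P' (e : rhom P' N), [/\ projective P', rsurjective e &
    forall X (e' : rhom X N), projective X -> rsurjective e' -> (tdim P' <= tdim X)%N].
Proof.
move=> pP sp.
have [m [[P' [e [pP' se dP']]] Hm]] : exists m,
    (exists X (e : rhom X N), [/\ projective X, rsurjective e & tdim X = m]) /\
    forall j, (exists X (e : rhom X N), [/\ projective X, rsurjective e & tdim X = j]) ->
      (m <= j)%N.
  by apply: min_exists; exists (tdim P), P, p.
exists P', e; split=> // X e' pX se'; rewrite dP'; apply: Hm.
by exists X, e'.
Qed.

End Resolutions.

Section Covers.
Variables (k : closedFieldType) (n : nat) (Q : quiver n).
Notation rep := (rep k Q).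
Implicit Types A B K L M N P X Y : rep.

(** Otherwise the nilpotent part of f splits off, and since e f = e it lies in
    the kernel of e; the complement still maps onto N. *)
Lemma minimal_cover_iso P N (e : rhom P N) (f : rhom P P) :
  projective P -> rsurjective e ->
  (forall X (e' : rhom X N), projective X -> rsurjective e' -> (tdim P <= tdim X)%N) ->
  e \c f = e -> is_iso f.
Proof.
move=> pP se minP ef; have [r nr r0] := annihilator f.
have [r_0|nr0] := boolP (root r 0); last first.
  rewrite -[f]pevalX; apply: coprime_iso r0.
  by rewrite coprimep_sym -['X]subr0 -polyC0 coprimep_XsubC.
have [q [m [rE cq nq sq]]] := mult_root nr r_0.
rewrite polyC0 subr0 in rE cq.
have [||i [ii fi Xi qi]] := @coprime_idem _ _ _ _ f 'X^m q.
- by rewrite coprimep_sym.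
- by rewrite mulrC -rE.
have eXm l : e \c peval f 'X^l = e.
  elim: l => [|l IH]; first by rewrite expr0 pevalC scale1r rcomp1r.
  by rewrite exprS pevalM pevalX rcompA ef.
have ei : e \c i = 0 by rewrite -(eXm m) -rcompA Xi rcomp0r.
have [A [B [i1 [i2 [p1 [p2 [H ip]]]]]]] := bisum_idem ii.
have [h1 h2 h] := H.
have S : bisum P A B by exists i1, i2, p1, p2.
have zA : is_zero A.
  apply/tdim0/eqP; rewrite -leqn0 -(leq_add2r (tdim B)) add0n -(tdim_bisum S).
  apply: (minP B (e \c i2)); first exact: retract_projective h2 pP.
  apply: rsurjPn => v y; have [x ->] := rsurjP se y; exists (p2.|[v] x).
  rewrite -comp_lfunE -rcompE -rcompA; have -> : i2 \c p2 = rid P - i.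
    by rewrite -h ip addrC addKr.
  by rewrite rcompBr ei subr0 rcomp1r.
have i0 : i = 0.
  by rewrite -ip -[p1]rcomp1l; move/zero_hom0: zA => ->; rewrite rcomp0l rcomp0r.
rewrite i0 subr0 rcomp1r in qi.
rewrite -[f]pevalX; apply: coprime_iso qi; rewrite coprimep_sym.
by case: m rE cq {Xi} => [rE|m rE]; [rewrite rE expr0 mulr1 ltnn in sq | rewrite coprimep_pexpr].
Qed.

(** A projective of least dimension over N is a cover: if e h is onto, then a
    lift l of e along e h gives the endomorphism h l over N. *)
Lemma projective_cover_exists P N (p : rhom P N) : projective P -> rsurjective p ->
  exists P' (e : rhom P' N), projective_cover e.
Proof.
move=> pP sp; have [P' [e [pP' se min]]] := minimal_cover pP sp.
exists P', e; split=> // X h s_eh.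
have [l el] := pP' _ _ _ e s_eh.
have := minimal_cover_iso pP' se min (f := h \c l); rewrite rcompA => /(_ el)/iso_surj sf.
apply: rsurjPn => v y; have [x ->] := rsurjP sf y; exists (l.|[v] x).
by rewrite rcompE comp_lfunE.
Qed.

Lemma decomp_rsum M s : decomp M s -> exists N : nat -> rep,
  (forall j, (j < size s)%N -> indecomposable (N j) /\ dim_vec (N j) = s`_j) /\
  riso M (rsum (fun j : 'I_(size s) => N j)).
Proof.
elim=> {M s} [M z|M A B s S iA _ [N [HN BN]]].
  exists (fun=> M); split=> //; set Z := rsum _.
  have zZ : rid Z = 0 by apply: rprj_ext => -[].
  by exists 0, 0; split; rewrite rcomp0l; apply/esym => //; apply/zero_hom0.
exists (fun j => if j is j'.+1 then N j' else A); split; first by case=> [|j] // /HN.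
apply: bisum_uniq (bisum_iso (riso_refl _) (riso_refl _) BN S) _.
exact: (rsum_ord_recl (fun j : 'I_(size s).+1 => if val j is j'.+1 then N j' else A)).
Qed.

End Covers.

(** * Splitting the general presentation *)

Section SumExact.
Variables (k : fieldType) (n : nat) (Q : quiver n).
Notation rep := (rep k Q).
Implicit Types (I J : finType) (K L M N P : rep).

Lemma rprj_hom I (A B : I -> rep) (f : forall i, rhom (A i) (B i)) i :
  rprj B i \c rsum_hom f = f i \c rprj A i.
Proof.
apply: rhom_ext => v x.
by rewrite !rcompE !comp_lfunE !rprjE mk_rhomE dmapE.
Qed.

Lemma rsum_hom_inj I (A B : I -> rep) (f : forall i, rhom (A i) (B i)) i :
  rsum_hom f \c rinj A i = rinj B i \c f i.
Proof.
apply: rprj_ext => j; rewrite !rcompA rprj_hom -rcompA.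
have [<-|ij] := eqVneq i j; first by rewrite !rprj_inj rcomp1l rcomp1r.
by rewrite !rprj_inj0 // rcomp0l rcomp0r.
Qed.

Lemma rsum_incl_inj I J (A : I -> rep) (phi : J -> I) j :
  rsum_incl A phi \c rinj (fun j => A (phi j)) j = rinj A (phi j).
Proof.
rewrite rcomp_suml (bigD1 j) //= (rcompK _ (rprj_inj _ _)) big1 ?addr0 // => l lj.
by rewrite -rcompA rprj_inj0 ?rcomp0r // eq_sym.
Qed.

Lemma rsum_hom_incl I J (A B : I -> rep) (f : forall i, rhom (A i) (B i)) (phi : J -> I) :
  rsum_hom f \c rsum_incl A phi = rsum_incl B phi \c rsum_hom (fun j => f (phi j)).
Proof.
apply: rinj_ext => j; rewrite -!rcompA rsum_incl_inj !rsum_hom_inj rcompA rsum_incl_inj.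
by [].
Qed.

Lemma rsum_zero I (A : I -> rep) : (forall i, is_zero (A i)) -> is_zero (rsum A).
Proof. by move=> z v; rewrite rsum_dim big1 // => i _; apply: z. Qed.

Lemma rsum_exact I (A B C : I -> rep) (i : forall j, rhom (A j) (B j))
    (p : forall j, rhom (B j) (C j)) :
  (forall j, short_exact (i j) (p j)) -> short_exact (rsum_hom i) (rsum_hom p).
Proof.
move=> ex; split.
- apply: rinjPn => v x y; rewrite !mk_rhomE => /dprodP e; apply/dprodP => j.
  by have := e j; rewrite !dmapE; case: (ex j) => ij _ _; apply: (rinjP ij).
- apply: rsurjPn => v y.
  have /fin_all_exists[x Hx] : forall j, exists x, dapp y j = (p j).|[v] x.
    by move=> j; case: (ex j) => _ pj _; apply: (rsurjP pj).
  exists (dmk x); rewrite mk_rhomE; apply/dprodP => j.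
  by rewrite dmapE dmkE Hx.
move=> v; apply/eqP; rewrite eqEsubv !mk_rhomE; apply/andP; split; apply/subvP => x.
  case/memv_imgP => y _ ->; rewrite memv_ker; apply/eqP/dprodP => j.
  rewrite !dmapE -comp_lfunE -rcompE (exact_comp0 (ex j)) at0 zero_lfunE.
  by rewrite [RHS]dmkE.
rewrite memv_ker => /eqP/dprodP px.
have /fin_all_exists[y Hy] : forall j, exists y, (i j).|[v] y = dapp x j.
  move=> j; case: (ex j) => _ _ H; have : dapp x j \in lker (p j).|[v].
    by rewrite memv_ker; have := px j; rewrite dmapE => ->; rewrite [X in X == _]dmkE.
  by rewrite -H => /memv_imgP[y _ ->]; exists y.
apply/memv_imgP; exists (dmk y); rewrite ?memvf //; apply/dprodP => j.
by rewrite dmapE dmkE Hy.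
Qed.

Lemma exact_iso K P M P' M' (i : rhom K P) (p : rhom P M) (u : rhom P P') u' (a : rhom M M') :
  short_exact i p -> u' \c u = rid P -> u \c u' = rid P' -> is_iso a ->
  short_exact (u \c i) (a \c p \c u').
Proof.
move=> [ii sp ex] h1 h2 ia; split.
- by apply: rinj_comp => //; apply: retr_inj h1.
- apply: rsurj_comp; last exact: retr_surj h1.
  by apply: rsurj_comp => //; apply: iso_surj.
move=> v; apply/eqP; rewrite eqEsubv; apply/andP; split; apply/subvP => x.
  case/memv_imgP => y _ ->; rewrite memv_ker -comp_lfunE -rcompE.
  rewrite !rcompA (rcompK _ h1) -(rcompA a) (exact_comp0 (And3 ii sp ex)) rcomp0r.
  by rewrite at0 zero_lfunE.
rewrite memv_ker -rcompA rcompE comp_lfunE => /eqP ax.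
have : u'.|[v] x \in lker p.|[v].
  rewrite memv_ker -comp_lfunE -rcompE; apply/eqP; apply: (rinjP (iso_inj ia)).
  by rewrite ax linear0.
rewrite -ex => /memv_imgP[y _ e]; apply/memv_imgP; exists y; rewrite ?memvf //.
by rewrite rcompE comp_lfunE -e -comp_lfunE -rcompE h2 ridE id_lfunE.
Qed.

Lemma biprod_zero M A B (i1 : rhom A M) i2 p1 (p2 : rhom M B) :
  biprod i1 i2 p1 p2 -> is_zero B -> i1 \c p1 = rid M.
Proof.
move=> [_ _ h] /zero_hom0 z.
by rewrite -h -[p2]rcomp1l z rcomp0l rcomp0r addr0.
Qed.

End SumExact.

Section MinimalSplitting.
Variables (k : closedFieldType) (n : nat) (Q : quiver n).
Notation rep := (rep k Q).

(** Let C j be a minimal resolution of the j-th summand of M.  Their sum and the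
    restriction of f to K resolve the same module, so they are homotopy
    equivalent; this also shows that the kernels of the covers are projective. *)
Theorem minimal_splitting (Y : finType) (Z : Y -> rep) (K P0 P1 M : rep) (f : rhom P1 P0)
    i1 i2 p1 p2 (e : rhom P0 M) (betas : seq 'cV[nat]_n) :
  projective K -> projective P0 ->
  @biprod _ _ _ P1 K (rsum Z) i1 i2 p1 p2 -> f \c i2 = 0 ->
  decomp M betas -> short_exact (f \c i1) e ->
  exists C : 'I_(size betas) -> cplx k Q,
    (forall j : 'I_(size betas), exists N : rep,
      [/\ indecomposable N, dim_vec N = betas`_j & minimal_projective_resolution (C j) N]) /\
    homotopy_equiv (Cplx f) (csum (fun x : 'I_(size betas) + Y =>
      match x with inl j => C j | inr y => @Cplx k n Q (Z y) (zero_rep k Q) 0 end)).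
Proof.
move=> pK pP S fi2 dM ex.
have [N [HN MN]] := decomp_rsum dM; pose J : finType := 'I_(size betas).
have [m [m' [m1 m2]]] := MN; have [_ se _] := ex.
have cov (j : J) : exists C : cplx k Q, exists p : rhom (deg0 C) (N j),
    projective_cover p /\ short_exact (diff C) p.
  have sj : rsurjective (rprj (fun j : J => N j) j \c m \c e).
    apply: rsurj_comp => //; apply: rsurj_comp; last exact: retr_surj m2.
    exact: retr_surj (rprj_inj _ j).
  have [P [p pc]] := projective_cover_exists pP sj; have [K' [i [ii im]]] := kernel_exists p.
  by exists (Cplx i), p; split=> //; case: pc => _ sp _; split.
have {cov}/fin_all_exists[C /fin_all_exists[p Hp]] := cov.
pose F (x : J + Y) : cplx k Q :=
  match x with inl j => C j | inr y => @Cplx k n Q (Z y) (zero_rep k Q) 0 end.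
pose D1 x := deg1 (F x); pose D0 x := deg0 (F x); pose dF x : rhom (D1 x) (D0 x) := diff (F x).
have S1 := rsum_sumtype D1; have S0 := rsum_sumtype D0.
have z0 : is_zero (rsum (fun y => D0 (inr y))) by apply: rsum_zero => y; apply: zero_repP.
have iso0 := biprod_zero S0 z0; have [ret0 _ _] := S0.
have ex' : short_exact (rsum_hom dF \c rsum_incl D1 inl)
    (m' \c rsum_hom p \c rsum_restr D0 inl).
  rewrite rsum_hom_incl; apply: exact_iso ret0 iso0 _; last by exists m.
  by apply: (@rsum_exact _ _ _ J (fun j => D1 (inl j)) (fun j => D0 (inl j))) => j; case: (Hp j).
have pD : projective (rsum D0).
  apply: rsum_projective => -[j|y]; first by case: (Hp j) => -[].
  by apply: zero_projective; apply: zero_repP.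
have dZ : rsum_hom dF \c rsum_incl D1 inr = 0.
  rewrite rsum_hom_incl; apply: rinj_ext => y; rewrite rcomp0l -rcompA.
  have /= -> := rsum_hom_inj (fun y : Y => dF (inr y)) y.
  by rewrite !rcomp0r.
have heq := resolution_homotopy pP pD ex ex'.
exists C; split; last exact: (homotopy_split S S1 fi2 dZ heq).
move=> j; have [iN dN] := HN j (ltn_ord j); exists (N j); split=> //; split; last by exists (p j).
have := homotopy_projective heq pK pD => /=.
exact: retract_projective (rprj_inj (fun j => D1 (inl j)) j).
Qed.

End MinimalSplitting.

Lemma proj_shift_dim (k : fieldType) (n : nat) (Q : quiver n) (v : 'I_n) : acyclic Q ->
  dim_vec_cplx (proj_shift k Q v) = - (invmx (euler_mx Q)^T *m toZ (unitv v)).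
Proof.
move=> acyc; rewrite inv_euler //.
have tE (M : rep k Q) u : toZ (dim_vec M) u 0 = (\dim {:M u})%:Z by rewrite !mxE.
apply/matrixP => u j; rewrite (ord1 j) [LHS]mxE [X in _ + X]mxE !tE.
rewrite (zero_repP k Q u) proj_dim sub0r !mxE (bigD1 v) //= !mxE eqxx mulr1 big1 ?addr0 // => w wv.
by rewrite !mxE (negPf wv) mulr0.
Qed.

Theorem theorem6p3p1 (k : closedFieldType) (n : nat) (Q : quiver n)
    (Q_acyclic : acyclic Q) (alpha : 'cV[int]_n) :
  exists (betas : seq 'cV[nat]_n) (gamma : 'cV[nat]_n),
    [/\ canonical_decomposition k Q alpha betas gamma,
        forall (betas' : seq 'cV[nat]_n) (gamma' : 'cV[nat]_n),
          canonical_decomposition k Q alpha betas' gamma' ->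
          perm_eq betas' betas /\ gamma' = gamma
      & forall g0 g1 : 'cV[nat]_n, canonical_pair Q alpha g0 g1 ->
        for_general (fun f : pres_space k Q g0 g1 =>
          exists C : 'I_(size betas) -> cplx k Q,
            [/\ forall j : 'I_(size betas), exists M : rep k Q,
                  [/\ indecomposable M, dim_vec M = betas`_j
                    & minimal_projective_resolution (C j) M],
                forall x : {v : 'I_n & 'I_(gamma v 0)},
                  dim_vec_cplx (proj_shift k Q (tag x)) =
                  - (invmx (euler_mx Q)^T *m toZ (unitv (tag x)))
              & homotopy_equiv (Cplx f)
                  (csum (fun x : 'I_(size betas) + {v : 'I_n & 'I_(gamma v 0)} =>
                           match x with
                           | inl j => C j
                           | inr y => proj_shift k Q (tag y)
                           end))])].
Proof.
have [betas [gamma H]] := canonical_decomposition_exists k Q_acyclic alpha.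
exists betas, gamma; split=> // [betas' gamma'|g0 g1 [mu [gamma' [dis aE -> g1E]]]].
  exact: canonical_decomposition_uniq H.
have [dis' aE' _] := (canonical_decompositionP k Q_acyclic _ _ _).1 H.
rewrite inv_euler // in aE.
have [|muE gE] := pair_uniq Q_acyclic dis dis'; first by rewrite -aE -aE'.
subst gamma'.
have g1E' : toZ g1 = toZ (kappa Q mu) + toZ gamma by rewrite g1E toZ_kappa.
have D := canonical_type Q_acyclic H muE.
have /for_generalP[d [pd nz Hd]] := general_presentation Q_acyclic dis g1E' D.
apply/for_generalP; exists d; split=> // f /Hd[i1 [i2 [p1 [p2 [M [e [S fi2 dM ex]]]]]]].
have pK g : projective (projs k Q g) by exact: projs_projective.
have [C [HC heq]] := minimal_splitting
  (Z := fun x : {v : 'I_n & 'I_(gamma v 0)} => proj k Q (tag x)) (pK _) (pK _) S fi2 dM ex.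
by exists C; split=> // x; apply: proj_shift_dim.
Qed.
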